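(* Suppose that the behavior policy $\pi_b$ satisfies $\pi_b(a|s)>0$ for all $(s,a)$ and that the Markov chain $\{S_k\}$ induced by $\pi_b$ is irreducible and aperiodic. Let $\gamma_c\in(0,1)$ be a tunable constant and let $n$ be a positive integer with $n\geq \frac{2\log(\gamma_c)+\log(\kappa_{b,\min})}{2\log(\gamma)}$. Consider the off-policy natural actor-critic algorithm (defined in the context) with initial parameter $\theta_0\in\mathbb{R}^d$, actor stepsize $\beta=\log(|\mathcal{A}|)$, and critic stepsize $\alpha>0$ such that $\alpha (t_\alpha+n+1)\leq \frac{1-\gamma_c}{456 f(\gamma\zeta_{\pi})^2}$ for every target policy $\pi=\pi_\theta$, $\theta\in\mathbb{R}^d$, with output $\theta_{\hat T}$ and $\pi_{\hat T}=\pi_{\theta_{\hat T}}$. Then for any starting distribution $\mu$ on $\mathcal{S}$, in order to achieve $$V^{\pi^*}(\mu)-\mathbb{E}\left[V^{\pi_{\hat{T}}}(\mu)\right]\leq \epsilon+\frac{4\xi}{(1-\gamma)^2},$$ the number of samples required is of the size $$\mathcal{O}\left(\epsilon^{-3}\log^2(1/\epsilon)\right)\tilde{\mathcal{O}}\left(f(\gamma\zeta_{\max})^2\, n\,(1-\gamma)^{-8}(1-\gamma_c)^{-3}\lambda_{\min}^{-3}\right).$$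
   Context: $\tilde{\mathcal{O}}(\cdot)$ ignores logarithmic terms. MDP: finite state space $\mathcal{S}$, finite action space $\mathcal{A}$, transition matrices $\{P_a\}_{a\in\mathcal{A}}$ on $\mathcal{S}$, reward $\mathcal{R}:\mathcal{S}\times\mathcal{A}\to\mathbb{R}$ with $\max_{s,a}|\mathcal{R}(s,a)|\le 1$, discount factor $\gamma\in(0,1)$. A policy $\pi$ assigns to each $s$ a probability distribution $\pi(\cdot|s)$ on $\mathcal{A}$. $V^\pi(s)=\mathbb{E}_\pi[\sum_{k\ge0}\gamma^k\mathcal{R}(S_k,A_k)\mid S_0=s]$, $Q^\pi(s,a)=\mathbb{E}_\pi[\sum_{k\ge0}\gamma^k\mathcal{R}(S_k,A_k)\mid S_0=s,A_0=a]$, $V^\pi(\mu)=\sum_s\mu(s)V^\pi(s)$; $\pi^*$ is an optimal policy (maximizing $V^\pi(\mu)$; it can be chosen independently of $\mu$). Features: $\phi_1,\dots,\phi_d\in\mathbb{R}^{|\mathcal{S}||\mathcal{A}|}$ are linearly independent, $\phi(s,a)=(\phi_1(s,a),\dots,\phi_d(s,a))^\top\in\mathbb{R}^d$ satisfies $\|\phi(s,a)\|_1\le 1$ for all $(s,a)$, and $\Phi=[\phi_1,\dots,\phi_d]$. Softmax policies: $\pi_\theta(a|s)=\exp(\phi(s,a)^\top\theta)/\sum_{a'}\exp(\phi(s,a')^\top\theta)$, $\theta\in\mathbb{R}^d$. Behavior policy: $\{(S_k,A_k)\}_{k\ge0}$ is a single trajectory generated by $\pi_b$. $P$ denotes the transition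 matrix of $\{S_k\}$ under $\pi_b$, $\mu_b$ its unique stationary distribution, $\kappa_b(s,a)=\mu_b(s)\pi_b(a|s)$, $\kappa_{b,\min}=\min_{s,a}\kappa_b(s,a)$, $\mathcal{K}=\mathrm{diag}(\kappa_b)$, and $\lambda_{\min}$ is the smallest eigenvalue of the positive definite matrix $\Phi^\top\mathcal{K}\Phi$. $t_\alpha=\min\{k\ge0:\max_{s\in\mathcal{S}}\|P^k(s,\cdot)-\mu_b(\cdot)\|_{\mathrm{TV}}\le\alpha\}$ (TV is half the $\ell_1$ distance). $\zeta_\pi=\max_{s,a}\frac{\pi(a|s)}{\pi_b(a|s)}$, $\zeta_{\max}=\max_{s,a}\frac{1}{\pi_b(a|s)}$, $f(x)=n+1$ if $x=1$ and $f(x)=\frac{1-x^{n+1}}{1-x}$ if $x\neq1$. Bellman operator: $(\mathcal{T}_\pi Q)(s,a)=\mathcal{R}(s,a)+\gamma\sum_{s',a'}P_a(s,s')\pi(a'|s')Q(s',a')$, $\mathcal{T}_\pi^n$ its $n$-fold composition, $\Pi_{\kappa_b}=\Phi(\Phi^\top\mathcal{K}\Phi)^{-1}\Phi^\top\mathcal{K}$. $w_\pi\in\mathbb{R}^d$ is the unique solution (it exists and is unique under the stated condition on $n$) of $\Phi w=\Pi_{\kappa_b}\mathcal{T}_\pi^n(\Phi w)$. $\xi=\max_{\theta}\|Q^{\pi_\theta}-\Phi w_{\pi_\theta}\|_\infty$. Critic: given target policy $\pi$, samples $\{(S_k,A_k)\}_{0\le k\le K+n}$, stepsize $\alpha$ and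 initial $w_0$, with $\rho(s,a)=\pi(a|s)/\pi_b(a|s)$, for $k=0,\dots,K-1$ let $\delta_{k,i}=\mathcal{R}(S_i,A_i)+\gamma\rho(S_{i+1},A_{i+1})\phi(S_{i+1},A_{i+1})^\top w_k-\phi(S_i,A_i)^\top w_k$, $\Delta_{k,n}=\sum_{i=k}^{k+n-1}\gamma^{i-k}\bigl(\prod_{j=k+1}^{i}\rho(S_j,A_j)\bigr)\delta_{k,i}$, $w_{k+1}=w_k+\alpha\phi(S_k,A_k)\Delta_{k,n}$; output $w_K$. Off-policy natural actor-critic (input $\theta_0\in\mathbb{R}^d$): $\hat T$ is a uniform sample from $\{0,1,\dots,T-1\}$, independent of the trajectory. For $t=0,1,\dots$: let $w_t$ be the output of the critic with target policy $\pi_t=\pi_{\theta_t}$, initial vector $0$, stepsize $\alpha$, $K$ iterations, applied to the samples $\{(S_k,A_k)\}_{t(K+n)\le k\le(t+1)(K+n)}$ of the single trajectory; set $\theta_{t+1}=\theta_t+\beta w_t$. Output $\theta_{\hat T}$. The expectation is over the trajectory and $\hat T$. The parameters $\alpha$, $K$ and $T$ are to be chosen in terms of $\epsilon$. *)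

(* Defs.v *)
From HB Require Import structures.
From mathcomp Require Import all_boot all_order all_algebra.
From mathcomp Require Import all_classical all_reals all_analysis.

Set Implicit Arguments.
Unset Strict Implicit.
Unset Printing Implicit Defensive.

Import Order.TTheory GRing.Theory Num.Theory.
Import numFieldNormedType.Exports.

Local Open Scope classical_set_scope.
Local Open Scope ring_scope.

Definition is_pmf (R : realType) (T : finType) (p : T -> R) : Prop :=
  (forall x, 0 <= p x) /\ \sum_x p x = 1.

Record mdp (R : realType) (S A : finType) := Mdp {
  trans : A -> S -> S -> R;
  reward : S -> A -> R;
  discount : R;
  trans_pmf : forall a s, is_pmf (trans a s);
  reward_bounded : forall s a, `|reward s a| <= 1;
  discount_gt0 : 0 < discount;
  discount_lt1 : discount < 1 }.

(* pi s a stands for pi(a|s). *)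
Definition is_policy (R : realType) (S A : finType) (pi : S -> A -> R) : Prop :=
  forall s, is_pmf (pi s).

Section Values.
Variables (R : realType) (S A : finType) (M : mdp R S A).
Implicit Types (pi : S -> A -> R) (nu : S -> R) (init : S * A -> R).

Definition start_law pi nu (z : S * A) : R := nu z.1 * pi z.1 z.2.

(* Probability that the first N+1 state-action pairs are x 0, ..., x N when
   (S_0, A_0) has law init and pi is followed afterwards. *)
Definition path_law pi init (N : nat) (x : nat -> S * A) : R :=
  init (x 0%N) *
  \prod_(k < N) (trans M (x k).2 (x k).1 (x k.+1).1 *
                 pi (x k.+1).1 (x k.+1).2).

Definition truncated_return (N : nat) (x : nat -> S * A) : R :=
  \sum_(k < N.+1) discount M ^+ k * reward M (x k).1 (x k).2.

Definition expected_return pi init (N : nat) : R :=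
  \sum_(x : {ffun 'I_N.+1 -> S * A})
    path_law pi init N (fun k => x (inord k)) *
    truncated_return N (fun k => x (inord k)).

(* The expectation of the infinite discounted return is the limit of the
   expectations of its truncations: rewards are bounded and discount M < 1. *)
Definition V_fun pi (s : S) : R :=
  lim (expected_return pi (start_law pi (fun s' => (s' == s)%:R)) @ \oo).

Definition Q_fun pi (s : S) (a : A) : R :=
  lim (expected_return pi (fun z => (z == (s, a))%:R) @ \oo).

Definition V_mean pi nu : R := \sum_s nu s * V_fun pi s.

Definition is_optimal pistar nu : Prop :=
  is_policy pistar /\
  forall pi, is_policy pi -> V_mean pi nu <= V_mean pistar nu.

Definition bellman pi (Q : S -> A -> R) (s : S) (a : A) : R :=
  reward M s a + discount M *
    \sum_s' \sum_a' trans M a s s' * pi s' a' * Q s' a'.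

End Values.

Section Chain.
Variables (R : realType) (S A : finType) (M : mdp R S A) (pib : S -> A -> R).

Definition chain_mx : 'M[R]_#|S| :=
  \matrix_(i, j) \sum_a pib (enum_val i) a *
    trans M a (enum_val i) (enum_val j).

Definition kstep (k : nat) (s s' : S) : R :=
  (chain_mx ^+ k) (enum_rank s) (enum_rank s').

Definition irreducible_chain : Prop :=
  forall s s', exists k, 0 < kstep k s s'.

Definition aperiodic_chain : Prop :=
  forall s (g : nat),
    (forall k, (0 < k)%N -> 0 < kstep k s s -> (g %| k)%N) -> g = 1%N.

Definition is_stationary (mu : S -> R) : Prop :=
  is_pmf mu /\ forall s', \sum_s mu s * kstep 1 s s' = mu s'.

Definition tv_dist (p q : S -> R) : R := 2^-1 * \sum_s `|p s - q s|.

Definition mixed (mub : S -> R) (alpha : R) (k : nat) : Prop :=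
  forall s, tv_dist (kstep k s) mub <= alpha.

Definition t_mix (mub : S -> R) (alpha : R) : nat :=
  xget 0%N [set k | mixed mub alpha k /\
                    forall j, mixed mub alpha j -> (k <= j)%N].

(* The smallest c with t_alpha <= c * (1 + log (1 / alpha)) for all alpha in
   (0, 1); the set is bounded when the chain is irreducible and aperiodic,
   since the chain then mixes geometrically. *)
Definition mixing_constant (mub : S -> R) : R :=
  sup [set (t_mix mub alpha)%:R / (1 + ln alpha^-1)
      | alpha in [set alpha : R | 0 < alpha < 1]].

Definition kappa (mub : S -> R) (z : S * A) : R := start_law pib mub z.

(* The neutral element 1 is harmless since kappa <= 1. *)
Definition kappa_min (mub : S -> R) : R :=
  \big[Num.min/1]_(z : S * A) kappa mub z.

(* In the two maxima below all entries are nonnegative. *)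
Definition zeta (pi : S -> A -> R) : R :=
  \big[Num.max/0]_(z : S * A) (pi z.1 z.2 / pib z.1 z.2).

Definition zeta_max : R := \big[Num.max/0]_(z : S * A) (pib z.1 z.2)^-1.

End Chain.

(* The factor f(x) = 1 + x + ... + x^n. *)
Definition f_geom (R : realType) (n : nat) (x : R) : R :=
  if x == 1 then n.+1%:R else (1 - x ^+ n.+1) / (1 - x).

Section Features.
Variables (R : realType) (S A : finType) (M : mdp R S A).
Variables (d : nat) (phi : S -> A -> 'cV[R]_d).
Variables (pib : S -> A -> R) (mub : S -> R) (n : nat).

Definition lin (w : 'cV[R]_d) (s : S) (a : A) : R :=
  \sum_i phi s a i 0 * w i 0.

Definition Phi_mx : 'M[R]_(#|{: S * A}|, d) :=
  \matrix_(z, i) phi (enum_val z).1 (enum_val z).2 i 0.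

Definition features_free : Prop := row_free (Phi_mx^T).

Definition softmax (theta : 'cV[R]_d) (s : S) (a : A) : R :=
  expR (lin theta s a) / \sum_a' expR (lin theta s a').

Definition K_mx : 'M[R]_#|{: S * A}| :=
  diag_mx (\row_z kappa pib mub (enum_val z)).

Definition gram_mx : 'M[R]_d := Phi_mx^T *m K_mx *m Phi_mx.

Definition proj_mx_kappa : 'M[R]_#|{: S * A}| :=
  Phi_mx *m invmx gram_mx *m Phi_mx^T *m K_mx.

Definition is_min_eigenvalue (lam : R) : Prop :=
  eigenvalue gram_mx lam /\ forall x, eigenvalue gram_mx x -> lam <= x.

Definition vec_of (Q : S -> A -> R) : 'cV[R]_#|{: S * A}| :=
  \col_z Q (enum_val z).1 (enum_val z).2.

(* lin w is the vector Phi_mx *m w read as a function on S * A; the value 0 is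
   only taken when the projected equation has no solution. *)
Definition w_sol (pi : S -> A -> R) : 'cV[R]_d :=
  xget 0 [set w | Phi_mx *m w =
    proj_mx_kappa *m vec_of (iter n (bellman M pi) (lin w))].

(* The maximum over theta in R^d is read as a supremum. *)
Definition xi_err : R :=
  sup [set \big[Num.max/0]_(z : S * A)
         `|Q_fun M (softmax theta) z.1 z.2 -
           lin (w_sol (softmax theta)) z.1 z.2|
      | theta in [set: 'cV[R]_d]].

(* Below, z k is the k-th observed state-action pair. *)
Definition rho (pi : S -> A -> R) (z : S * A) : R :=
  pi z.1 z.2 / pib z.1 z.2.

Definition td_error (pi : S -> A -> R) (z : nat -> S * A)
    (w : 'cV[R]_d) (i : nat) : R :=
  reward M (z i).1 (z i).2
  + discount M * rho pi (z i.+1) * lin w (z i.+1).1 (z i.+1).2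
  - lin w (z i).1 (z i).2.

Definition nstep_td (pi : S -> A -> R) (z : nat -> S * A)
    (w : 'cV[R]_d) (k : nat) : R :=
  \sum_(k <= i < k + n)
    discount M ^+ (i - k) * (\prod_(k.+1 <= j < i.+1) rho pi (z j)) *
    td_error pi z w i.

Fixpoint critic (pi : S -> A -> R) (z : nat -> S * A) (alpha : R)
    (w0 : 'cV[R]_d) (k : nat) : 'cV[R]_d :=
  if k is k'.+1 then
    let w := critic pi z alpha w0 k' in
    w + (alpha * nstep_td pi z w k') *: phi (z k').1 (z k').2
  else w0.

Fixpoint actor (z : nat -> S * A) (theta0 : 'cV[R]_d) (alpha beta : R)
    (K t : nat) : 'cV[R]_d :=
  if t is t'.+1 then
    let theta := actor z theta0 alpha beta K t' in
    theta + beta *: critic (softmax theta)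
                      (fun k => z (t' * (K + n) + k)%N) alpha 0 K
  else theta0.

End Features.

Section Sampling.
Context (R : realType) (S A : finType) (M : mdp R S A).
Context (dsp : measure_display) (Omega : measurableType dsp).
Context (Pr : probability Omega R) (Z : nat -> Omega -> S * A).

Definition cylinder (N : nat) (x : nat -> S * A) : set Omega :=
  [set omega | forall k, (k <= N)%N -> Z k omega = x k].

(* Z is the state-action process of pi started from S_0 ~ nu. *)
Definition is_trajectory (pi : S -> A -> R) (nu : S -> R) : Prop :=
  (forall k z, measurable (Z k @^-1` [set z])) /\
  forall N x, Pr (cylinder N x) = (path_law M pi (start_law pi nu) N x)%:E.

Definition is_uniform_index (T : nat) (I : Omega -> 'I_T) : Prop :=
  forall t, measurable (I @^-1` [set t]) /\
            Pr (I @^-1` [set t]) = (T%:R^-1)%:E.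

Definition independent_index (T : nat) (I : Omega -> 'I_T) : Prop :=
  forall t N x,
    Pr (I @^-1` [set t] `&` cylinder N x) =
    (Pr (I @^-1` [set t]) * Pr (cylinder N x))%E.

End Sampling.

(* The argument X of the soft-O in the sample complexity. Each factor is at
   least 1 when f >= 1, n >= 1 and lam <= 1, so 1 + ln X dominates the logarithm
   of every parameter and soft-O(X) reads as X * (1 + ln X) ^+ p up to a
   constant. That constant absorbs the size of theta0 and of mixing_constant,
   which do not occur in X: both are independent of it, and both do slow the
   algorithm down. *)
Definition complexity_factor (R : realType) (f : R) (n : nat)
    (gamma gamma_c lam : R) : R :=
  f ^+ 2 * n%:R * (1 - gamma) ^- 8 * (1 - gamma_c) ^- 3 * lam ^- 3.

(* Main.v *)
Require Import Defs.
From HB Require Import structures.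
From mathcomp Require Import all_boot all_order all_algebra.
From mathcomp Require Import all_classical all_reals all_analysis.
From mathcomp Require Import ring lra zify.

(* The argument couples a mirror-descent regret bound for the actor with a
   Lyapunov bound for the critic.

   Actor. With Qhat_t = Phi w_t the update multiplies pi_t by exp (beta Qhat_t),
   so the cross entropy of pi* relative to pi_t telescopes against
   sum_a pi*(a|s) Qhat_t(s,a) and the log-partition function, and the latter is
   controlled by the improvement V^{t+1} - V^t up to the critic error.  Hence
   the average regret is O(1 / (T (1 - gamma)^2)) plus 2 / (1 - gamma)^2 times
   the average sup-norm error of the critic.

   Critic. The n-step temporal difference telescopes to
   (n-step return) - (current value); in stationary mean it is the projected
   Bellman residual, whose drift towards w_pi is at least (1 - gamma_c) lambda.
   For Markovian samples, add to |w - w_pi|^2 the term 2 alpha <w - w_pi, h>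
   with h a truncated solution of the Poisson equation of the sliding window
   chain.  The result decreases in conditional expectation up to a term of
   order alpha^2 (t_alpha + n + 1) f^2, whatever the past and the starting law,
   so the target policy may depend on the earlier samples.

   Expectations over the trajectory are finite sums of path probabilities, and
   conditioning is the summation over the last observation of a path. *)

Set Implicit Arguments.
Unset Strict Implicit.
Unset Printing Implicit Defensive.

Import Order.TTheory GRing.Theory Num.Theory.
Import numFieldNormedType.Exports.

Local Open Scope classical_set_scope.
Local Open Scope ring_scope.

(** * Expectations over finite trajectories *)

(** The final constant may depend only on [tau] and [B], so the sizes of [S], [A] and [d] must
    disappear. Hence errors are read in the sup norm, dual to the l1 bound on features, and the
    actor step ln|A| cancels the ln|A| of the initial cross entropy. The kernel of a target policy
    need not be nonexpansive in the kappa-weighted norm. Only the sup-norm factor gam^n is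
    available, and the lower bound on [n] pays for the conversion, which costs [kappa_min]. The
    exponents arise as follows, with g = 1 - gam and c = 1 - gamma_c. The critic needs squared error
    of order eps^2 g^4. Its limit has squared norm of order 1/(lam g^2 c), and the noise is divided
    by the drift c lam, so alpha is of order eps^2 g^6 c^2 lam^2 / (f^2 n) up to logarithms. Then K
    of order 1/(alpha c lam) and T of order 1/(eps g^2) multiply to eps^-3 f^2 n g^-8 c^-3
    lam^-3. *)

Section PathExpectation.
Variables (R : realType) (S A : finType) (M : mdp R S A).
Implicit Types (pi : S -> A -> R) (init : S * A -> R) (g : S * A -> R).

Definition kern pi (z z' : S * A) : R := trans M z.2 z.1 z'.1 * pi z'.1 z'.2.

Definition kern_op pi g (z : S * A) : R := \sum_x kern pi z x * g x.

Definition path_exp pi init (N : nat) (G : (nat -> S * A) -> R) : R :=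
  \sum_(x : {ffun 'I_N.+1 -> S * A})
    path_law M pi init N (fun k => x (inord k)) * G (fun k => x (inord k)).

(** Plays the role of measurability with respect to the first N+1 observations. *)
Definition prefix_det (T : Type) (N : nat) (G : (nat -> S * A) -> T) : Prop :=
  forall z z', (forall k, (k <= N)%N -> z k = z' k) -> G z = G z'.

Definition extend (N : nat) (z : nat -> S * A) (x : S * A) : nat -> S * A :=
  fun k => if (k <= N)%N then z k else x.

Lemma start_law_pmf pi (nu : S -> R) :
  is_policy pi -> is_pmf nu -> is_pmf (start_law pi nu).
Proof.
move=> hpi [nu0 nu1]; split=> [z|]; first by rewrite mulr_ge0 // (hpi z.1).1.
rewrite -(pair_bigA _ (fun s a => nu s * pi s a)) /= -nu1.
by apply: eq_bigr => s _; rewrite -big_distrr /= (hpi s).2 mulr1.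
Qed.

Lemma kern_pmf pi z : is_policy pi -> is_pmf (kern pi z).
Proof. by move=> hpi; apply: start_law_pmf (trans_pmf M z.2 z.1). Qed.

Lemma kern_ge0 pi z z' : is_policy pi -> 0 <= kern pi z z'.
Proof. by move=> hpi; apply: (kern_pmf z hpi).1. Qed.

Lemma pmf_sum_cst (T : finType) (p : T -> R) (c : R) :
  is_pmf p -> \sum_x p x * c = c.
Proof. by move=> [_ p1]; rewrite -big_distrl /= p1 mul1r. Qed.

Lemma pmf_sum_norm (T : finType) (p g : T -> R) (c : R) :
  is_pmf p -> (forall x, `|g x| <= c) -> `|\sum_x p x * g x| <= c.
Proof.
move=> hp hg; rewrite -[leRHS](pmf_sum_cst _ hp).
apply: le_trans (ler_norm_sum _ _ _) _; apply: ler_sum => x _.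
by rewrite normrM (ger0_norm (hp.1 x)) ler_wpM2l // hp.1.
Qed.

Lemma path_law_ge0 pi init N x :
  is_policy pi -> (forall z, 0 <= init z) -> 0 <= path_law M pi init N x.
Proof.
move=> hpi h0; rewrite mulr_ge0 // prodr_ge0 // => k _.
exact: (kern_ge0 (x k) (x k.+1) hpi).
Qed.

Lemma path_exp0 pi init G : path_exp pi init 0 G = \sum_z init z * G (fun=> z).
Proof.
rewrite /path_exp (reindex (fun z : S * A => [ffun _ : 'I_1 => z])) /=.
  apply: eq_bigr => z _; rewrite /path_law big_ord0 mulr1 ffunE.
  by congr (_ * G _); apply/funext => k; rewrite ffunE.
exists (fun x : {ffun 'I_1 -> S * A} => x ord0) => x _; first by rewrite ffunE.
by apply/ffunP => i; rewrite ffunE [i]ord1.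
Qed.

(** Tower property: the inner sum is the conditional expectation given the first N+1 observations. A
    path of length N+2 is split into its initial part and its last entry. *)
Lemma path_expS pi init N G : prefix_det N.+1 G ->
  path_exp pi init N.+1 G =
  path_exp pi init N (fun z => \sum_x kern pi (z N) x * G (extend N z x)).
Proof.
move=> hG; rewrite /path_exp.
pose h (p : {ffun 'I_N.+1 -> S * A} * (S * A)) : {ffun 'I_N.+2 -> S * A} :=
  [ffun i : 'I_N.+2 => extend N (fun k => p.1 (inord k)) p.2 i].
have hE p k : (k <= N.+1)%N ->
    h p (inord k) = extend N (fun k => p.1 (inord k)) p.2 k.
  by move=> hk; rewrite ffunE inordK.
rewrite (reindex h) /=; last first.
  exists (fun x : {ffun 'I_N.+2 -> S * A} =>
    ([ffun i : 'I_N.+1 => x (inord i)], x ord_max)) => [[x y] _|x _] /=.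
    congr (_, _); last by rewrite ffunE /extend /= ltnn.
    apply/ffunP => i; rewrite ffunE hE; last by rewrite ltnW // ltnS ltnW.
    by rewrite /extend -ltnS ltn_ord inord_val.
  apply/ffunP => i; rewrite ffunE /extend.
  case: ifPn => [iN|]; first by rewrite ffunE inordK ?ltnS // inord_val.
  rewrite -ltnNge => Ni; congr (x _); apply/val_inj => /=.
  by apply/eqP; rewrite eqn_leq Ni -ltnS ltn_ord.
rewrite -(pair_bigA _ (fun x y =>
  path_law M pi init N.+1 (fun k => h (x, y) (inord k)) *
  G (fun k => h (x, y) (inord k)))) /=.
apply: eq_bigr => x _; rewrite big_distrr /=; apply: eq_bigr => y _.
rewrite mulrA; congr (_ * _); last by apply: hG => k hk; rewrite hE.
rewrite /path_law big_ord_recr /= !mulrA; congr (_ * _ * _ * _).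
- by rewrite hE // /extend.
- apply: eq_bigr => k _; have kN := ltn_ord k.
  have [k1 k2] : (k <= N.+1)%N /\ (k.+1 <= N.+1)%N by lia.
  by rewrite !hE // /extend (ltnW kN) kN.
- by rewrite !hE // /extend leqnn ltnn.
- by rewrite !hE // /extend ltnn.
Qed.

Lemma path_expD pi init N G H :
  path_exp pi init N (fun z => G z + H z) =
  path_exp pi init N G + path_exp pi init N H.
Proof. by rewrite -big_split /=; apply: eq_bigr => x _; rewrite mulrDr. Qed.

Lemma path_expZ pi init N (c : R) G :
  path_exp pi init N (fun z => c * G z) = c * path_exp pi init N G.
Proof. by rewrite big_distrr /=; apply: eq_bigr => x _; rewrite mulrCA. Qed.

Lemma path_exp_sum pi init N (I : Type) (r : seq I) (P : pred I)
    (G : I -> (nat -> S * A) -> R) :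
  path_exp pi init N (fun z => \sum_(i <- r | P i) G i z) =
  \sum_(i <- r | P i) path_exp pi init N (G i).
Proof.
by rewrite exchange_big /=; apply: eq_bigr => x _; rewrite big_distrr.
Qed.

Lemma path_exp_le pi init N G H : is_policy pi -> (forall z, 0 <= init z) ->
  (forall z, G z <= H z) -> path_exp pi init N G <= path_exp pi init N H.
Proof.
move=> hpi h0 hGH; apply: ler_sum => x _.
by rewrite ler_wpM2l // path_law_ge0.
Qed.

Lemma path_exp_marginal pi init N g :
  path_exp pi init N (fun z => g (z N)) =
  \sum_z init z * iter N (kern_op pi) g z.
Proof.
elim: N g => [|N IH] g; first by rewrite path_exp0.
rewrite path_expS; last by move=> z z' ->.
rewrite iterSr -IH; apply: eq_bigr => x _; congr (_ * _).
by apply: eq_bigr => y _; rewrite /extend ltnn.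
Qed.

(** Later observations sum out because each row of [kern] has mass one. This puts quantities of
    different blocks on one common horizon. *)
Lemma path_exp_widen pi init N m G : is_policy pi -> prefix_det N G ->
  path_exp pi init (N + m) G = path_exp pi init N G.
Proof.
move=> hpi hG; elim: m => [|m IH]; first by rewrite addn0.
rewrite addnS path_expS; last first.
  move=> z z' h; apply: hG => k kN; apply: h.
  by rewrite (leq_trans kN) // ltnW // ltnS leq_addr.
rewrite -IH; apply: eq_bigr => x _; congr (_ * _).
rewrite -[RHS](pmf_sum_cst _ (kern_pmf (x (inord (N + m))) hpi)).
apply: eq_bigr => y _; congr (_ * _); apply: hG => k kN.
by rewrite /extend (leq_trans kN) // leq_addr.
Qed.

Lemma path_exp_cst pi init N (c : R) : is_policy pi -> is_pmf init ->
  path_exp pi init N (fun=> c) = c.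
Proof.
move=> hpi hi; rewrite -[N]add0n path_exp_widen // path_exp0.
exact: pmf_sum_cst.
Qed.

End PathExpectation.

(** * Value functions *)

Lemma sum_pairE (V : nmodType) (I J : finType) (F : I * J -> V) :
  \sum_z F z = \sum_i \sum_j F (i, j).
Proof. by rewrite pair_bigA; apply: eq_bigr => -[]. Qed.

Lemma sum_cvg (R : realType) (I : finType) (u : nat -> I -> R) (l : I -> R) :
  (forall i, u N i @[N --> \oo] --> l i) ->
  \sum_i u N i @[N --> \oo] --> \sum_i l i.
Proof.
move=> hu; apply: cvg_big => [x|i _]; last exact: hu.
exact: add_continuous.
Qed.

Section ValueFunctions.
Variables (R : realType) (S A : finType) (M : mdp R S A) (pi : S -> A -> R).
Hypothesis pi_policy : is_policy pi.
Local Notation gam := (discount M).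
Local Notation T := (kern_op M pi).

Definition rew (z : S * A) : R := reward M z.1 z.2.

Lemma discount_compl_gt0 : 0 < 1 - gam.
Proof. by rewrite subr_gt0 discount_lt1. Qed.

Lemma kern_op_norm g (c : R) : (forall x, `|g x| <= c) ->
  forall z, `|T g z| <= c.
Proof. by move=> hg z; apply: pmf_sum_norm => //; apply: kern_pmf. Qed.

Lemma iter_kern_op_norm k g (c : R) : (forall x, `|g x| <= c) ->
  forall z, `|iter k T g z| <= c.
Proof. by move=> hg; elim: k => [|k IH] //=; apply: kern_op_norm. Qed.

Lemma rew_norm z : `|rew z| <= 1. Proof. exact: reward_bounded. Qed.

Definition trunc_Q (N : nat) (z : S * A) : R :=
  \sum_(k < N.+1) gam ^+ k * iter k T rew z.

Lemma expected_returnE init N :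
  expected_return M pi init N = \sum_z init z * trunc_Q N z.
Proof.
have -> : expected_return M pi init N =
    path_exp M pi init N (truncated_return M N) by [].
rewrite path_exp_sum; under [RHS]eq_bigr do rewrite big_distrr /=.
rewrite [RHS]exchange_big /=; apply: eq_bigr => k _.
rewrite (path_expZ M pi init N (gam ^+ k) (fun z => rew (z k))).
have kN : (k <= N)%N by rewrite -ltnS.
move: (nat_of_ord k) kN => {}k kN.
rewrite -(subnKC kN) path_exp_widen //; last by move=> z z' ->.
rewrite path_exp_marginal big_distrr; apply: eq_bigr => z _.
by rewrite mulrCA.
Qed.

Lemma trunc_QS N z : trunc_Q N.+1 z = rew z + gam * T (trunc_Q N) z.
Proof.
rewrite /trunc_Q big_ord_recl expr0 mul1r; congr (_ + _).
rewrite /kern_op; under [X in _ = _ * X]eq_bigr do rewrite big_distrr /=.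
rewrite exchange_big /= big_distrr /=; apply: eq_bigr => k _.
rewrite exprS -mulrA; congr (_ * _); rewrite big_distrr /=.
by apply: eq_bigr => x _; rewrite mulrCA.
Qed.

Lemma trunc_Q_cvg z : cvgn (fun N => trunc_Q N z).
Proof.
have -> : (fun N => trunc_Q N z) =
    (fun N => series (fun k => gam ^+ k * iter k T rew z) N.+1).
  by apply/funext => N; rewrite /series /= big_mkord.
apply/(cvg_ex _).2.
have : cvgn (series (fun k => gam ^+ k * iter k T rew z)).
  apply: normed_cvg; apply: (series_le_cvg (v_ := geometric 1 gam)) => [k|k|k|].
  - exact: normr_ge0.
  - by rewrite /= mul1r exprn_ge0 // ltW // discount_gt0.
  - rewrite /= mul1r normrM ger0_norm ?exprn_ge0 ?(ltW (discount_gt0 M)) //.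
    rewrite ler_piMr ?exprn_ge0 ?(ltW (discount_gt0 M)) //.
    exact: iter_kern_op_norm rew_norm z.
  - apply: is_cvg_geometric_series.
    by rewrite gtr0_norm ?discount_gt0 // discount_lt1.
by move=> /cvg_ex[l hl]; exists l; rewrite cvg_shiftS.
Qed.

Lemma Q_funE s a : Q_fun M pi s a = lim ((fun N => trunc_Q N (s, a)) @ \oo).
Proof.
rewrite /Q_fun; have -> // : expected_return M pi (fun z => (z == (s, a))%:R) =
  (fun N => trunc_Q N (s, a)).
apply/funext => N.
rewrite expected_returnE (bigD1 (s, a)) //= eqxx mul1r big1 ?addr0 // => z.
by move=> /negbTE ->; rewrite mul0r.
Qed.

Lemma trunc_Q_cvg_to z : (fun N => trunc_Q N z) @ \oo --> Q_fun M pi z.1 z.2.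
Proof. by rewrite Q_funE -surjective_pairing; apply: trunc_Q_cvg. Qed.

Lemma kern_op_cvg (u : nat -> S * A -> R) (l : S * A -> R) z :
  (forall x, (fun N => u N x) @ \oo --> l x) ->
  (fun N => T (u N) z) @ \oo --> T l z.
Proof.
move=> hu; apply: sum_cvg => x; apply: cvgM; [exact: cvg_cst|exact: hu].
Qed.

Lemma bellmanE Q s a :
  bellman M pi Q s a = rew (s, a) + gam * T (fun z => Q z.1 z.2) (s, a).
Proof.
rewrite /bellman /kern_op; congr (_ + _ * _).
by rewrite pair_bigA; apply: eq_bigr => -[s' a'] _.
Qed.

Lemma Q_fun_bellman s a : Q_fun M pi s a = bellman M pi (Q_fun M pi) s a.
Proof.
rewrite bellmanE Q_funE; apply: cvg_lim => //.
rewrite -cvg_shiftS /=.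
under eq_fun do rewrite trunc_QS.
apply: cvgD; first exact: cvg_cst.
apply: cvgM; first exact: cvg_cst.
by apply: kern_op_cvg => x; apply: trunc_Q_cvg_to.
Qed.

Lemma V_funE s : V_fun M pi s = \sum_a pi s a * Q_fun M pi s a.
Proof.
rewrite /V_fun; apply: cvg_lim => //.
have -> : expected_return M pi (start_law pi (fun s' => (s' == s)%:R)) =
    (fun N => \sum_a pi s a * trunc_Q N (s, a)).
  apply/funext => N; rewrite expected_returnE.
  rewrite sum_pairE (bigD1 s) //= [X in _ + X]big1 ?addr0.
    by apply: eq_bigr => a _; rewrite /start_law /= eqxx mul1r.
  by move=> s' /negbTE ss; apply: big1 => a _; rewrite /start_law /= ss !mul0r.
apply: sum_cvg => a; apply: cvgM; first exact: cvg_cst.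
exact: (@trunc_Q_cvg_to (s, a)).
Qed.

(** The Bellman equation turns the largest absolute value m into a solution of m <= 1 + gam m. *)
Lemma Q_fun_norm s a : `|Q_fun M pi s a| <= (1 - gam)^-1.
Proof.
pose m := \big[Num.max/0]_z `|Q_fun M pi z.1 z.2|.
have hm z : `|Q_fun M pi z.1 z.2| <= m.
  exact: (le_bigmax _ (fun z => `|Q_fun M pi z.1 z.2|)).
have g0 := ltW (discount_gt0 M).
have h z : `|Q_fun M pi z.1 z.2| <= 1 + gam * m.
  case: z => s' a'; rewrite Q_fun_bellman bellmanE.
  apply: le_trans (ler_normD _ _) _; apply: lerD; first exact: rew_norm.
  by rewrite normrM (ger0_norm g0) ler_wpM2l // kern_op_norm.
have m0 : 0 <= m by apply: bigmax_ge_id.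
have : m <= 1 + gam * m.
  by apply/bigmax_leP; split=> // ; rewrite addr_ge0 // mulr_ge0.
move=> hmm; apply: le_trans (hm (s, a)) _.
rewrite -[leRHS]mul1r ler_pdivlMr ?discount_compl_gt0 //.
by rewrite mulrBr mulr1 lerBlDr mulrC.
Qed.

Lemma V_fun_norm s : `|V_fun M pi s| <= (1 - gam)^-1.
Proof.
by rewrite V_funE; apply: pmf_sum_norm (pi_policy s) _ => a; apply: Q_fun_norm.
Qed.

End ValueFunctions.

(** * Natural policy gradient *)

Section MaximumPrinciple.
Variables (R : realType) (S : finType) (gam : R) (p : S -> S -> R).
Hypothesis p_pmf : forall s, is_pmf (p s).
Hypothesis gam01 : 0 <= gam < 1.

(** At a state maximizing [u] the average of [u] is at most [u] itself, so the recursion closes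
    there. This replaces sums over discounted visitation measures. *)
Lemma discounted_upper (u : S -> R) (b : R) :
  (forall s, u s <= gam * (\sum_s' p s s' * u s') + b) ->
  forall s, u s <= b / (1 - gam).
Proof.
move=> hu s; have /andP[gam0 gam1] := gam01.
have [s0 _ hs0] := @arg_maxP _ _ _ s xpredT u isT.
have {}hs0 s' : u s' <= u s0 by exact: hs0.
apply: le_trans (hs0 s) _; rewrite ler_pdivlMr ?subr_gt0 //.
rewrite mulrBr mulr1 lerBlDl [u s0 * gam]mulrC; apply: le_trans (hu s0) _.
rewrite lerD2r ler_wpM2l // -[leRHS](pmf_sum_cst _ (p_pmf s0)).
by apply: ler_sum => s' _; rewrite ler_wpM2l ?(p_pmf s0).1 // hs0.
Qed.

Lemma discounted_ge0 (u : S -> R) :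
  (forall s, gam * (\sum_s' p s s' * u s') <= u s) -> forall s, 0 <= u s.
Proof.
move=> hu s; have := @discounted_upper (fun s => - u s) 0 _ s.
rewrite mul0r oppr_le0; apply => s'; rewrite addr0.
under eq_bigr do rewrite mulrN.
by rewrite sumrN mulrN lerN2.
Qed.

End MaximumPrinciple.

(** Jensen for the exponential: factor out the exponential of the mean, then apply 1 + y <= exp y to
    the centred values. *)
Lemma expR_sum_pmf_ge (R : realType) (T : finType) (p x : T -> R) :
  is_pmf p -> expR (\sum_a p a * x a) <= \sum_a p a * expR (x a).
Proof.
move=> hp; set m := \sum_a _.
have -> : \sum_a p a * expR (x a) = expR m * \sum_a p a * expR (x a - m).
  rewrite big_distrr /=; apply: eq_bigr => a _.
  by rewrite mulrCA -expRD addrC subrK.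
rewrite ler_peMr ?expR_ge0 //.
have <- : \sum_a p a * (1 + (x a - m)) = 1.
  under eq_bigr do rewrite mulrDr mulr1 mulrBr.
  by rewrite big_split /= hp.2 sumrB (pmf_sum_cst _ hp) subrr addr0.
by apply: ler_sum => a _; rewrite ler_wpM2l ?hp.1 // expR_ge1Dx.
Qed.

Section Softmax.
Variables (R : realType) (S A : finType) (d : nat) (phi : S -> A -> 'cV[R]_d).
Hypothesis A_gt0 : (0 < #|A|)%N.

Lemma linD w w' s a : lin phi (w + w') s a = lin phi w s a + lin phi w' s a.
Proof. by rewrite -big_split /=; apply: eq_bigr => i _; rewrite mxE mulrDr. Qed.

Lemma linZ c w s a : lin phi (c *: w) s a = c * lin phi w s a.
Proof. by rewrite big_distrr /=; apply: eq_bigr => i _; rewrite mxE mulrCA. Qed.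

Lemma linB w w' s a : lin phi (w - w') s a = lin phi w s a - lin phi w' s a.
Proof. by rewrite -scaleN1r linD linZ mulN1r. Qed.

Lemma softmax_den_gt0 theta s : 0 < \sum_a expR (lin phi theta s a).
Proof.
have /card_gt0P[a _] := A_gt0.
by rewrite (bigD1 a) //= ltr_pwDl ?expR_gt0 // sumr_ge0 // => a' _.
Qed.

Lemma softmax_gt0 theta s a : 0 < softmax phi theta s a.
Proof. by rewrite divr_gt0 ?expR_gt0 // softmax_den_gt0. Qed.

Lemma softmax_policy theta : is_policy (softmax phi theta).
Proof.
move=> s; split=> [a|]; first exact/ltW/softmax_gt0.
by rewrite -big_distrl /= divff // gt_eqF // softmax_den_gt0.
Qed.

Lemma softmax_le1 theta s a : softmax phi theta s a <= 1.
Proof.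
rewrite -(softmax_policy theta s).2 (bigD1 a) //= lerDl sumr_ge0 // => a' _.
exact/ltW/softmax_gt0.
Qed.

Lemma softmax_update theta beta w s a :
  softmax phi (theta + beta *: w) s a =
  softmax phi theta s a * expR (beta * lin phi w s a) /
    \sum_a' softmax phi theta s a' * expR (beta * lin phi w s a').
Proof.
have hE b : expR (lin phi (theta + beta *: w) s b) =
    expR (lin phi theta s b) * expR (beta * lin phi w s b).
  by rewrite linD linZ expRD.
rewrite /softmax; set D := \sum_a' expR (lin phi theta s a').
have D0 : D != 0 by rewrite gt_eqF // softmax_den_gt0.
have -> : \sum_a' expR (lin phi theta s a') / D * expR (beta * lin phi w s a')
    = (\sum_a' expR (lin phi (theta + beta *: w) s a')) / D.
  by rewrite big_distrl /=; apply: eq_bigr => b _; rewrite hE mulrAC.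
have E0 : \sum_a' expR (lin phi (theta + beta *: w) s a') != 0.
  by rewrite gt_eqF // softmax_den_gt0.
rewrite hE; field; exact/andP.
Qed.

(** The logits lie in [-B, B], so each probability is at least exp(-2B)/|A|. Through this bound the
    size of the initial parameter enters the final constant. *)
Lemma softmax_init_ln (theta : 'cV[R]_d) (B : R) s a :
  (forall s a, \sum_i `|phi s a i 0| <= 1) ->
  (forall i, `|theta i 0| <= B) -> 0 <= B ->
  - ln (softmax phi theta s a) <= ln #|A|%:R + 2 * B.
Proof.
move=> hphi hB B0.
have hl b : `|lin phi theta s b| <= B.
  apply: le_trans (ler_norm_sum _ _ _) _; rewrite -[leRHS]mul1r.
  apply: le_trans (ler_wpM2r B0 (hphi s b)); rewrite big_distrl /=.
  by apply: ler_sum => i _; rewrite normrM ler_wpM2l.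
rewrite ln_div ?posrE ?expR_gt0 ?softmax_den_gt0 // expRK opprB.
have hs : ln (\sum_a' expR (lin phi theta s a')) <= ln (#|A|%:R * expR B).
  rewrite ler_ln ?posrE ?softmax_den_gt0 ?mulr_gt0 ?ltr0n ?expR_gt0 //.
  rewrite mulr_natl -sumr_const; apply: ler_sum => b _.
  by rewrite ler_expR; have := hl b; rewrite ler_norml => /andP[].
move: hs; rewrite lnM ?posrE ?ltr0n ?expR_gt0 // expRK.
by have := hl a; rewrite ler_norml => /andP[]; lra.
Qed.

End Softmax.

Section NaturalPolicyGradient.
Variables (R : realType) (S A : finType) (M : mdp R S A).
Local Notation gam := (discount M).

Definition state_kern (pi : S -> A -> R) (s s' : S) : R :=
  \sum_a pi s a * trans M a s s'.

Lemma state_kern_pmf pi s : is_policy pi -> is_pmf (state_kern pi s).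
Proof.
move=> hpi; split=> [s'|].
  by apply: sumr_ge0 => a _; rewrite mulr_ge0 ?(hpi s).1 ?(trans_pmf M a s).1.
rewrite exchange_big /= -(hpi s).2; apply: eq_bigr => a _.
by rewrite -big_distrr /= (trans_pmf M a s).2 mulr1.
Qed.

Lemma Q_fun_V pi s a : is_policy pi ->
  Q_fun M pi s a =
  reward M s a + gam * \sum_s' trans M a s s' * V_fun M pi s'.
Proof.
move=> hpi; rewrite Q_fun_bellman // /bellman; congr (_ + _ * _).
apply: eq_bigr => s' _; rewrite V_funE // big_distrr /=.
by apply: eq_bigr => a' _; rewrite mulrA.
Qed.

(** Kept as a fixed-point equation for the value gap, not unrolled, so that the maximum principle
    can solve it. *)
Lemma performance_difference pi pi' s : is_policy pi -> is_policy pi' ->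
  V_fun M pi' s - V_fun M pi s =
  gam * (\sum_s' state_kern pi' s s' * (V_fun M pi' s' - V_fun M pi s')) +
  ((\sum_a pi' s a * Q_fun M pi s a) - V_fun M pi s).
Proof.
move=> hpi hpi'; rewrite addrA; congr (_ - _); rewrite V_funE //.
have -> : \sum_s' state_kern pi' s s' * (V_fun M pi' s' - V_fun M pi s') =
  \sum_a pi' s a * \sum_s' trans M a s s' * (V_fun M pi' s' - V_fun M pi s').
  under [RHS]eq_bigr do rewrite big_distrr /=.
  rewrite exchange_big /=; apply: eq_bigr => s' _.
  by rewrite big_distrl /=; apply: eq_bigr => a _; rewrite mulrA.
rewrite big_distrr /= -big_split /=; apply: eq_bigr => a _.
rewrite mulrCA -mulrDr !Q_fun_V //; congr (_ * _).
under [X in _ = _ * X + _]eq_bigr do rewrite mulrBr.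
rewrite sumrB; ring.
Qed.

Variables (d : nat) (phi : S -> A -> 'cV[R]_d).
Hypothesis A_gt0 : (0 < #|A|)%N.
Variables (pistar : S -> A -> R) (beta : R).
Hypothesis pistar_policy : is_policy pistar.
Hypothesis beta_gt0 : 0 < beta.
Variables (theta w : nat -> 'cV[R]_d) (e : nat -> R).
Hypothesis theta_step : forall t, theta t.+1 = theta t + beta *: w t.
Hypothesis Q_err : forall t s a,
  `|Q_fun M (softmax phi (theta t)) s a - lin phi (w t) s a| <= e t.

Local Notation pol t := (softmax phi (theta t)).
Local Notation V t := (V_fun M (pol t)).

(** Equals KL(pistar || softmax) plus the entropy of [pistar]. The entropy cancels in differences,
    and no logarithm of a possibly zero [pistar s a] occurs. *)
Definition cross_entropy (th : 'cV[R]_d) (s : S) : R :=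
  - \sum_a pistar s a * ln (softmax phi th s a).

Lemma cross_entropy_ge0 th s : 0 <= cross_entropy th s.
Proof.
rewrite oppr_ge0; apply: sumr_le0 => a _.
by rewrite mulr_ge0_le0 ?(pistar_policy s).1 // ln_le0 // softmax_le1.
Qed.

(** The drop of the cross entropy divided by [beta] is the [pistar]-mean of the estimated Q minus ln
    Z / beta. It remains to bound g = ln Z / beta - V^t by the improvement: g >= -e by Jensen, and g
    - e is below the advantage of the new policy, so the performance difference gives g + e <=
    V^{t+1} - V^t + c. *)
Lemma npg_step t s :
  (\sum_a pistar s a * Q_fun M (pol t) s a) - V t s <=
  (cross_entropy (theta t) s - cross_entropy (theta t.+1) s) / beta +
  (V t.+1 s - V t s) + 2 * e t / (1 - gam).
Proof.
have hpol t' := softmax_policy phi A_gt0 (theta t').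
have g1 := discount_compl_gt0 M; have gam0 := ltW (discount_gt0 M).
pose Z s := \sum_a pol t s a * expR (beta * lin phi (w t) s a).
have Z0 s' : 0 < Z s'.
  apply: lt_le_trans (expR_sum_pmf_ge _ (hpol t s')); exact: expR_gt0.
have e0 : 0 <= e t.
  have /card_gt0P[a _] := A_gt0; exact: le_trans (Q_err t s a).
pose g s := ln (Z s) / beta - V t s.
have lin_mean (pi : S -> A -> R) s' : is_policy pi ->
    `|(\sum_a pi s' a * Q_fun M (pol t) s' a) -
      (\sum_a pi s' a * lin phi (w t) s' a)| <= e t.
  move=> hpi; rewrite -sumrB; under eq_bigr do rewrite -mulrBr.
  exact: pmf_sum_norm (hpi s') _.
have ln_step s' a : ln (pol t.+1 s' a) =
    ln (pol t s' a) + beta * lin phi (w t) s' a - ln (Z s').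
  have p0 := softmax_gt0 phi A_gt0 (theta t) s' a.
  have x0 := expR_gt0 (beta * lin phi (w t) s' a).
  rewrite theta_step softmax_update // ln_div ?posrE ?(mulr_gt0 p0 x0) ?Z0 //.
  by rewrite lnM ?posrE // expRK.
have lnZ_ge s' : beta * (\sum_a pol t s' a * lin phi (w t) s' a) <= ln (Z s').
  rewrite -ler_expR lnK ?posrE //.
  apply: le_trans (expR_sum_pmf_ge _ (hpol t s')).
  rewrite ler_expR big_distrr /=; apply: ler_sum => a _.
  by rewrite mulrCA.
have g_ge s' : - e t <= g s'.
  have := lin_mean _ s' (hpol t); rewrite -V_funE // ler_norml => /andP[_ h].
  have : \sum_a pol t s' a * lin phi (w t) s' a <= ln (Z s') / beta.
    by rewrite ler_pdivlMr // mulrC.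
  by rewrite /g; lra.
(* This is the nonnegativity of KL(pi_{t+1} || pi_t): tilting the new policy back by exp(ln Z - beta
   Qhat) returns the old one, of total mass one. *)
have improve s' : ln (Z s') / beta <=
    \sum_a pol t.+1 s' a * lin phi (w t) s' a.
  have := expR_sum_pmf_ge (fun a => ln (Z s') - beta * lin phi (w t) s' a)
    (hpol t.+1 s').
  have -> : \sum_a pol t.+1 s' a * expR (ln (Z s') - beta * lin phi (w t) s' a)
      = 1.
    rewrite -(hpol t s').2; apply: eq_bigr => a _.
    rewrite theta_step softmax_update // expRB lnK ?posrE //.
    rewrite -/(Z s'); field.
    by rewrite !gt_eqF ?Z0 ?expR_gt0.
  rewrite -[leRHS]expR0 ler_expR.
  under eq_bigr do rewrite mulrBr mulrCA.
  rewrite sumrB (pmf_sum_cst _ (hpol t.+1 s')) -big_distrr /= subr_le0 => h.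
  by rewrite ler_pdivrMr // mulrC.
have adv_ge s' : g s' - e t <=
    (\sum_a pol t.+1 s' a * Q_fun M (pol t) s' a) - V t s'.
  have := lin_mean _ s' (hpol t.+1); rewrite ler_norml => /andP[h _].
  by have := improve s'; rewrite /g; lra.
(* The shift c solves c - gam c = 2 e, which makes the source term g + e of the recursion for [v]
   nonnegative; then [v] itself is nonnegative. *)
have hc : 2 * e t / (1 - gam) - gam * (2 * e t / (1 - gam)) = 2 * e t.
  by field; rewrite gt_eqF.
set c := 2 * e t / (1 - gam) in hc *.
pose v s' := V t.+1 s' - V t s' + c.
have hv s' : gam * (\sum_s'' state_kern (pol t.+1) s' s'' * v s'') +
    (g s' + e t) <= v s'.
  rewrite /v; have -> : \sum_s'' state_kern (pol t.+1) s' s'' *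
      (V t.+1 s'' - V t s'' + c) =
      (\sum_s'' state_kern (pol t.+1) s' s'' * (V t.+1 s'' - V t s'')) + c.
    under eq_bigr do rewrite mulrDr.
    by rewrite big_split /= (pmf_sum_cst _ (state_kern_pmf s' (hpol t.+1))).
  rewrite [X in _ <= X + _]performance_difference // mulrDr.
  by have := adv_ge s'; lra.
have v0 : forall s', 0 <= v s'.
  apply: (@discounted_ge0 _ _ gam (state_kern (pol t.+1))).
  - by move=> s'; apply: state_kern_pmf.
  - by rewrite gam0 discount_lt1.
  - by move=> s'; have := hv s'; have := g_ge s'; lra.
have key : g s + e t <= V t.+1 s - V t s + c.
  rewrite -/(v s); apply: le_trans (hv s); rewrite lerDr mulr_ge0 //.
  apply: sumr_ge0 => s' _; rewrite mulr_ge0 //.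
  exact: (state_kern_pmf s (hpol t.+1)).1.
have hpsi : (cross_entropy (theta t) s - cross_entropy (theta t.+1) s) / beta =
    (\sum_a pistar s a * lin phi (w t) s a) - ln (Z s) / beta.
  rewrite /cross_entropy opprK addrC -sumrB.
  have -> : \sum_a (pistar s a * ln (pol t.+1 s a) -
                    pistar s a * ln (pol t s a)) =
     beta * (\sum_a pistar s a * lin phi (w t) s a) - ln (Z s).
    under eq_bigr do rewrite ln_step -mulrBr.
    rewrite -[X in _ = _ - X](pmf_sum_cst _ (pistar_policy s)) big_distrr /=.
    by rewrite -sumrB; apply: eq_bigr => a _; ring.
  by field; rewrite gt_eqF.
rewrite hpsi; have := lin_mean _ s pistar_policy.
rewrite ler_norml => /andP[_ h]; rewrite /g in key.
clear v0 hv v; clearbody c; clear hc; move: key h.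
move: (\sum_a pistar s a * Q_fun M (pol t) s a).
move: (\sum_a pistar s a * lin phi (w t) s a) (ln (Z s) / beta).
move: (V t s) (V t.+1 s) (e t) c => ? ? ? ? ? ? ?; lra.
Qed.

(** The maximum principle is applied after summing over t, since only the sum telescopes. What
    survives is the initial cross entropy, V^T - V^0 <= 2 / (1 - gam), and the critic errors. *)
Lemma npg_regret (T : nat) s :
  \sum_(t < T) (V_fun M pistar s - V t s) <=
  ((\big[Num.max/0]_s cross_entropy (theta 0%N) s) / beta +
    2 / (1 - gam) + 2 * (\sum_(t < T) e t) / (1 - gam)) / (1 - gam).
Proof.
set psi0 := \big[Num.max/0]_s _.
have hpol t' := softmax_policy phi A_gt0 (theta t').
have gam01 : 0 <= gam < 1 by rewrite ltW ?discount_gt0 // discount_lt1.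
move: s; apply: discounted_upper => [s|//|s].
  exact: state_kern_pmf pistar_policy.
have -> : \sum_(t < T) (V_fun M pistar s - V t s) =
    gam * (\sum_s' state_kern pistar s s' *
      (\sum_(t < T) (V_fun M pistar s' - V t s'))) +
    \sum_(t < T) ((\sum_a pistar s a * Q_fun M (pol t) s a) - V t s).
  under eq_bigr do rewrite performance_difference //.
  rewrite big_split /= -big_distrr /=; congr (_ * _ + _).
  by rewrite exchange_big /=; apply: eq_bigr => s' _; rewrite big_distrr.
rewrite lerD2l; apply: le_trans.
  by apply: ler_sum => t _; apply: npg_step.
rewrite !big_split /= -!big_distrl /= -big_distrr /=.
rewrite lerD2r.
have -> : \sum_(t < T) (cross_entropy (theta t) s - cross_entropy (theta t.+1) s)
    = cross_entropy (theta 0%N) s - cross_entropy (theta T) s.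
  rewrite -[LHS]opprK -sumrN.
  under eq_bigr do rewrite opprB.
  by rewrite -(big_mkord xpredT (fun t => cross_entropy (theta t.+1) s -
    cross_entropy (theta t) s)) telescope_sumr // opprB.
have -> : \sum_(t < T) V t.+1 s + \sum_(t < T) - V t s = V T s - V 0%N s.
  by rewrite -big_split /= -(big_mkord xpredT (fun t => V t.+1 s - V t s)) telescope_sumr.
apply: lerD.
  rewrite ler_pM2r ?invr_gt0 // lerBlDr ler_wpDr ?cross_entropy_ge0 //.
  exact: (le_bigmax _ (cross_entropy (theta 0%N))).
rewrite mulr_natl mulr2n; apply: lerD.
  exact: ler_normlW (V_fun_norm M (hpol T) s).
by rewrite lerNl; apply: lerNnormlW (V_fun_norm M (hpol 0%N) s).
Qed.

End NaturalPolicyGradient.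

(** * Geometric mixing *)

Section NumericalSemigroup.
Variable P : nat -> Prop.
Hypothesis P0 : P 0%N.
Hypothesis PD : forall j k, P j -> P k -> P (j + k)%N.

Lemma semigroup_mul q k : P k -> P (q * k)%N.
Proof. by move=> hk; elim: q => [|q IH] //; rewrite mulSn; apply: PD. Qed.

(* The least gap d between two elements divides every element: a remainder of
   the division by d would be a smaller gap. *)
Lemma semigroup_cofinite :
  (forall g, (forall k, (0 < k)%N -> P k -> (g %| k)%N) -> g = 1%N) ->
  exists N, forall k, (N <= k)%N -> P k.
Proof.
move=> hg.
pose gap d := (0 < d)%N /\ exists a, P a /\ P (a + d)%N.
have [d0 hd0] : exists d, gap d.
  have [k [k0 hk]] : exists k, (0 < k)%N /\ P k.
    apply: contrapT => h; suff : 2 = 1%N by [].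
    by apply: hg => k k0 hk; case: h; exists k.
  by exists k; split=> //; exists 0%N; rewrite add0n.
have [d /asboolP[d_gt0 [a [ha had]]] dmin] :=
  @ex_minnP (fun d => `[< gap d >]) (ex_intro _ d0 (asboolT hd0)).
have d1 : d = 1%N.
  apply: hg => k k0 hk; rewrite /dvdn; case: (posnP (k %% d)) => // r0.
  suff : (d <= k %% d)%N by rewrite leqNgt ltn_pmod.
  apply/dmin/asboolP; split=> //; exists (k %/ d * (a + d))%N; split.
    exact: semigroup_mul.
  have -> : (k %/ d * (a + d) + k %% d = k + k %/ d * a)%N.
    by have := divn_eq k d; set q := (k %/ d)%N; nia.
  by apply: PD => //; apply: semigroup_mul.
(* With gap one, both a and a + 1 are elements. For k >= a^2, write k = q a + r; then r <= q and k =
   (q - r) a + r (a + 1). *)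
exists (a * a)%N => k hk; case: (posnP a) => [a0|a0].
  by rewrite -[k]muln1; apply: semigroup_mul; rewrite -d1 -[d]add0n -a0.
have ra : (k %% a <= k %/ a)%N.
  by rewrite (leq_trans (ltnW (ltn_pmod k a0))) // leq_divRL.
have -> : k = ((k %/ a - k %% a) * a + k %% a * (a + d))%N.
  rewrite d1 mulnDr muln1 addnA -mulnDl subnK //; exact: divn_eq.
by apply: PD; apply: semigroup_mul.
Qed.

End NumericalSemigroup.

Section Mixing.
Variables (R : realType) (S A : finType) (M : mdp R S A) (pib : S -> A -> R).
Variable mub : S -> R.
Hypothesis pib_policy : is_policy pib.
Local Notation kstep := (kstep M pib).

Lemma kstep0 s s' : kstep 0 s s' = (s == s')%:R.
Proof. by rewrite /kstep expr0 mxE (inj_eq enum_rank_inj). Qed.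

Lemma kstepD j k s s' :
  kstep (j + k) s s' = \sum_t kstep j s t * kstep k t s'.
Proof.
rewrite /kstep exprD mxE (reindex enum_rank) //.
by exists enum_val => i _; rewrite ?enum_rankK ?enum_valK.
Qed.

Lemma kstep1 s s' : kstep 1 s s' = state_kern M pib s s'.
Proof. by rewrite /kstep expr1 mxE !enum_rankK. Qed.

Lemma kstep_pmf k s : is_pmf (kstep k s).
Proof.
elim: k s => [|k IH] s.
  split=> [s'|]; first by rewrite kstep0 ler0n.
  rewrite (bigD1 s) //= kstep0 eqxx big1 ?addr0 // => s'.
  by rewrite kstep0 eq_sym => /negbTE ->.
have hk := state_kern_pmf M s pib_policy.
split=> [s'|].
  rewrite -add1n kstepD sumr_ge0 // => t _.
  by rewrite kstep1 mulr_ge0 ?hk.1 // (IH t).1.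
under eq_bigr do rewrite -add1n kstepD.
rewrite exchange_big /= -hk.2; apply: eq_bigr => t _.
by rewrite -big_distrr /= (IH t).2 mulr1 kstep1.
Qed.

Lemma kstep_ge0 k s s' : 0 <= kstep k s s'. Proof. exact: (kstep_pmf k s).1. Qed.

Lemma kstep_gt0D j k s t s' :
  0 < kstep j s t -> 0 < kstep k t s' -> 0 < kstep (j + k) s s'.
Proof.
move=> h1 h2; rewrite kstepD (bigD1 t) //= ltr_pwDl ?mulr_gt0 //.
by apply: sumr_ge0 => u _; rewrite mulr_ge0 ?kstep_ge0.
Qed.

Hypothesis irr : irreducible_chain M pib.
Hypothesis aper : aperiodic_chain M pib.

(** Every state returns at all large times. A length [m] above all return thresholds plus all
    connecting path lengths leaves enough time to loop at [s] before walking to [s']. *)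
Lemma kstep_primitive : exists m, forall s s', 0 < kstep m s s'.
Proof.
have /choice[N hN] s : exists N, forall k, (N <= k)%N -> 0 < kstep k s s.
  apply: (@semigroup_cofinite (fun k => 0 < kstep k s s)); last exact: aper.
    by rewrite kstep0 eqxx.
  by move=> j k; apply: kstep_gt0D.
have /choice[l hl] (p : S * S) : exists k, 0 < kstep k p.1 p.2 by exact: irr.
pose m := (\sum_s N s + \sum_p l p)%N; exists m => s s'.
have hlm : (N s + l (s, s') <= m)%N.
  by rewrite /m (bigD1 s) // (bigD1 (s, s')) //= leq_add // leq_addr.
have hm : (N s <= m - l (s, s'))%N by rewrite leq_subRL; lia.
rewrite -[m](@subnK (l (s, s'))); last by apply: leq_trans hlm; rewrite leq_addl.
by apply: kstep_gt0D (hN _ _ hm) (hl (s, s')).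
Qed.

Hypothesis mub_stat : is_stationary M pib mub.

Lemma stationary_kstep k s' : \sum_s mub s * kstep k s s' = mub s'.
Proof.
elim: k s' => [|k IH] s'.
  rewrite (bigD1 s') //= kstep0 eqxx mulr1 big1 ?addr0 // => s.
  by rewrite kstep0 => /negbTE ->; rewrite mulr0.
under eq_bigr do rewrite -addn1 kstepD big_distrr /=.
rewrite exchange_big /= -[RHS](mub_stat.2); apply: eq_bigr => t _.
by under eq_bigr do rewrite mulrA; rewrite -big_distrl /= IH.
Qed.

Lemma stationary_gt0 s : 0 < mub s.
Proof.
have [m hm] := kstep_primitive; have [[mu0 mu1] _] := mub_stat.
rewrite lt_neqAle mu0 andbT; apply/negP => /eqP /esym mus.
move: (oner_neq0 R); rewrite -mu1 big1 ?eqxx // => t _.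
have := stationary_kstep m s; rewrite mus => /eqP.
rewrite psumr_eq0 => [/allP /(_ t)|u _]; last by rewrite mulr_ge0 ?kstep_ge0.
rewrite mem_index_enum => /(_ isT) /=.
by rewrite mulf_eq0 (gt_eqF (hm _ _)) orbF => /eqP.
Qed.

(** Doeblin minorization: since [x] has total mass zero, the common part eta * mub may be subtracted
    from every row, leaving nonnegative rows of mass 1 - eta. *)
Lemma l1_kstep_contract m eta (x : S -> R) : \sum_s x s = 0 ->
  (forall s s', eta <= kstep m s s') -> 0 <= eta ->
  \sum_s' `|\sum_s x s * kstep m s s'| <= (1 - eta) * \sum_s `|x s|.
Proof.
move=> x0 heta eta0; have [[mu0 mu1] _] := mub_stat.
have hge s s' : 0 <= kstep m s s' - eta * mub s'.
  rewrite subr_ge0; apply: le_trans (heta s s'); rewrite ler_piMr //.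
  by rewrite -mu1 (bigD1 s') //= lerDl sumr_ge0.
have hle s' : `|\sum_s x s * kstep m s s'| <=
    \sum_s `|x s| * (kstep m s s' - eta * mub s').
  have -> : \sum_s x s * kstep m s s' =
      \sum_s x s * (kstep m s s' - eta * mub s').
    under [RHS]eq_bigr do rewrite mulrBr.
    by rewrite sumrB -big_distrl /= x0 mul0r subr0.
  apply: le_trans (ler_norm_sum _ _ _) _; apply: ler_sum => s _.
  by rewrite normrM (ger0_norm (hge s s')).
apply: le_trans (ler_sum _ (fun s' _ => hle s')) _.
rewrite exchange_big /= big_distrr /=; apply: ler_sum => s _.
rewrite -big_distrr /= sumrB -big_distrr /= mu1 mulr1 (kstep_pmf m s).2.
by rewrite mulrC.
Qed.

(** After q blocks of m steps the distance is at most (1 - eta)^q <= exp(- eta q), so q just above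
    ln(1/alpha)/eta suffices. As eta <= 1, c = m/eta also covers the rounding. *)
Lemma geometric_mixing : exists c : R,
  forall alpha : R, 0 < alpha < 1 ->
  exists2 k, mixed M pib mub alpha k & k%:R <= c * (1 + ln alpha^-1).
Proof.
have [m hm] := kstep_primitive; have [[mu0 mu1] _] := mub_stat.
pose eta : R := \big[Num.min/1]_(p : S * S) kstep m p.1 p.2.
have eta0 : 0 < eta by apply/bigmin_gtP; split=> // p _; apply: hm.
have eta1 : eta <= 1 by apply: bigmin_le_id.
have heta s s' : eta <= kstep m s s'.
  exact: (bigmin_le _ (s, s') (fun p : S * S => kstep m p.1 p.2)).
have dist q s : \sum_s' `|kstep (q * m) s s' - mub s'| <= 2 * (1 - eta) ^+ q.
  elim: q => [|q IH].
    rewrite mul0n expr0 mulr1 -[2]/(1 + 1).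
    rewrite -{1}(kstep_pmf 0 s).2 -mu1 -big_split /=; apply: ler_sum => s' _.
    apply: le_trans (ler_normB _ _) _.
    by rewrite (ger0_norm (mu0 s')) (ger0_norm (kstep_ge0 _ _ _)).
  have -> : \sum_s' `|kstep (q.+1 * m) s s' - mub s'| =
      \sum_s' `|\sum_t (kstep (q * m) s t - mub t) * kstep m t s'|.
    apply: eq_bigr => s' _; congr `|_|.
    under [RHS]eq_bigr do rewrite mulrBl.
    by rewrite sumrB -kstepD stationary_kstep mulSnr.
  apply: le_trans (l1_kstep_contract _ heta (ltW eta0)) _.
    by rewrite sumrB mu1 (kstep_pmf _ s).2 subrr.
  by rewrite exprS mulrCA ler_wpM2l // subr_ge0.
exists (m%:R / eta) => alpha /andP[a0 a1].
have l0 : 0 <= ln alpha^-1 by rewrite ln_ge0 // invf_ge1 // ltW.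
pose q := (Num.truncn (ln alpha^-1 / eta)).+1.
have q0 : 0 <= ln alpha^-1 / eta by rewrite divr_ge0 // ltW.
have /andP[q1 q2] := truncn_itv q0; rewrite -/q in q2.
exists (q * m)%N.
  move=> s; rewrite /tv_dist ler_pdivrMl //.
  apply: le_trans (dist q s) _; rewrite ler_wpM2l //.
  have -> : alpha = expR (- ln alpha^-1).
    by rewrite expRN lnK ?posrE ?invr_gt0 // invrK.
  apply: (@le_trans _ _ (expR (- eta) ^+ q)).
    rewrite lerXn2r ?nnegrE ?subr_ge0 ?expR_ge0 //; exact: expR_ge1Dx.
  rewrite -expRM_natl ler_expR mulrN lerN2.
  by rewrite -ler_pdivrMr // ltW.
rewrite natrM [q%:R * _]mulrC -!mulrA ler_wpM2l // mulrC mulrDl mul1r addrC.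
rewrite -natr1 lerD // invf_ge1 //.
Qed.

Lemma t_mixP (alpha : R) : 0 < alpha < 1 ->
  mixed M pib mub alpha (t_mix M pib mub alpha) /\
  forall j, mixed M pib mub alpha j -> (t_mix M pib mub alpha <= j)%N.
Proof.
move=> ha; have [c hc] := geometric_mixing; have [k hk _] := hc _ ha.
rewrite /t_mix; case: xgetP => [t _ //|/(_ _) no].
have [t /asboolP ht tmin] := @ex_minnP (fun t => `[< mixed M pib mub alpha t >])
  (ex_intro _ k (asboolT hk)).
by case: (no t); split=> // j /asboolT; apply: tmin.
Qed.

(** [geometric_mixing] bounds the set in [mixing_constant], so that its [sup] is a genuine upper
    bound. *)
Lemma t_mix_le (tau alpha : R) : 0 < alpha < 1 ->
  mixing_constant M pib mub <= tau ->
  (t_mix M pib mub alpha)%:R <= tau * (1 + ln alpha^-1).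
Proof.
move=> ha htau; have l0 (a : R) : 0 < a < 1 -> 0 < 1 + ln a^-1.
  by move=> /andP[a0 a1]; rewrite ltr_pwDl // ln_ge0 // invf_ge1 // ltW.
rewrite -ler_pdivrMr ?l0 //; apply: le_trans htau.
apply: ub_le_sup; last by exists alpha.
have [c hc] := geometric_mixing; exists c => _ [a ha' <-].
have [k hk hck] := hc _ ha'; rewrite ler_pdivrMr ?l0 //.
by apply: le_trans hck; rewrite ler_nat (t_mixP ha').2.
Qed.

End Mixing.

(** * The Gram matrix of the features *)

Section Euclidean.
Variables (R : realType) (d : nat).
Implicit Types u v w : 'cV[R]_d.

Definition dot u v : R := \sum_i u i 0 * v i 0.
Definition linf u : R := \big[Num.max/0]_i `|u i 0|.

Lemma dotC u v : dot u v = dot v u.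
Proof. by apply: eq_bigr => i _; rewrite mulrC. Qed.

Lemma dotDr u v w : dot u (v + w) = dot u v + dot u w.
Proof. by rewrite -big_split; apply: eq_bigr => i _; rewrite mxE mulrDr. Qed.

Lemma dotZr c u v : dot u (c *: v) = c * dot u v.
Proof. by rewrite big_distrr; apply: eq_bigr => i _; rewrite mxE mulrCA. Qed.

Lemma dotDl u v w : dot (v + w) u = dot v u + dot w u.
Proof. by rewrite dotC dotDr !(dotC u). Qed.

Lemma dotZl c u v : dot (c *: v) u = c * dot v u.
Proof. by rewrite dotC dotZr (dotC u). Qed.

Lemma dot_sqrD u v c : dot (u + c *: v) (u + c *: v) =
  dot u u + 2 * c * dot u v + c ^+ 2 * dot v v.
Proof. rewrite !(dotDl, dotDr, dotZl, dotZr) (dotC v u); ring. Qed.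

Lemma dot_ge0 u : 0 <= dot u u.
Proof. by apply: sumr_ge0 => i _; rewrite -expr2 sqr_ge0. Qed.

Lemma dot_gt0 u : u != 0 -> 0 < dot u u.
Proof.
move=> u0; rewrite lt_neqAle dot_ge0 andbT eq_sym.
apply: contra u0 => /eqP; move/psumr_eq0P => h; apply/eqP/colP => i.
by have /eqP := h (fun i _ => sqr_ge0 (u i 0)) i isT; rewrite mulf_eq0 orbb mxE => /eqP.
Qed.

Lemma linf_ge0 u : 0 <= linf u. Proof. exact: bigmax_ge_id. Qed.

Lemma linf_ub u i : `|u i 0| <= linf u.
Proof. exact: (le_bigmax _ (fun i => `|u i 0|)). Qed.

Lemma linf_le u c : 0 <= c -> (forall i, `|u i 0| <= c) -> linf u <= c.
Proof. by move=> c0 h; apply/bigmax_leP. Qed.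

Lemma linfD u v : linf (u + v) <= linf u + linf v.
Proof.
apply: linf_le => [|i]; first by rewrite addr_ge0 ?linf_ge0.
by rewrite mxE (le_trans (ler_normD _ _)) // lerD ?linf_ub.
Qed.

Lemma linfZ c u : linf (c *: u) <= `|c| * linf u.
Proof.
apply: linf_le => [|i]; first by rewrite mulr_ge0 ?linf_ge0.
by rewrite mxE normrM ler_wpM2l ?linf_ub.
Qed.

Lemma linf_sqr_le u : linf u ^+ 2 <= dot u u.
Proof.
rewrite -(sqr_sqrtr (dot_ge0 u)) lerXn2r ?nnegrE ?linf_ge0 ?sqrtr_ge0 //.
apply: linf_le => [|i]; first exact: sqrtr_ge0.
rewrite -sqrtr_sqr ler_sqrt ?dot_ge0 // /dot (bigD1 i) //= -expr2 lerDl.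
by apply: sumr_ge0 => j _; rewrite -expr2 sqr_ge0.
Qed.

(** A kernel vector would have zero quadratic form. Serves both the Gram matrix and the nonsymmetric
    matrix of the projected Bellman equation. *)
Lemma coercive_unitmx (G : 'M[R]_d) c : 0 < c ->
  (forall w, c * dot w w <= dot w (G *m w)) -> G \in unitmx.
Proof.
move=> c0 hG; rewrite -unitmx_tr -row_free_unit.
apply: inj_row_free => v hv; apply: contraTeq (hG v^T) => v0.
have -> : G *m v^T = 0 by rewrite -[RHS]trmx0 -hv trmx_mul trmxK.
rewrite [dot _ 0]big1 => [|i _]; last by rewrite [X in _ * X]mxE mulr0.
by rewrite -ltNge mulr_gt0 // dot_gt0 // -trmx0 (inj_eq trmx_inj).
Qed.

End Euclidean.

Section WeightedProduct.
Variables (R : realType) (T : finType) (k : T -> R).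
Hypothesis k_ge0 : forall z, 0 <= k z.
Implicit Types f g h : T -> R.

Definition wip f g : R := \sum_z k z * (f z * g z).

Lemma wip_ge0 f : 0 <= wip f f.
Proof. by apply: sumr_ge0 => z _; rewrite mulr_ge0 // -expr2 sqr_ge0. Qed.

Lemma wipC f g : wip f g = wip g f.
Proof. by apply: eq_bigr => z _; rewrite (mulrC (f z)). Qed.

Lemma wipDr f g h : wip f (g \+ h) = wip f g + wip f h.
Proof. by rewrite -big_split; apply: eq_bigr => z _; rewrite /= -mulrDr -mulrDr. Qed.

Lemma wipBr f g h : wip f (g \- h) = wip f g - wip f h.
Proof. by rewrite -sumrB; apply: eq_bigr => z _; rewrite /= -!mulrBr. Qed.

Lemma wipBl f g h : wip (g \- h) f = wip g f - wip h f.
Proof. by rewrite wipC wipBr !(wipC f). Qed.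

(** Stands in for Cauchy-Schwarz without square roots; [c] is later [gamma_c] or 1. *)
Lemma wip_amgm f g (c : R) :
  2 * c * wip f g <= c ^+ 2 * wip f f + wip g g.
Proof.
rewrite !big_distrr -big_split; apply: ler_sum => z _ /=.
have := mulr_ge0 (k_ge0 z) (sqr_ge0 (c * f z - g z)); rewrite -subr_ge0.
by congr (0 <= _); ring.
Qed.

Lemma wip_add_le f g : wip (f \+ g) (f \+ g) <= 2 * wip f f + 2 * wip g g.
Proof.
rewrite !big_distrr -big_split; apply: ler_sum => z _ /=.
have := mulr_ge0 (k_ge0 z) (sqr_ge0 (f z - g z)); rewrite -subr_ge0.
by congr (0 <= _); ring.
Qed.

End WeightedProduct.

Section Features.
Variables (R : realType) (S A : finType) (d : nat) (phi : S -> A -> 'cV[R]_d).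
Variables (pib : S -> A -> R) (mub : S -> R) (lam : R).
Hypothesis phi_norm : forall s a, \sum_i `|phi s a i 0| <= 1.
Local Notation kap := (kappa pib mub).

Definition linz (w : 'cV[R]_d) (z : S * A) : R := lin phi w z.1 z.2.

Lemma linzE w z : linz w z = dot (phi z.1 z.2) w. Proof. by []. Qed.

Lemma linzD w w' : linz (w + w') = linz w \+ linz w'.
Proof. by apply/funext => z; apply: linD. Qed.

Lemma linzZ c w z : linz (c *: w) z = c * linz w z.
Proof. exact: linZ. Qed.

Lemma linzB w w' : linz (w - w') = linz w \- linz w'.
Proof. by apply/funext => z; apply: linB. Qed.

Lemma linz_norm w z : `|linz w z| <= linf w.
Proof.
apply: le_trans (ler_norm_sum _ _ _) _; rewrite -[leRHS]mul1r.
apply: le_trans (ler_wpM2r (linf_ge0 w) (phi_norm z.1 z.2)).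
rewrite big_distrl; apply: ler_sum => i _.
by rewrite normrM ler_wpM2l // linf_ub.
Qed.

Lemma phi_entry_norm s a i : `|phi s a i 0| <= 1.
Proof.
apply: le_trans (phi_norm s a); rewrite (bigD1 i) //= lerDl.
by apply: sumr_ge0.
Qed.

Lemma linf_phi s a : linf (phi s a) <= 1.
Proof. by apply: linf_le => // i; apply: phi_entry_norm. Qed.

Lemma dot_phi_le1 s a : dot (phi s a) (phi s a) <= 1.
Proof.
apply: le_trans (phi_norm s a); apply: ler_sum => i _.
by rewrite -expr2 -real_normK ?num_real // expr2 ler_piMr // phi_entry_norm.
Qed.

Hypothesis kap_gt0 : forall z, 0 < kap z.
Hypothesis kap_sum : \sum_z kap z = 1.
Hypothesis phi_free : features_free phi.
Hypothesis lam_min : is_min_eigenvalue phi pib mub lam.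
Local Notation wipk := (wip kap).

Lemma wipk_lin_le w : wipk (linz w) (linz w) <= dot w w.
Proof.
apply: (@le_trans _ _ (\sum_z kap z * dot w w)); last first.
  by rewrite -big_distrl /= kap_sum mul1r.
apply: ler_sum => z _; rewrite ler_wpM2l ?(ltW (kap_gt0 z)) //.
apply: le_trans (linf_sqr_le w); rewrite -expr2 -real_normK ?num_real //.
by rewrite lerXn2r ?nnegrE ?linf_ge0 ?linz_norm.
Qed.

Lemma gram_mulE (v : 'cV[R]_d) w :
  (v^T *m gram_mx phi pib mub *m w) 0 0 = wipk (linz v) (linz w).
Proof.
rewrite /gram_mx !mulmxA -mulmxA mxE.
rewrite /K_mx mul_mx_diag /wip.
rewrite (reindex (@enum_val _ (mem {: S * A}))) /=; last first.
  by exists enum_rank => i _; rewrite ?enum_rankK ?enum_valK.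
apply: eq_bigr => z _; rewrite !mxE mulrAC mulrC.
congr (_ * (_ * _)).
  by apply: eq_bigr => i _; rewrite !mxE mulrC.
by apply: eq_bigr => i _; rewrite !mxE.
Qed.

Lemma linz_inj v : linz v =1 (fun=> 0) -> v = 0.
Proof.
move=> hv; apply: trmx_inj; rewrite trmx0.
apply: (row_free_inj phi_free); rewrite mul0mx; apply/rowP => z.
rewrite !mxE -[RHS](hv (enum_val z)); apply: eq_bigr => i _.
by rewrite !mxE mulrC.
Qed.

Lemma wipk_lin_gt0 v : v != 0 -> 0 < wipk (linz v) (linz v).
Proof.
have k0 z := ltW (kap_gt0 z).
move=> v0; rewrite lt_neqAle wip_ge0 // andbT eq_sym.
apply: contra v0 => /eqP /psumr_eq0P h; apply/eqP/linz_inj => z.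
have /eqP := h (fun z _ => mulr_ge0 (k0 z) (sqr_ge0 (linz v z))) z isT.
by rewrite mulf_eq0 (gt_eqF (kap_gt0 z)) mulf_eq0 orbb => /eqP.
Qed.

Lemma min_eigenvalue_gt0 : 0 < lam.
Proof.
have [/eigenvalueP[v hv v0] _] := lam_min.
have vt0 : v^T != 0 by rewrite -trmx0 (inj_eq trmx_inj).
have := gram_mulE v^T v^T; rewrite trmxK hv -scalemxAl mxE.
have -> : (v *m v^T) 0 0 = dot v^T v^T.
  by rewrite mxE; apply: eq_bigr => i _; rewrite !mxE.
move=> h; have := wipk_lin_gt0 vt0; rewrite -h.
by rewrite pmulr_lgt0 // dot_gt0.
Qed.

Lemma min_eigenvalue_le1 : lam <= 1.
Proof.
have [/eigenvalueP[v hv v0] _] := lam_min.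
have vt0 : v^T != 0 by rewrite -trmx0 (inj_eq trmx_inj).
have := gram_mulE v^T v^T; rewrite trmxK hv -scalemxAl mxE.
have -> : (v *m v^T) 0 0 = dot v^T v^T.
  by rewrite mxE; apply: eq_bigr => i _; rewrite !mxE.
move=> h; have := wipk_lin_le v^T; rewrite -h -[leRHS]mul1r.
by rewrite ler_pM2r // dot_gt0.
Qed.

Lemma wipkDr u v w : wipk (linz u) (linz (v + w)) =
  wipk (linz u) (linz v) + wipk (linz u) (linz w).
Proof. by rewrite linzD wipDr. Qed.

Lemma wipkZr c u v : wipk (linz u) (linz (c *: v)) = c * wipk (linz u) (linz v).
Proof.
rewrite big_distrr /=; apply: eq_bigr => z _; rewrite linzZ; ring.
Qed.

Lemma wipkDl u v w : wipk (linz (v + w)) (linz u) =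
  wipk (linz v) (linz u) + wipk (linz w) (linz u).
Proof. by rewrite wipC wipkDr !(wipC _ (linz u)). Qed.

Lemma wipkZl c u v : wipk (linz (c *: v)) (linz u) = c * wipk (linz v) (linz u).
Proof. by rewrite wipC wipkZr (wipC _ (linz u)). Qed.

Lemma qform_continuous : continuous (fun v : 'rV[R]_d => wipk (linz v^T) (linz v^T)).
Proof.
have cl z : continuous (fun v : 'rV[R]_d => linz v^T z).
  apply: continuous_big => [x|i _ v]; first exact: add_continuous.
  under eq_fun do rewrite mxE.
  by apply: continuousM; [exact: cst_continuous|exact: coord_continuous].
apply: continuous_big => [x|z _ v]; first exact: add_continuous.
have cM (f g : 'rV[R]_d -> R) : continuous f -> continuous g ->
  continuous (fun x => f x * g x) 
  by move=> cf cg x; exact: cvgM (cf x) (cg x).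
exact: (cM _ _ (@cst_continuous _ _ (kap z)) (cM _ _ (cl z) (cl z))).
Qed.

Lemma dot_continuous : continuous (fun v : 'rV[R]_d => dot v^T v^T).
Proof.
apply: continuous_big => [x|i _ v]; first exact: add_continuous.
under eq_fun do rewrite !mxE.
by apply: continuousM; exact: coord_continuous.
Qed.

Hypothesis d_gt0 : (0 < d)%N.

(* A minimiser of the quadratic form on the unit sphere is an eigenvector of
   the Gram matrix for the minimum, which is therefore at least lam. *)
Lemma min_eigenvalue_le w : lam * dot w w <= wipk (linz w) (linz w).
Proof.
pose Sph := [set v : 'rV[R]_d | dot v^T v^T = 1].
have normal (u : 'cV[R]_d) : u != 0 ->
    Sph ((Num.sqrt (dot u u))^-1 *: u)^T.
  move=> u0; rewrite /Sph /= trmxK dotZl dotZr mulrA -expr2 exprVn.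
  by rewrite sqr_sqrtr ?dot_ge0 // mulVf // gt_eqF // dot_gt0.
have Sph0 : Sph !=set0.
  have u0 : (const_mx 1 : 'cV[R]_d) != 0; last by eexists; apply: normal u0.
  apply/eqP => /colP /(_ (Ordinal d_gt0)).
  by rewrite !mxE => /eqP; rewrite oner_eq0.
have Sphc : compact Sph.
  apply: bounded_closed_compact.
    exists 1; split=> [|M M1 v vS]; first exact: num_real.
    apply: le_trans (ltW M1); rewrite /= /Num.norm /= mx_normrE.
    apply/bigmax_leP; split=> // -[i j] _ /=.
    have := linf_sqr_le v^T; rewrite vS -[leRHS](expr1n _ 2).
    rewrite ler_pXn2r ?nnegrE ?linf_ge0 // => h.
    by apply: le_trans h; have := linf_ub v^T j; rewrite mxE (ord1 i).
  have -> : Sph = (fun v : 'rV[R]_d => dot v^T v^T) @^-1` [set x | x = 1] by [].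
  by apply: preimage_closed; [move=> x _; exact: dot_continuous|exact: closed_eq].
have [c] := compact_EVT_min Sph0 Sphc (continuous_subspaceT qform_continuous).
rewrite inE => cS cmin.
set m := wipk (linz c^T) (linz c^T) in cmin.
have hm u : m * dot u u <= wipk (linz u) (linz u).
  case: (eqVneq u 0) => [->|u0].
    have -> : (0 : 'cV[R]_d) = 0 *: 0 by rewrite scale0r.
    by rewrite dotZr !mul0r !mulr0 wip_ge0 // => z; apply: ltW.
  have := cmin _ (mem_set (normal u u0)); rewrite trmxK wipkZl wipkZr mulrA -expr2.
  rewrite exprVn sqr_sqrtr ?dot_ge0 //.
  by rewrite ler_pdivlMl ?dot_gt0 // mulrC.
(* First-order condition: the excess over the minimum along c + t u is 2 t b + t^2 a >= 0 for all t.
   The choice t = - b / (1 + a) forces b = 0 and, unlike - b / a, also covers a = 0. *)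
have stat u : wipk (linz c^T) (linz u) = m * dot c^T u.
  pose b := wipk (linz c^T) (linz u) - m * dot c^T u.
  pose a := wipk (linz u) (linz u) - m * dot u u.
  have a0 : 0 <= a by rewrite subr_ge0 hm.
  have q t : 0 <= 2 * t * b + t ^+ 2 * a.
    have := hm (c^T + t *: u).
    rewrite !(dotDl, dotDr, dotZl, dotZr) !(wipkDl, wipkDr, wipkZl, wipkZr).
    rewrite -subr_ge0 (dotC u) (wipC _ (linz u)) [dot c^T c^T]cS -/m.
    by congr (0 <= _); rewrite /a /b; ring.
  apply/eqP; rewrite -subr_eq0 -/b -sqrf_eq0 eq_le sqr_ge0 andbT.
  have a1 : 0 < 1 + a by rewrite ltr_pwDl.
  have := q (- b / (1 + a)).
  have -> : 2 * (- b / (1 + a)) * b + (- b / (1 + a)) ^+ 2 * a =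
      - (b ^+ 2 * ((2 + a) / (1 + a) ^+ 2)).
    by field; rewrite gt_eqF.
  by rewrite oppr_ge0 pmulr_lle0 // divr_gt0 ?exprn_gt0 // ltr_pwDl.
have : eigenvalue (gram_mx phi pib mub) m.
  apply/eigenvalueP; exists c; last first.
    apply/eqP => c0; move: cS; rewrite /Sph /= c0 trmx0 /dot big1 => [/eqP|i _].
      by rewrite eq_sym oner_eq0.
    by rewrite mxE mul0r.
  apply/rowP => j.
  have := stat (delta_mx j 0); rewrite -gram_mulE trmxK.
  have hd (x : 'rV[R]_d) : (x *m delta_mx j (0 : 'I_1)) 0 0 = x 0 j.
    rewrite mxE (bigD1 j) //= !mxE !eqxx mulr1 big1 ?addr0 // => i ij.
    by rewrite !mxE (negbTE ij) mulr0.
  rewrite hd => ->; rewrite mxE; congr (_ * _).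
  by rewrite -hd mxE; apply: eq_bigr => i _; rewrite !mxE.
move=> /lam_min.2 lm; apply: le_trans (hm w).
by rewrite ler_wpM2r ?dot_ge0.
Qed.

End Features.

(** * The projected Bellman equation *)

Section ProjectedBellman.
Variables (R : realType) (S A : finType) (M : mdp R S A).
Variables (d : nat) (phi : S -> A -> 'cV[R]_d).
Variables (pib : S -> A -> R) (mub : S -> R) (lam gamma_c : R) (n : nat).
Local Notation gam := (discount M).
Local Notation kap := (kappa pib mub).
Local Notation wipk := (wip kap).
Local Notation linz := (linz phi).
Hypothesis kap_gt0 : forall z, 0 < kap z.
Hypothesis kap_sum : \sum_z kap z = 1.
Hypothesis phi_norm : forall s a, \sum_i `|phi s a i 0| <= 1.
Hypothesis phi_free : features_free phi.
Hypothesis lam_min : is_min_eigenvalue phi pib mub lam.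
Hypothesis d_gt0 : (0 < d)%N.
Hypothesis gc01 : 0 < gamma_c < 1.
Hypothesis n_large :
  (2 * ln gamma_c + ln (kappa_min pib mub)) / (2 * ln gam) <= n%:R.

Let lam_gt0 : 0 < lam.
Proof. exact: min_eigenvalue_gt0 kap_gt0 phi_free lam_min. Qed.

Let kap_ge0 z : 0 <= kap z. Proof. exact: ltW. Qed.

Let lam_le w : lam * dot w w <= wipk (linz w) (linz w).
Proof. exact: min_eigenvalue_le. Qed.

Lemma kap_min_gt0 : 0 < kappa_min pib mub.
Proof. by apply/bigmin_gtP; split. Qed.

(** Exponentiated lower bound on [n]; multiplying by 2 ln gam < 0 reverses the inequality. *)
Lemma discount_pow_le : gam ^+ n ^+ 2 <= gamma_c ^+ 2 * kappa_min pib mub.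
Proof.
have /andP[gc0 _] := gc01; have g0 := discount_gt0 M.
have kmin0 := kap_min_gt0.
have lg : ln gam < 0 by rewrite ln_lt0 // g0 discount_lt1.
rewrite -ler_ln ?posrE ?exprn_gt0 ?mulr_gt0 ?exprn_gt0 //.
rewrite lnM ?posrE ?exprn_gt0 // !lnXn ?exprn_gt0 //.
move: n_large; rewrite ler_ndivrMr ?pmulr_rlt0 // => h.
rewrite -[_ *+ 2]mulr_natl -[_ *+ n]mulr_natl mulrCA -[ln gamma_c *+ 2]mulr_natl.
exact: h.
Qed.

Section Policy.
Variable pi : S -> A -> R.
Hypothesis pi_policy : is_policy pi.
Local Notation T := (kern_op M pi).

Definition bellz (f : S * A -> R) (z : S * A) : R := rew M z + gam * T f z.

Lemma iter_bellmanE k Q z :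
  iter k (bellman M pi) Q z.1 z.2 = iter k bellz (fun z => Q z.1 z.2) z.
Proof.
elim: k z => [|k IH] z //=; rewrite bellmanE -surjective_pairing /bellz.
by congr (_ + _ * _); apply: eq_bigr => x _; rewrite IH.
Qed.

Lemma kern_op_sum (I : finType) (c : I -> R) (f : I -> S * A -> R) z :
  T (fun x => \sum_i c i * f i x) z = \sum_i c i * T (f i) z.
Proof.
under [LHS]eq_bigr do rewrite big_distrr /=.
rewrite exchange_big /=; apply: eq_bigr => i _; rewrite big_distrr /=.
by apply: eq_bigr => x _; rewrite mulrCA.
Qed.

Lemma iter_kern_op_sum k (I : finType) (c : I -> R) (f : I -> S * A -> R) z :
  iter k T (fun x => \sum_i c i * f i x) z = \sum_i c i * iter k T (f i) z.
Proof.
elim: k z => [|k IH] z //=; rewrite -kern_op_sum.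
by congr (T _ z); apply/funext => x; rewrite IH.
Qed.

Lemma kern_opB f g z : T (f \- g) z = T f z - T g z.
Proof. by rewrite -sumrB; apply: eq_bigr => x _; rewrite mulrBr. Qed.

Definition nstep_op (e : S * A -> R) (z : S * A) : R := gam ^+ n * iter n T e z.

Lemma iter_bellzB f g z :
  iter n bellz f z - iter n bellz g z = nstep_op (f \- g) z.
Proof.
rewrite /nstep_op; elim: n z => [|k IH] z /=; first by rewrite expr0 mul1r.
rewrite /bellz opprD addrACA subrr add0r -mulrBr -kern_opB exprS -mulrA.
congr (_ * _); rewrite /kern_op big_distrr /=; apply: eq_bigr => x _.
by rewrite /= IH mulrCA.
Qed.

(** Passing from the weighted norm to the sup norm costs 1 / [kappa_min]. The sup norm then
    contracts by gam^n, and [discount_pow_le] absorbs the cost. *)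
Lemma nstep_op_wip e :
  wipk (nstep_op e) (nstep_op e) <= gamma_c ^+ 2 * wipk e e.
Proof.
have g0 := ltW (discount_gt0 M).
have kmin0 := kap_min_gt0; have e0 := wip_ge0 kap_ge0 e.
pose m := Num.sqrt (wipk e e / kappa_min pib mub).
have m0 : 0 <= m by exact: sqrtr_ge0.
have m2 : m ^+ 2 = wipk e e / kappa_min pib mub.
  by rewrite sqr_sqrtr // divr_ge0 // ltW.
have hm z : `|e z| <= m.
  rewrite -(@ler_pXn2r _ 2) ?nnegrE // m2 ler_pdivlMr // mulrC.
  rewrite real_normK ?num_real // /wip (bigD1 z) //= -expr2.
  rewrite ler_wpDr ?ler_wpM2r ?sqr_ge0 //.
    by apply: sumr_ge0 => x _; rewrite mulr_ge0 // -expr2 sqr_ge0.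
  exact: (bigmin_le _ z (fun z => kap z)).
have hop z : nstep_op e z ^+ 2 <= gam ^+ n ^+ 2 * m ^+ 2.
  rewrite exprMn ler_wpM2l ?sqr_ge0 // -real_normK ?num_real //.
  rewrite lerXn2r ?nnegrE // iter_kern_op_norm //.
apply: (@le_trans _ _ (gam ^+ n ^+ 2 * m ^+ 2)).
  rewrite -[leRHS]mul1r -kap_sum big_distrl /=; apply: ler_sum => z _.
  by rewrite ler_wpM2l // -expr2 hop.
apply: le_trans (ler_wpM2r (sqr_ge0 m) discount_pow_le) _.
by rewrite m2 -mulrA [_ * (_ / _)]mulrC divfK // gt_eqF.
Qed.

Lemma nstep_op_drift e : wipk e (nstep_op e) <= gamma_c * wipk e e.
Proof.
have /andP[gc0 _] := gc01.
have := wip_amgm kap_ge0 e (nstep_op e) gamma_c; have := nstep_op_wip e.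
move=> h1 h2; rewrite -(ler_pM2l gc0); move: h1 h2.
move: (wipk e e) (wipk e _) (wipk _ _) => x y z.
by rewrite expr2 => h1 h2; lra.
Qed.

Definition feature_proj (f : S * A -> R) : 'cV[R]_d :=
  \col_i wipk (fun z => phi z.1 z.2 i 0) f.

Lemma wipk_feature v f : wipk (linz v) f = dot v (feature_proj f).
Proof.
under [RHS]eq_bigr do rewrite mxE big_distrr /=.
rewrite exchange_big /=; apply: eq_bigr => z _.
have -> : linz v z = \sum_i phi z.1 z.2 i 0 * v i 0 by [].
by rewrite big_distrl big_distrr /=; apply: eq_bigr => i _; ring.
Qed.

Lemma dot_inj u v : (forall x : 'cV[R]_d, dot x u = dot x v) -> u = v.
Proof.
move=> h; apply/colP => i; have := h (delta_mx i 0).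
rewrite /dot (bigD1 i) //= [RHS](bigD1 i) //= !mxE !eqxx !mul1r.
by rewrite !big1 ?addr0 // => j /negbTE ji; rewrite mxE ji mul0r.
Qed.

Lemma gram_dot v w : dot v (gram_mx phi pib mub *m w) = wipk (linz v) (linz w).
Proof.
rewrite -gram_mulE -mulmxA [RHS]mxE; apply: eq_bigr => i _.
by rewrite [v^T _ _]mxE.
Qed.

Lemma gram_unit : gram_mx phi pib mub \in unitmx.
Proof. by apply: (coercive_unitmx lam_gt0) => w; rewrite gram_dot. Qed.

Lemma feature_projE f : feature_proj f =
  (Phi_mx phi)^T *m K_mx pib mub *m vec_of (fun s a => f (s, a)).
Proof.
apply/colP => i; rewrite /K_mx mul_mx_diag !mxE /wip.
rewrite (reindex (@enum_val _ (mem {: S * A}))) /=; last first.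
  by exists enum_rank => z _; rewrite ?enum_rankK ?enum_valK.
apply: eq_bigr => z _; rewrite !mxE -surjective_pairing; ring.
Qed.

(** Galerkin form: the residual is kappa-orthogonal to the span of the features. One direction
    multiplies by Phi^T K, the other uses invertibility of the Gram matrix. *)
Lemma projected_eqP w Q :
  Phi_mx phi *m w = proj_mx_kappa phi pib mub *m vec_of Q <->
  forall v, wipk (linz v) (linz w) = wipk (linz v) (fun z => Q z.1 z.2).
Proof.
have hQ : vec_of Q = vec_of (fun s a => (fun z : S * A => Q z.1 z.2) (s, a)).
  by apply/colP => z; rewrite !mxE.
have hP : proj_mx_kappa phi pib mub *m vec_of Q = Phi_mx phi *m
    (invmx (gram_mx phi pib mub) *m feature_proj (fun z => Q z.1 z.2)).
  by rewrite feature_projE hQ /proj_mx_kappa !mulmxA.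
split=> [h v|h].
  rewrite -gram_dot wipk_feature; congr dot.
  move: h; rewrite hP => h.
  have -> : gram_mx phi pib mub *m w =
      (Phi_mx phi)^T *m K_mx pib mub *m (Phi_mx phi *m w) by rewrite !mulmxA.
  rewrite h !mulmxA -[_ *m _ *m Phi_mx phi]/(gram_mx phi pib mub).
  by rewrite mulmxV ?gram_unit // mul1mx.
rewrite hP; congr (_ *m _).
rewrite -[LHS](mulKmx gram_unit); congr (_ *m _).
by apply: dot_inj => v; rewrite gram_dot -wipk_feature.
Qed.

Lemma projection_exists f :
  exists p, forall v, wipk (linz v) (linz p) = wipk (linz v) f.
Proof.
exists (invmx (gram_mx phi pib mub) *m feature_proj f) => v.
by rewrite -gram_dot mulKVmx ?gram_unit // wipk_feature.
Qed.

(** In coordinates the linear part is the matrix of inner products of phi_i with (I - gam^n P_pi^n)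
    phi_j, coercive with constant (1 - gamma_c) lam and therefore invertible. *)
Lemma projected_bellman_exists : exists w, forall v,
  wipk (linz v) (linz w) = wipk (linz v) (iter n bellz (linz w)).
Proof.
have /andP[_ gc1] := gc01.
pose f j z := phi z.1 z.2 j 0.
pose G : 'M[R]_d := \matrix_(i, j) wipk (f i) (f j \- nstep_op (f j)).
have GE w : G *m w = feature_proj (linz w \- nstep_op (linz w)).
  apply/colP => i; rewrite !mxE /wip.
  under [LHS]eq_bigr do rewrite mxE big_distrl /=.
  rewrite exchange_big /=; apply: eq_bigr => z _.
  have -> : nstep_op (linz w) z = \sum_j w j 0 * nstep_op (f j) z.
    rewrite /nstep_op.
    have -> : linz w = (fun z => \sum_j w j 0 * f j z).
      by apply/funext => x; apply: eq_bigr => j _; rewrite mulrC.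
    by rewrite iter_kern_op_sum big_distrr; apply: eq_bigr => j _; rewrite mulrCA.
  have -> : linz w z = \sum_j w j 0 * f j z.
    by apply: eq_bigr => j _; rewrite mulrC.
  rewrite -sumrB !big_distrr /=; apply: eq_bigr => j _; rewrite /f; ring.
have Gu : G \in unitmx.
  have c0 : 0 < (1 - gamma_c) * lam by rewrite mulr_gt0 // subr_gt0.
  apply: (coercive_unitmx c0) => w; rewrite GE -wipk_feature wipBr.
  apply: (@le_trans _ _ ((1 - gamma_c) * wipk (linz w) (linz w))).
    by rewrite -mulrA ler_wpM2l ?subr_ge0 ?(ltW gc1).
  by rewrite mulrBl mul1r lerD2l lerN2 nstep_op_drift.
(* The n-fold Bellman operator is affine; its value at zero is the expected n-step reward, the
   right-hand side of the linear system. *)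
pose w := invmx G *m feature_proj (iter n bellz (fun=> 0)).
exists w => v; apply/eqP; rewrite -subr_eq0 -wipBr.
have -> : linz w \- iter n bellz (linz w) =
    (linz w \- nstep_op (linz w)) \- iter n bellz (fun=> 0).
  apply/funext => z /=; have := iter_bellzB (linz w) (fun=> 0) z.
  have -> : linz w \- (fun=> 0) = linz w by apply/funext => x /=; rewrite subr0.
  by move=> <-; ring.
by rewrite wipBr !wipk_feature -GE mulKVmx // subrr.
Qed.

Definition wstar : 'cV[R]_d := w_sol M phi pib mub n pi.

(** Existence of a solution rules out the default value in [w_sol]. *)
Lemma wstar_eq v : wipk (linz v) (iter n bellz (linz wstar) \- linz wstar) = 0.
Proof.
rewrite wipBr; apply/eqP; rewrite subr_eq0 eq_sym; apply/eqP.
have bE w : (fun z => iter n (bellman M pi) (lin phi w) z.1 z.2) =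
    iter n bellz (linz w).
  by apply/funext => z; rewrite iter_bellmanE.
rewrite -bE; move: v; apply/projected_eqP.
rewrite /wstar /w_sol; case: xgetP => [w _ //|no].
have [w hw] := projected_bellman_exists.
by case: (no w); apply/projected_eqP => v; rewrite bE.
Qed.

Lemma wstar_drift w :
  wipk (linz (w - wstar)) (iter n bellz (linz w) \- linz w) <=
  - ((1 - gamma_c) * lam * dot (w - wstar) (w - wstar)).
Proof.
set u := w - wstar; have /andP[_ gc1] := gc01.
have -> : iter n bellz (linz w) \- linz w =
   (iter n bellz (linz wstar) \- linz wstar) \+ (nstep_op (linz u) \- linz u).
  rewrite linzB; apply/funext => z /=; rewrite -iter_bellzB; ring.
rewrite wipDr wstar_eq add0r wipBr.
apply: (@le_trans _ _ (- ((1 - gamma_c) * wipk (linz u) (linz u)))).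
  by have := nstep_op_drift (linz u); lra.
by rewrite lerN2 -mulrA ler_wpM2l ?subr_ge0 ?(ltW gc1).
Qed.

Let Q (z : S * A) : R := Q_fun M pi z.1 z.2.

Lemma iter_bellz_Q : iter n bellz Q = Q.
Proof.
have h : bellz Q = Q.
  by apply/funext => -[s a]; rewrite /Q /= Q_fun_bellman // bellmanE.
by elim: n => //= k ->.
Qed.

(* By orthogonality ||Phi w - Q||^2 splits into ||Phi w - Phi p||^2, which the
   contraction bounds by gamma_c^2 ||Phi w - Q||^2, and ||Phi p - Q||^2; this
   saves a factor 1 - gamma_c over the triangle inequality. *)
Lemma wstar_bound :
  lam * dot wstar wstar <= 4 / ((1 - gam) ^+ 2 * (1 - gamma_c)).
Proof.
have /andP[gc0 gc1] := gc01; have g1 := discount_compl_gt0 M.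
have [p hp] := projection_exists Q.
pose e := linz wstar \- Q; pose u := linz (wstar - p).
have uE : e = u \+ (linz p \- Q).
  by rewrite /e /u linzB; apply/funext => z /=; ring.
have orth v : wipk (linz v) (linz p \- Q) = 0 by rewrite wipBr hp subrr.
set q := linz p \- Q in uE orth *.
have ue : wipk u e = wipk u u.
  by rewrite -[RHS]addr0 -(orth (wstar - p)) -wipDr -uE.
(* [u] lies in the span of the features, and the residual of the projected equation, here equal to
   [nstep_op e] minus [e], is orthogonal to that span. *)
have uGe : wipk u (nstep_op e) = wipk u e.
  apply/eqP; rewrite -subr_eq0 -wipBr.
  have -> : nstep_op e \- e = iter n bellz (linz wstar) \- linz wstar.
    apply/funext => z; rewrite /= -iter_bellzB iter_bellz_Q /e /=; ring.
  by rewrite wstar_eq.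
have ee : wipk e e = wipk u u + wipk q q.
  have -> : wipk e e = wipk e u + wipk e q by rewrite -wipDr -uE.
  rewrite (wipC _ e u) (wipC _ e q) ue; congr (_ + _).
  have -> : wipk q e = wipk q u + wipk q q by rewrite -wipDr -uE.
  by rewrite (wipC _ q u) orth add0r.
have hu : wipk u u <= gamma_c ^+ 2 * wipk e e.
  have := wip_amgm kap_ge0 u (nstep_op e) 1; have := nstep_op_wip e.
  rewrite uGe ue expr1n !mul1r mulr1 mulr_natl mulr2n => h1 h2.
  by rewrite -(lerD2l (wipk u u)); apply: le_trans h2 _; rewrite lerD2l.
have pQ : wipk q q <= wipk Q Q.
  have -> : wipk Q Q = wipk (linz p) (linz p) + wipk q q.
    by rewrite wipBl !wipBr (wipC _ Q (linz p)) !hp; ring.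
  by rewrite lerDr wip_ge0.
have Qle : wipk Q Q <= (1 - gam) ^- 2.
  have -> : (1 - gam) ^- 2 = \sum_z kap z * (1 - gam) ^- 2.
    by rewrite -big_distrl /= kap_sum mul1r.
  apply: ler_sum => z _; rewrite ler_wpM2l // -expr2 -real_normK ?num_real // -exprVn.
  by rewrite lerXn2r ?nnegrE ?invr_ge0 ?(ltW g1) //; apply: Q_fun_norm.
have eQ : (1 - gamma_c) * wipk e e <= wipk Q Q.
  have e0 := wip_ge0 kap_ge0 e.
  have : 0 <= (gamma_c - gamma_c ^+ 2) * wipk e e.
    have -> : gamma_c - gamma_c ^+ 2 = gamma_c * (1 - gamma_c) by ring.
    by rewrite !mulr_ge0 ?subr_ge0 // ltW.
  move: hu pQ; rewrite ee.
  by move: (wipk u u) (wipk q q) (wipk Q Q) => x y t; lra.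
have xle : wipk (linz wstar) (linz wstar) <= 2 * wipk e e + 2 * wipk Q Q.
  have -> : linz wstar = e \+ Q by apply/funext => z /=; rewrite /e /=; ring.
  exact: wip_add_le.
apply: le_trans (lam_le _) _; apply: le_trans xle _.
rewrite invfM mulrA ler_pdivlMr ?subr_gt0 //.
have : (1 - gamma_c) * wipk Q Q <= wipk Q Q.
  by rewrite ler_piMl ?wip_ge0 // gerBl ltW.
by move: eQ Qle; move: (wipk Q Q) (wipk e e) ((1 - gam) ^- 2) => x y g; lra.
Qed.

End Policy.

Hypothesis A_gt0 : (0 < #|A|)%N.

Definition wbound : R := Num.sqrt (4 / (lam * (1 - gam) ^+ 2 * (1 - gamma_c))).

Lemma wbound_ge0 : 0 <= wbound. Proof. exact: sqrtr_ge0. Qed.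

Lemma wbound_sqr : wbound ^+ 2 = 4 / (lam * (1 - gam) ^+ 2 * (1 - gamma_c)).
Proof.
have /andP[_ gc1] := gc01; have g1 := discount_compl_gt0 M.
rewrite sqr_sqrtr // divr_ge0 // mulr_ge0 ?subr_ge0 ?(ltW gc1) //.
by rewrite mulr_ge0 ?sqr_ge0 ?(ltW lam_gt0).
Qed.

Lemma wstar_dot pi : is_policy pi -> dot (wstar pi) (wstar pi) <= wbound ^+ 2.
Proof.
move=> hpi; rewrite wbound_sqr -mulrA invfM [lam^-1 * _]mulrC mulrA.
by rewrite ler_pdivlMr // mulrC wstar_bound.
Qed.

Lemma wstar_linf pi : is_policy pi -> linf (wstar pi) <= wbound.
Proof.
move=> hpi; rewrite -(@ler_pXn2r _ 2) ?nnegrE ?linf_ge0 ?wbound_ge0 //.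
exact: le_trans (linf_sqr_le _) (wstar_dot hpi).
Qed.

(** The [sup] in [xi_err] is meaningful because Q and the limit [wstar] are bounded uniformly over
    all policies. *)
Lemma xi_ub theta s a :
  `|Q_fun M (softmax phi theta) s a - lin phi (wstar (softmax phi theta)) s a|
  <= xi_err M phi pib mub n.
Proof.
pose F th := \big[Num.max/0]_(z : S * A)
  `|Q_fun M (softmax phi th) z.1 z.2 - lin phi (wstar (softmax phi th)) z.1 z.2|.
apply: (@le_trans _ _ (F theta)).
  exact: (le_bigmax _ (fun z : S * A => `|Q_fun M (softmax phi theta) z.1 z.2 -
    lin phi (wstar (softmax phi theta)) z.1 z.2|) (s, a)).
apply: ub_le_sup; last by exists theta.
exists ((1 - gam)^-1 + wbound) => _ [th _ <-].
have g1 := discount_compl_gt0 M.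
apply/bigmax_leP; split=> [|z _].
  by rewrite addr_ge0 ?wbound_ge0 // invr_ge0 ltW.
have hpol := softmax_policy phi A_gt0 th.
apply: le_trans (ler_normB _ _) _; apply: lerD; first exact: Q_fun_norm.
exact: le_trans (linz_norm phi_norm _ z) (wstar_linf hpol).
Qed.

End ProjectedBellman.

(** * Sliding windows and temporal differences *)

Section Windows.
Variables (R : realType) (S A : finType) (M : mdp R S A).
Variables (pib : S -> A -> R) (mub : S -> R) (n : nat).
Hypothesis pib_policy : is_policy pib.
Hypothesis kap_pmf : is_pmf (kappa pib mub).
Local Notation X := (S * A)%type.
Local Notation q := (kern M pib).
Implicit Types (y z : nat -> X) (g : (nat -> X) -> R).

(* A window is a sequence of which only the entries 0, ..., n matter; push
   slides it by one observation. *)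
Definition push y (x : X) : nat -> X := fun k => if (k < n)%N then y k.+1 else x.

Definition window_op g y : R := \sum_x q (y n) x * g (push y x).

Definition scons (x : X) y : nat -> X := fun k => if k is k'.+1 then y k' else x.

(** Generates a window from its first entry onwards, the direction in which the n-step return
    recurses; [window_op] adds entries at the other end. *)
Fixpoint forward_exp (m : nat) (x : X) g : R :=
  if m is m'.+1 then
    \sum_x' q x x' * forward_exp m' x' (fun y => g (scons x y))
  else g (fun=> x).

Definition window_mean g : R := \sum_x kappa pib mub x * forward_exp n x g.

Lemma push_last y x : push y x n = x. Proof. by rewrite /push ltnn. Qed.

Lemma window_opB g h y :
  window_op (g \- h) y = window_op g y - window_op h y.
Proof. by rewrite -sumrB; apply: eq_bigr => x _; rewrite mulrBr. Qed.

Lemma window_op_cst c y : window_op (fun=> c) y = c.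
Proof. exact: pmf_sum_cst (kern_pmf M (y n) pib_policy). Qed.

Lemma window_op_norm g c y : (forall y, `|g y| <= c) -> `|window_op g y| <= c.
Proof. by move=> hg; apply: pmf_sum_norm => //; apply: kern_pmf. Qed.

Lemma iter_window_opB k g h y :
  iter k window_op (g \- h) y = iter k window_op g y - iter k window_op h y.
Proof.
elim: k y => [|k IH] y //=; rewrite -window_opB; congr (window_op _ y).
exact/funext.
Qed.

Lemma iter_window_op_norm k g c y :
  (forall y, `|g y| <= c) -> `|iter k window_op g y| <= c.
Proof. by move=> hg; elim: k y => [|k IH] y //=; apply: window_op_norm. Qed.

Lemma window_op_prefix g : prefix_det n g -> prefix_det n (window_op g).
Proof.
move=> hg z z' h; rewrite /window_op h //; apply: eq_bigr => x _.
congr (_ * _); apply: hg => k _; rewrite /push.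
by case: ifP => // kn; rewrite h.
Qed.

Lemma iter_window_op_prefix k g :
  prefix_det n g -> prefix_det n (iter k window_op g).
Proof. by move=> hg; elim: k => //= k; apply: window_op_prefix. Qed.

Lemma iter_window_op_forward m g y : prefix_det n g -> (m <= n)%N ->
  iter m window_op g y = forward_exp m (y n)
    (fun v => g (fun k => if (k < n - m)%N then y (k + m)%N else v (k - (n - m))%N)).
Proof.
move=> hg; elim: m y => [|m IH] y mn /=.
  apply: hg => k kn; rewrite subn0 addn0; case: ltnP => // nk.
  by congr y; apply/eqP; rewrite eqn_leq kn.
apply: eq_bigr => x _; congr (_ * _); rewrite IH ?(ltnW mn) // push_last.
congr (forward_exp m x _); apply/funext => v; congr g; apply/funext => k.
have [k1|k1] := ltnP k (n - m.+1).
  have -> : (k < n - m)%N by lia.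
  by rewrite /push addnS; have -> : (k + m < n)%N by lia.
have [k2|k2] := ltnP k (n - m).
  have -> : (k - (n - m.+1) = 0)%N by lia.
  rewrite /push /=; have -> : (k + m < n)%N by lia.
  by congr y; lia.
by have -> : (k - (n - m.+1) = (k - (n - m)).+1)%N by lia.
Qed.

Lemma iter_window_op_last k (G : X -> R) y :
  iter k window_op (fun y => G (y n)) y = iter k (kern_op M pib) G (y n).
Proof.
by elim: k y => [|k IH] y //=; apply: eq_bigr => x _; rewrite IH push_last.
Qed.

(** The last n slides replace all entries but the newest one, so k + n slides amount to k steps of
    the pair chain followed by a fresh forward window. *)
Lemma iter_window_op_split k g y : prefix_det n g ->
  iter (k + n) window_op g y =
  iter k (kern_op M pib) (fun x => forward_exp n x g) (y n).
Proof.
move=> hg; rewrite iterD -iter_window_op_last; congr (iter k window_op _ y).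
apply/funext => v; rewrite iter_window_op_forward //.
congr (forward_exp n _ _); apply/funext => u; congr g; apply/funext => k'.
by rewrite subnn subn0.
Qed.

Lemma forward_expB m x g h :
  forward_exp m x (g \- h) = forward_exp m x g - forward_exp m x h.
Proof.
elim: m x g h => [|m IH] x g h //=; rewrite -sumrB.
by apply: eq_bigr => x' _; rewrite -mulrBr -IH.
Qed.

Lemma forward_exp_norm m x g c :
  (forall y, `|g y| <= c) -> `|forward_exp m x g| <= c.
Proof.
elim: m x g => [|m IH] x g hg //=; apply: pmf_sum_norm => [|x'].
  exact: kern_pmf.
by apply: IH.
Qed.

Lemma forward_exp_head m x (F : X -> (nat -> X) -> R) :
  forward_exp m x (fun y => F (y 0%N) y) = forward_exp m x (F x).
Proof. by case: m. Qed.

Lemma window_meanB g h : window_mean (g \- h) = window_mean g - window_mean h.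
Proof.
rewrite /window_mean -sumrB; apply: eq_bigr => x _.
by rewrite forward_expB mulrBr.
Qed.

Lemma window_mean_norm g c : (forall y, `|g y| <= c) -> `|window_mean g| <= c.
Proof.
by move=> hg; apply: pmf_sum_norm => // x; apply: forward_exp_norm.
Qed.

Lemma iter_kern_op_kstep k (G : X -> R) s :
  \sum_a pib s a * iter k (kern_op M pib) G (s, a) =
  \sum_s' kstep M pib k s s' * \sum_a pib s' a * G (s', a).
Proof.
elim: k s => [|k IH] s /=.
  rewrite [RHS](bigD1 s) //= kstep0 eqxx mul1r [X in _ + X]big1 ?addr0 // => s'.
  by rewrite kstep0 eq_sym => /negbTE ->; rewrite mul0r.
have -> : \sum_a pib s a * kern_op M pib (iter k (kern_op M pib) G) (s, a) =
    \sum_s' state_kern M pib s s' *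
      \sum_a pib s' a * iter k (kern_op M pib) G (s', a).
  rewrite /state_kern.
  under [RHS]eq_bigr do rewrite big_distrl /=.
  rewrite exchange_big /=; apply: eq_bigr => a _.
  rewrite /kern_op sum_pairE big_distrr /=; apply: eq_bigr => s' _.
  rewrite -mulrA; congr (_ * _); rewrite big_distrr /=.
  by apply: eq_bigr => a' _; rewrite /kern /= mulrA.
under [LHS]eq_bigr => s' _ do rewrite IH big_distrr /=.
rewrite exchange_big /=; apply: eq_bigr => s'' _.
rewrite -add1n kstepD big_distrl /=; apply: eq_bigr => s' _.
by rewrite mulrA -kstep1.
Qed.

(** Mixing is stated for states, so one extra step leads from the pair [z] to a state law, after
    which t steps mix and the action is drawn afresh. The 2 converts total variation to l1. *)
Lemma kern_op_mixing t alpha (G : X -> R) (c : R) (z : X) :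
  mixed M pib mub alpha t -> (forall x, `|G x| <= c) ->
  `|iter t.+1 (kern_op M pib) G z - \sum_x kappa pib mub x * G x| <=
  2 * alpha * c.
Proof.
move=> hmix hG; pose Gs s := \sum_a pib s a * G (s, a).
have hGs s : `|Gs s| <= c by apply: pmf_sum_norm (pib_policy s) _ => a.
have -> : \sum_x kappa pib mub x * G x = \sum_s mub s * Gs s.
  rewrite sum_pairE; apply: eq_bigr => s _; rewrite big_distrr /=.
  by apply: eq_bigr => a _; rewrite /kappa /start_law mulrA.
have -> : iter t.+1 (kern_op M pib) G z =
    \sum_s' trans M z.2 z.1 s' * \sum_s kstep M pib t s' s * Gs s.
  rewrite /= {1}/kern_op sum_pairE; apply: eq_bigr => s' _.
  rewrite -iter_kern_op_kstep big_distrr /=.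
  by apply: eq_bigr => a _; rewrite /kern /= mulrA.
have hp := trans_pmf M z.2 z.1.
rewrite -[X in _ - X](pmf_sum_cst _ hp) -sumrB.
under eq_bigr do rewrite -mulrBr.
apply: pmf_sum_norm hp _ => s'; rewrite -sumrB.
under eq_bigr do rewrite -mulrBl.
apply: le_trans (ler_norm_sum _ _ _) _.
apply: (@le_trans _ _ (\sum_s `|kstep M pib t s' s - mub s| * c)).
  by apply: ler_sum => s _; rewrite normrM ler_wpM2l.
have c0 : 0 <= c by apply: le_trans (hG z).
rewrite -big_distrl /= ler_wpM2r //.
by have := hmix s'; rewrite /tv_dist ler_pdivrMl.
Qed.

Variables (m : nat) (alpha : R).

(* Truncated solution of the Poisson equation h - window_op h = g - mean g. *)
Definition poisson g y : R :=
  \sum_(j < m) (iter j window_op g y - window_mean g).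

Lemma poissonB g h y : poisson (g \- h) y = poisson g y - poisson h y.
Proof.
rewrite -sumrB; apply: eq_bigr => j _.
rewrite iter_window_opB window_meanB; ring.
Qed.

Lemma poisson_norm g c y : (forall y, `|g y| <= c) ->
  `|poisson g y| <= 2 * m%:R * c.
Proof.
move=> hg; apply: le_trans (ler_norm_sum _ _ _) _.
apply: (@le_trans _ _ (\sum_(j < m) (c + c))).
  apply: ler_sum => j _; apply: le_trans (ler_normB _ _) _.
  by rewrite lerD ?iter_window_op_norm ?window_mean_norm.
rewrite sumr_const card_ord -mulr_natl le_eqVlt; apply/orP; left; apply/eqP.
ring.
Qed.

Lemma poisson_prefix g : prefix_det n g -> prefix_det n (poisson g).
Proof.
move=> hg z z' h; apply: eq_bigr => j _; congr (_ - _).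
exact: iter_window_op_prefix h.
Qed.

(** The sum telescopes. Truncation leaves the m-step expectation of [g] where an exact solution
    would have its mean; [poisson_residual] bounds the discrepancy. *)
Lemma poisson_eq g y :
  window_op (poisson g) y =
  poisson g y - g y + iter m window_op g y.
Proof.
have -> : window_op (poisson g) y =
    \sum_(j < m) (iter j.+1 window_op g y - window_mean g).
  rewrite /window_op /poisson.
  under eq_bigr do rewrite big_distrr /=.
  rewrite exchange_big /=; apply: eq_bigr => j _.
  under eq_bigr do rewrite mulrBr.
  rewrite sumrB; congr (_ - _).
  exact: window_op_cst.
have <- : poisson g y + \sum_(j < m) (iter j.+1 window_op g y -
    iter j window_op g y) = \sum_(j < m) (iter j.+1 window_op g y - window_mean g).
  by rewrite -big_split /=; apply: eq_bigr => j _; ring.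
rewrite -(big_mkord xpredT (fun j => iter j.+1 window_op g y -
    iter j window_op g y)) telescope_sumr //= -addrA; congr (_ + _).
by rewrite addrC.
Qed.

Lemma poisson_residual g c y t : m = (t + n + 1)%N -> prefix_det n g ->
  mixed M pib mub alpha t -> (forall y, `|g y| <= c) ->
  `|iter m window_op g y - window_mean g| <= 2 * alpha * c.
Proof.
move=> -> hg hmix hc; rewrite addn1 -addSn iter_window_op_split //.
by apply: kern_op_mixing hmix _ => x; apply: forward_exp_norm.
Qed.

End Windows.

Lemma f_geomE (R : realType) (n : nat) (x : R) :
  f_geom n x = \sum_(i < n.+1) x ^+ i.
Proof.
rewrite /f_geom; case: eqVneq => [->|x1].
  by under eq_bigr do rewrite expr1n; rewrite sumr_const card_ord.
have x0 : 1 - x != 0 by rewrite subr_eq0 eq_sym.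
apply: (mulfI x0); rewrite mulrCA divff // mulr1.
rewrite -[X in X - _](expr1n _ n.+1) subrXX; congr (_ * _).
by apply: eq_bigr => i _; rewrite expr1n mul1r.
Qed.

Lemma f_geom_ge1 (R : realType) (n : nat) (x : R) : 0 <= x -> 1 <= f_geom n x.
Proof.
move=> x0; rewrite f_geomE big_ord_recl expr0 lerDl.
by apply: sumr_ge0 => i _; rewrite exprn_ge0.
Qed.

Lemma f_geom_le (R : realType) (n : nat) (x y : R) :
  0 <= x -> x <= y -> f_geom n x <= f_geom n y.
Proof.
move=> x0 xy; rewrite !f_geomE; apply: ler_sum => i _.
by rewrite lerXn2r ?nnegrE // (le_trans x0).
Qed.

Section TemporalDifference.
Variables (R : realType) (S A : finType) (M : mdp R S A).
Variables (d : nat) (phi : S -> A -> 'cV[R]_d).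
Variables (pib : S -> A -> R) (mub : S -> R) (n : nat) (pi : S -> A -> R).
Local Notation gam := (discount M).
Local Notation linz := (linz phi).
Local Notation rho := (rho pib pi).
Local Notation f := (f_geom n (gam * zeta_max pib)).
Hypothesis pib_policy : is_policy pib.
Hypothesis pib_gt0 : forall s a, 0 < pib s a.
Hypothesis pi_policy : is_policy pi.
Hypothesis phi_norm : forall s a, \sum_i `|phi s a i 0| <= 1.
Hypothesis n_gt0 : (0 < n)%N.
Implicit Types (w v : 'cV[R]_d) (y : nat -> S * A).

Definition shift y : nat -> S * A := fun k => y k.+1.

Fixpoint nstep_return (k : nat) w y : R :=
  if k is k'.+1 then
    rew M (y 0%N) + gam * rho (y 1%N) * nstep_return k' w (shift y)
  else linz w (y 0%N).

Definition td w y : R := nstep_return n w y - linz w (y 0%N).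

(** Inner product of [v] with the critic increment before scaling by alpha. Only this scalar
    receives a Poisson correction. *)
Definition td_dir v w y : R := linz v (y 0%N) * td w y.

(* The corrections telescope against the bootstrap terms because their weight
   is exactly the discounted importance ratio. *)
Lemma nstep_tdE z w k :
  nstep_td M phi pib n pi z w k = td w (fun i => z (k + i)%N).
Proof.
rewrite /nstep_td /td; elim: n k => [|j IH] k.
  by rewrite addn0 big_geq //= addn0 subrr.
rewrite addnS big_ltn ?ltnS ?leq_addr // subnn expr0 big_geq // !mul1r.
have -> : \sum_(k.+1 <= i < (k + j).+1)
    gam ^+ (i - k) * (\prod_(k.+1 <= l < i.+1) rho (z l)) *
    td_error M phi pib pi z w i =
    gam * rho (z k.+1) * \sum_(k.+1 <= i < k.+1 + j)
    gam ^+ (i - k.+1) * (\prod_(k.+2 <= l < i.+1) rho (z l)) *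
    td_error M phi pib pi z w i.
  rewrite big_distrr /= addSn [LHS]big_nat [RHS]big_nat.
  apply: eq_bigr => i /andP[ki _].
  rewrite big_ltn ?ltnS //; have -> : (i - k = (i - k.+1).+1)%N by lia.
  by rewrite exprS; ring.
rewrite IH /td_error /= /shift !addn0 addn1.
have -> : (fun i => z (k.+1 + i)%N) = (fun k0 => z (k + k0.+1)%N).
  by apply/funext => i; rewrite addSnnS.
rewrite /linz -/(rew M (z k)); ring.
Qed.

Lemma nstep_return_prefix k w : prefix_det k (nstep_return k w).
Proof.
elim: k => [|k IH] z z' h /=; first by rewrite h.
rewrite !h //; congr (_ + _ * _); apply: IH => i ik.
by rewrite /shift h.
Qed.

Lemma td_prefix w : prefix_det n (td w).
Proof.
by move=> z z' h; rewrite /td h // (nstep_return_prefix _ h).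
Qed.

Lemma td_dir_prefix v w : prefix_det n (td_dir v w).
Proof. by move=> z z' h; rewrite /td_dir h // (td_prefix _ h). Qed.

Lemma kern_rho z x : kern M pib z x * rho x = kern M pi z x.
Proof. by rewrite /kern /rho; field; rewrite gt_eqF. Qed.

(** The affine shape is what the induction preserves: peeling off an observation multiplies by the
    discounted ratio and adds a reward. The ratio turns the kernel of [pib] into that of [pi]. *)
Lemma forward_exp_return k w x (c e : R) :
  forward_exp M pib k x (fun y => c * nstep_return k w y + e) =
  c * iter k (bellz M pi) (linz w) x + e.
Proof.
elim: k x c e => [|k IH] x c e //=.
have -> : \sum_x' kern M pib x x' * forward_exp M pib k x'
      (fun y => c * (rew M x + gam * rho (y 0%N) * nstep_return k w
         (shift (scons x y))) + e) =
    \sum_x' kern M pib x x' * ((c * (gam * rho x')) *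
      iter k (bellz M pi) (linz w) x' + (c * rew M x + e)).
  apply: eq_bigr => x' _; congr (_ * _).
  rewrite -IH (forward_exp_head M pib k x' (fun x' y =>
    c * (rew M x + gam * rho x' * nstep_return k w (shift (scons x y))) + e)).
  congr (forward_exp _ _ _ _ _); apply/funext => y.
  by rewrite (_ : shift (scons x y) = y) //; ring.
under eq_bigr do rewrite mulrDr.
rewrite big_split /= (pmf_sum_cst _ (kern_pmf M x pib_policy)).
have -> : \sum_x' kern M pib x x' * (c * (gam * rho x') *
    iter k (bellz M pi) (linz w) x') =
    c * gam * kern_op M pi (iter k (bellz M pi) (linz w)) x.
  rewrite big_distrr /=; apply: eq_bigr => x' _.
  by rewrite -kern_rho; ring.
by rewrite /bellz; ring.
Qed.

Lemma window_mean_td v w : window_mean M pib mub n (td_dir v w) =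
  wip (kappa pib mub) (linz v) (iter n (bellz M pi) (linz w) \- linz w).
Proof.
apply: eq_bigr => x _; congr (_ * _).
rewrite (forward_exp_head M pib n x
  (fun x y => linz v x * (nstep_return n w y - linz w x))).
rewrite mulrBr -forward_exp_return; congr (forward_exp _ _ _ _ _).
by apply/funext => y; rewrite mulrBr.
Qed.

Lemma rho_ge0 x : 0 <= rho x.
Proof. by rewrite divr_ge0 ?(pi_policy _).1 // ltW. Qed.

Lemma rho_le x : rho x <= zeta_max pib.
Proof.
apply: (@le_trans _ _ (pib x.1 x.2)^-1).
  rewrite /rho ler_piMl ?invr_ge0 ?(ltW (pib_gt0 _ _)) //.
  rewrite -(pi_policy x.1).2 (bigD1 x.2) //= lerDl sumr_ge0 // => a _.
  exact: (pi_policy x.1).1.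
exact: (le_bigmax _ (fun z : S * A => (pib z.1 z.2)^-1)).
Qed.

Lemma zeta_max_ge0 : 0 <= zeta_max pib. Proof. exact: bigmax_ge_id. Qed.

Let x0 : 0 <= gam * zeta_max pib.
Proof. by rewrite mulr_ge0 ?zeta_max_ge0 // ltW // discount_gt0. Qed.

Let rho_step x (r c : R) : `|r| <= c ->
  `|gam * rho x * r| <= gam * zeta_max pib * c.
Proof.
move=> rc; have g0 := ltW (discount_gt0 M).
rewrite normrM ger0_norm; last by rewrite mulr_ge0 // rho_ge0.
apply: ler_pM => //; first by rewrite mulr_ge0 ?rho_ge0.
by rewrite ler_wpM2l ?rho_le.
Qed.

Lemma nstep_return_norm k w y : `|nstep_return k w y| <=
  \sum_(i < k) (gam * zeta_max pib) ^+ i + (gam * zeta_max pib) ^+ k * linf w.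
Proof.
elim: k y => [|k IH] y /=; first by rewrite big_ord0 add0r mul1r linz_norm.
apply: le_trans (ler_normD _ _) _; rewrite big_ord_recl expr0 -addrA.
apply: lerD; first exact: rew_norm.
apply: le_trans (rho_step _ (IH _)) _; rewrite mulrDr big_distrr /=.
apply: lerD; last by rewrite [in leRHS]exprS mulrA.
by apply: ler_sum => i _; rewrite exprS.
Qed.

Lemma nstep_returnB_norm k w w' y :
  `|nstep_return k w y - nstep_return k w' y| <=
  (gam * zeta_max pib) ^+ k * linf (w - w').
Proof.
elim: k y => [|k IH] y /=.
  by rewrite mul1r; have := linz_norm phi_norm (w - w') (y 0%N); rewrite linzB.
rewrite opprD addrACA subrr add0r -mulrBr exprS -mulrA.
exact: rho_step.
Qed.

(** For n > 0 the terms of exponent 0 and n of the geometric sum are distinct. One factor [f] thus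
    controls both the size and the Lipschitz constant of [td]. *)
Let f_ge : 1 + (gam * zeta_max pib) ^+ n <= f.
Proof.
case: n n_gt0 => // k _; rewrite f_geomE big_ord_recr big_ord_recl /= expr0.
by rewrite lerD2r lerDl; apply: sumr_ge0 => i _; rewrite exprn_ge0.
Qed.

Lemma td_norm w y : `|td w y| <= f * (1 + linf w).
Proof.
apply: le_trans (ler_normB _ _) _.
apply: le_trans (lerD (nstep_return_norm _ _ _) (linz_norm phi_norm _ _)) _.
rewrite mulrDr mulr1 -addrA; apply: lerD.
  by rewrite f_geomE big_ord_recr /= lerDl exprn_ge0.
by rewrite -[X in _ + X]mul1r -mulrDl ler_wpM2r ?linf_ge0 // addrC.
Qed.

Lemma tdB_norm w w' y : `|td w y - td w' y| <= f * linf (w - w').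
Proof.
have -> : td w y - td w' y =
    (nstep_return n w y - nstep_return n w' y) - linz (w - w') (y 0%N).
  by rewrite /td linzB /=; ring.
apply: le_trans (ler_normB _ _) _.
apply: le_trans (lerD (nstep_returnB_norm _ _ _ _) (linz_norm phi_norm _ _)) _.
by rewrite -[X in _ + X]mul1r -mulrDl ler_wpM2r ?linf_ge0 // addrC.
Qed.

Lemma td_dir_norm v w y : `|td_dir v w y| <= linf v * (f * (1 + linf w)).
Proof. by rewrite normrM ler_pM ?linz_norm ?td_norm. Qed.

End TemporalDifference.

(** * Mean-square error of the critic *)

(** By (s + b)^2 <= 2 (E + b^2), the noise costs at most 34 al kap E <= al rho E, half of the drift.
    The correction 2 al h is at most 6 kap E + 2 kap b^2, hence E is comparable to the Lyapunov
    value. Exchanging E for it leaves the rate 2/3 al rho and adds 4/3 to 34, below 36. *)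
Lemma lyapunov_descent (R : realFieldType) (E s b al kap rho h WL : R) :
  0 <= s -> s ^+ 2 <= E -> 0 <= b -> 0 < al -> 0 <= kap ->
  34 * kap <= rho -> rho <= 1 ->
  `|al * h| <= 2 * kap * (s * (s + b)) ->
  WL <= E + 2 * al * h - 2 * al * rho * E + 17 * al * kap * (s + b) ^+ 2 ->
  [/\ WL <= (1 - 2 / 3 * (al * rho)) * (E + 2 * al * h) + 36 * al * kap * b ^+ 2,
      E + 2 * al * h <= 3 / 2 * E + 2 * kap * b ^+ 2 &
      E <= 2 * (E + 2 * al * h) + 4 * kap * b ^+ 2].
Proof.
move=> s0 sE b0 al0 k0 kr r1 /ler_normlP[h1 h2] hW.
have P2 : (s + b) ^+ 2 <= 2 * (E + b ^+ 2).
  by have := sqr_ge0 (s - b); rewrite sqrrB sqrrD; lra.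
have sP : s * (s + b) <= 3 / 2 * E + b ^+ 2 / 2.
  by have := sqr_ge0 (s - b); rewrite sqrrB mulrDr -expr2; lra.
have E0 : 0 <= E by apply: le_trans sE; apply: sqr_ge0.
have b2 : 0 <= b ^+ 2 := sqr_ge0 b.
have kE : kap * E <= E / 34.
  have : 34 * kap * E <= 1 * E by rewrite ler_wpM2r // (le_trans kr).
  by lra.
have hk : 2 * kap * (s * (s + b)) <= 3 * (kap * E) + kap * b ^+ 2.
  have := ler_wpM2l k0 sP; lra.
have c1 : E + 2 * al * h <= 3 / 2 * E + 2 * kap * b ^+ 2 by lra.
split=> //; last by lra.
have k2 : al * kap * (s + b) ^+ 2 <= al * kap * (2 * (E + b ^+ 2)).
  by rewrite ler_wpM2l // mulr_ge0 // ltW.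
have arE : 34 * al * kap * E <= al * rho * E.
  by rewrite ler_wpM2r // [34 * al]mulrC -mulrA ler_wpM2l // ltW.
have aL := ler_wpM2l (mulr_ge0 (ltW al0) (le_trans (mulr_ge0 (ler0n _ 34) k0) kr)) c1.
have ark : al * rho * (kap * b ^+ 2) <= al * (kap * b ^+ 2).
  by rewrite ler_wpM2r ?mulr_ge0 // ler_piMr // ltW.
have st1 : WL <= E + 2 * al * h - al * rho * E + 34 * (al * kap * b ^+ 2).
  by move: hW k2 arE; move: ((s + b) ^+ 2) (b ^+ 2) => x y; lra.
have akb : 0 <= al * (kap * b ^+ 2) by rewrite !mulr_ge0 // ltW.
by move: st1 aL ark akb; move: (b ^+ 2) => y; lra.
Qed.

Section Critic.
Variables (R : realType) (S A : finType) (M : mdp R S A).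
Variables (d : nat) (phi : S -> A -> 'cV[R]_d).
Variables (pib : S -> A -> R) (mub : S -> R) (lam gamma_c : R) (n : nat).
Local Notation gam := (discount M).
Local Notation f := (f_geom n (gam * zeta_max pib)).
Local Notation linz := (linz phi).
Hypothesis pib_policy : is_policy pib.
Hypothesis pib_gt0 : forall s a, 0 < pib s a.
Hypothesis mub_pmf : is_pmf mub.
Hypothesis mub_gt0 : forall s, 0 < mub s.
Hypothesis phi_norm : forall s a, \sum_i `|phi s a i 0| <= 1.
Hypothesis phi_free : features_free phi.
Hypothesis lam_min : is_min_eigenvalue phi pib mub lam.
Hypothesis d_gt0 : (0 < d)%N.
Hypothesis gc01 : 0 < gamma_c < 1.
Hypothesis n_gt0 : (0 < n)%N.
Hypothesis n_large :
  (2 * ln gamma_c + ln (kappa_min pib mub)) / (2 * ln gam) <= n%:R.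

Variables (alpha : R) (t : nat).
Local Notation m := (t + n + 1)%N.
Local Notation rho0 := ((1 - gamma_c) * lam).
Local Notation noise := (m%:R * alpha * f ^+ 2).
Hypothesis alpha_gt0 : 0 < alpha.
Hypothesis t_mixed : mixed M pib mub alpha t.
Hypothesis alpha_small : 34 * noise <= rho0.

(** Chosen so that 1 + linf w <= linf (w - wst) + b for every target policy. *)
Let b : R := 1 + wbound M lam gamma_c.

Lemma kap_pmf : is_pmf (kappa pib mub). Proof. exact: start_law_pmf. Qed.

Lemma kap_pos z : 0 < kappa pib mub z. Proof. by rewrite mulr_gt0. Qed.

Lemma f_ge1 : 1 <= f.
Proof.
by rewrite f_geom_ge1 // mulr_ge0 ?zeta_max_ge0 // ltW // discount_gt0.
Qed.

Lemma b_ge1 : 1 <= b. Proof. by rewrite lerDl wbound_ge0. Qed.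

Lemma rho0_gt0 : 0 < rho0.
Proof.
have /andP[_ gc1] := gc01; rewrite mulr_gt0 ?subr_gt0 //.
exact: min_eigenvalue_gt0 kap_pos phi_free lam_min.
Qed.

Lemma rho0_le1 : rho0 <= 1.
Proof.
have /andP[/ltW gc0 gc1] := gc01.
have l1 := min_eigenvalue_le1 phi_norm kap_pos kap_pmf.2 lam_min.
have l0 := ltW (min_eigenvalue_gt0 kap_pos phi_free lam_min).
by rewrite mulr_ile1 // ?subr_ge0 ?(ltW gc1) // lerBlDr lerDl.
Qed.

Lemma noise_ge0 : 0 <= noise.
Proof. by rewrite mulr_ge0 ?sqr_ge0 // mulr_ge0 // ltW. Qed.

Lemma alpha_le1 : alpha <= 1.
Proof.
apply: (@le_trans _ _ noise).
  have -> : noise = alpha * (m%:R * f ^+ 2) by ring.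
  rewrite ler_peMr ?(ltW alpha_gt0) // mulr_ege1 ?exprn_ege1 ?f_ge1 //.
  by rewrite ler1n addn1.
apply: le_trans (le_trans alpha_small rho0_le1).
by rewrite ler_peMl ?noise_ge0 // ler1n.
Qed.

Let m1 : 1 <= m%:R :> R. Proof. by rewrite ler1n addn1. Qed.

(** The last of k > 0 updates starts at index k - 1 and looks n entries ahead, so it reads up to
    index k + n - 1. *)
Lemma critic_prefix pi N (z z' : nat -> S * A) k :
  (forall i, (i <= N)%N -> z i = z' i) -> (k + n <= N.+1)%N ->
  critic M phi pib n pi z alpha 0 k = critic M phi pib n pi z' alpha 0 k.
Proof.
move=> hz; elim: k => [|k IH] //= kN.
have hk : (k + n <= N)%N by rewrite -ltnS -addSn.
have kN' : (k <= N)%N by apply: leq_trans hk; rewrite leq_addr.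
rewrite (IH (leqW hk)) !nstep_tdE // (hz k kN').
congr (_ + (_ * _) *: _); apply: td_prefix => i iN.
by apply: hz; apply: leq_trans hk; rewrite leq_add2l.
Qed.

Section Target.
Variable pi : S -> A -> R.
Hypothesis pi_policy : is_policy pi.
Local Notation wst := (wstar M phi pib mub n pi).
Local Notation tdd := (td_dir M phi pib n pi).
Local Notation h v w := (poisson M pib mub n m (tdd v w)).
Local Notation W := (window_op M pib n).

(* The Poisson correction turns the Markovian noise into a martingale term. *)
Definition lyapunov (w : 'cV[R]_d) (y : nat -> S * A) : R :=
  dot (w - wst) (w - wst) + 2 * alpha * h (w - wst) w y.

Definition critic_step (w : 'cV[R]_d) (y : nat -> S * A) : 'cV[R]_d :=
  w + (alpha * td M phi pib n pi w y) *: phi (y 0%N).1 (y 0%N).2.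

Lemma lyapunov_prefix w : prefix_det n (lyapunov w).
Proof.
move=> z z' hz; congr (_ + _ * _); apply: poisson_prefix hz.
exact: td_dir_prefix.
Qed.

Lemma lyapunov_step w y :
  [/\ W (lyapunov (critic_step w y)) y <=
        (1 - 2 / 3 * (alpha * rho0)) * lyapunov w y + 36 * alpha * noise * b ^+ 2,
      lyapunov w y <= 3 / 2 * dot (w - wst) (w - wst) + 2 * noise * b ^+ 2 &
      dot (w - wst) (w - wst) <= 2 * lyapunov w y + 4 * noise * b ^+ 2].
Proof.
have f1 := f_ge1; have f0 : 0 <= f := le_trans ler01 f1.
have a0 := ltW alpha_gt0; have b0 := le_trans ler01 b_ge1.
pose u := w - wst; pose s := linf u; pose P := s + b.
have s0 : 0 <= s := linf_ge0 u.
have P0 : 0 <= P by rewrite addr_ge0.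
have sP : s <= P by rewrite lerDl.
have wP : 1 + linf w <= P.
  rewrite /P /b addrCA lerD2l -{1}[w](subrK wst); apply: le_trans (linfD _ _) _.
  by rewrite lerD2l wstar_linf //; [exact: kap_pos|exact: kap_pmf.2].
pose w' := critic_step w y; pose u' := w' - wst.
pose dl := td M phi pib n pi w y.
have dlP : `|dl| <= f * P.
  apply: le_trans (td_norm M pib_gt0 pi_policy phi_norm n_gt0 w y) _.
  by rewrite ler_wpM2l.
have w'E : w' - w = (alpha * dl) *: phi (y 0%N).1 (y 0%N).2.
  by rewrite /w' /critic_step addrC addKr.
have u'E : u' - u = w' - w by rewrite /u' /u opprB addrA subrK.
pose eta := alpha * (f * P).
have stepP : linf (w' - w) <= eta.
  rewrite w'E; apply: le_trans (linfZ _ _) _.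
  rewrite normrM (ger0_norm a0) -[leRHS]mulr1.
  by apply: ler_pM; rewrite ?mulr_ge0 ?linf_ge0 ?linf_phi // ler_wpM2l.
have af1 : alpha * f <= 1.
  have h1 : alpha * f <= noise.
    have -> : noise = alpha * f * (m%:R * f) by ring.
    by rewrite ler_peMr ?mulr_ge0 // mulr_ege1.
  apply: le_trans h1 _; apply: le_trans (le_trans alpha_small rho0_le1).
  by rewrite ler_peMl ?noise_ge0 // ler1n.
have eta0 : 0 <= eta by rewrite !mulr_ge0.
have etaP : eta <= P by rewrite /eta mulrA ler_piMl.
have w'P : 1 + linf w' <= 2 * P.
  rewrite -[w'](subrK w); have := linfD (w' - w) w; lra.
have m0 : 0 <= m%:R :> R by [].
have tddn v x c y' : linf v <= c -> `|tdd v x y'| <= c * (f * (1 + linf x)).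
  move=> vc; apply: le_trans (td_dir_norm M pib_gt0 pi_policy phi_norm n_gt0 v x y') _.
  by rewrite ler_wpM2r // mulr_ge0 // addr_ge0 ?linf_ge0.
have tddP y' : `|tdd u w y'| <= s * (f * P).
  by apply: le_trans (tddn u w s y' _) _ => //; rewrite ler_wpM2l // ler_wpM2l.
(* Of the 6, the change of direction from u to u' contributes 4 and the change of parameter from w
   to w' contributes 2. *)
pose D := 6 * (m%:R * alpha * f ^+ 2) * P ^+ 2.
have diff y' : `|h u' w' y' - h u w y'| <= D.
  have -> : h u' w' y' - h u w y' =
      poisson M pib mub n m (tdd u' w' \- tdd u w') y' +
      poisson M pib mub n m (tdd u w' \- tdd u w) y'.
    by rewrite !poissonB; ring.
  apply: le_trans (ler_normD _ _) _.
  have d1 : `|poisson M pib mub n m (tdd u' w' \- tdd u w') y'| <=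
      2 * m%:R * (eta * (f * (2 * P))).
    apply: poisson_norm => // [|v]; first exact: kap_pmf.
    have -> : (tdd u' w' \- tdd u w') v = tdd (u' - u) w' v.
      by rewrite /td_dir (linzB phi u' u) /= mulrBl.
    apply: le_trans (tddn _ _ eta _ _) _; first by rewrite u'E.
    by rewrite !ler_wpM2l.
  have d2 : `|poisson M pib mub n m (tdd u w' \- tdd u w) y'| <=
      2 * m%:R * (P * (f * eta)).
    apply: poisson_norm => // [|v]; first exact: kap_pmf.
    rewrite /= /td_dir -mulrBr normrM; apply: ler_pM => //.
      exact: le_trans (linz_norm phi_norm _ _) sP.
    apply: le_trans (tdB_norm M pib_gt0 pi_policy phi_norm n_gt0 _ _ _) _.
    by rewrite ler_wpM2l.
  apply: le_trans (lerD d1 d2) _; rewrite le_eqVlt; apply/orP; left; apply/eqP.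
  rewrite /D /eta; ring.
have bell v : window_mean M pib mub n (tdd v w) =
    wip (kappa pib mub) (linz v) (iter n (bellz M pi) (linz w) \- linz w).
  exact: window_mean_td.
have drift : window_mean M pib mub n (tdd u w) <= - (rho0 * dot u u).
  rewrite bell; apply: wstar_drift => //; [exact: kap_pos|exact: kap_pmf.2].
pose res := iter m W (tdd u w) y - window_mean M pib mub n (tdd u w).
have resP : `|res| <= 2 * alpha * (s * (f * P)).
  apply: (poisson_residual pib_policy y (erefl m) _ t_mixed tddP).
  exact: td_dir_prefix.
have WhE : W (h u w) y = h u w y - tdd u w y + iter m W (tdd u w) y.
  exact: poisson_eq.
have WdP : `|W (h u' w') y - W (h u w) y| <= D.
  rewrite -window_opB; apply: window_op_norm => //.
have WLE : W (lyapunov w') y = dot u' u' + 2 * alpha * W (h u' w') y.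
  rewrite /window_op /lyapunov; under eq_bigr do rewrite mulrDr.
  rewrite big_split /= (pmf_sum_cst _ (kern_pmf M (y n) pib_policy)).
  by rewrite big_distrr /=; congr (_ + _); apply: eq_bigr => x _; rewrite mulrCA.
have uuE : dot u' u' <= dot u u + 2 * alpha * tdd u w y + alpha ^+ 2 * (f * P) ^+ 2.
  have -> : u' = u + (alpha * dl) *: phi (y 0%N).1 (y 0%N).2.
    by rewrite -w'E -u'E addrC subrK.
  rewrite (dot_sqrD u) /td_dir -/dl.
  have -> : linz u (y 0%N) = dot u (phi (y 0%N).1 (y 0%N).2).
    by rewrite linzE dotC.
  have := dot_phi_le1 phi_norm (y 0%N).1 (y 0%N).2.
  have := dot_ge0 (phi (y 0%N).1 (y 0%N).2).
  move: (dot (phi _ _) _) (dot u (phi _ _)) => p1 p2 p10 p11.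
  have dl2 : dl ^+ 2 <= (f * P) ^+ 2.
    by rewrite -(real_normK (num_real dl)) lerXn2r ?nnegrE // mulr_ge0.
  have q : alpha ^+ 2 * (dl ^+ 2 * p1) <= alpha ^+ 2 * (f * P) ^+ 2.
    rewrite ler_wpM2l ?sqr_ge0 // -[leRHS]mulr1.
    by apply: ler_pM => //; apply: sqr_ge0.
  by move: q; rewrite !expr2; move: (dot u u) => e; lra.
apply: (@lyapunov_descent _ (dot u u) s b alpha noise rho0 (h u w y)) => //.
- exact: linf_sqr_le.
- exact: noise_ge0.
- exact: rho0_le1.
- rewrite normrM (ger0_norm a0).
  have hp : `|h u w y| <= 2 * m%:R * (s * (f * P)).
    by apply: poisson_norm => //; exact: kap_pmf.
  apply: le_trans (ler_wpM2l a0 hp) _; rewrite -/P.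
  have -> : alpha * (2 * m%:R * (s * (f * P))) =
      2 * (m%:R * alpha * f) * (s * P) by ring.
  rewrite ler_wpM2r ?mulr_ge0 // ler_wpM2l // ler_wpM2l ?mulr_ge0 //.
  by rewrite expr2 ler_peMr.
rewrite -/w' WLE.
(* The term - tdd u w y cancels the cross term in the expansion of dot u' u'; only its stationary
   mean, the drift, remains. *)
have Wh : W (h u' w') y <= h u w y - tdd u w y + (res - rho0 * dot u u) + D.
  have /ler_normlP[_ q1] := WdP; move: q1 drift; rewrite WhE /res.
  by move: (W _ y) (h u w y) (tdd u w y) (iter m W _ y) (window_mean _ _ _ _ _) => *; lra.
have resB : res <= 2 * alpha * (f ^+ 2 * P ^+ 2).
  have /ler_normlP[_ q1] := resP; apply: le_trans q1 _.
  rewrite ler_wpM2l ?mulr_ge0 // -exprMn expr2 ler_wpM2r ?mulr_ge0 //.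
  by apply: le_trans sP _; rewrite ler_peMl.
have aW := ler_wpM2l a0 Wh; have aR := ler_wpM2l a0 resB.
(* The 17 of [lyapunov_descent] is 1 from the squared increment, 4 from the mixing residual and 12
   from [D]; the first two are enlarged by the factor m. *)
have mm : alpha ^+ 2 * (f ^+ 2 * P ^+ 2) <= m%:R * (alpha ^+ 2 * (f ^+ 2 * P ^+ 2)).
  by rewrite ler_peMl // !mulr_ge0 ?sqr_ge0.
move: uuE aW aR mm; rewrite -/P /D !exprMn.
move: (dot u' u') (W _ y) (h u w y) (tdd u w y) (dot u u) => *.
lra.
Qed.

Lemma criticS z k :
  critic M phi pib n pi z alpha 0 k.+1 =
  critic_step (critic M phi pib n pi z alpha 0 k) (fun i => z (k + i)%N).
Proof. by rewrite /= nstep_tdE // /critic_step /= addn0. Qed.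

End Target.

Section Expectation.
Variables (init : S * A -> R) (N0 : nat) (target : (nat -> S * A) -> S -> A -> R).
Hypothesis init_pmf : is_pmf init.
Hypothesis target_policy : forall z, is_policy (target z).
Hypothesis target_prefix : prefix_det N0 target.
Local Notation iterate z k :=
  (critic M phi pib n (target z) (fun i => z (N0 + i)%N) alpha 0 k).
Local Notation err z k := (iterate z k - wstar M phi pib mub n (target z)).

Let lyap k z : R :=
  lyapunov (target z) (iterate z k) (fun i => z (N0 + k + i)%N).

Let r : R := 2 / 3 * (alpha * rho0).

(** Iterate k+1 is determined by the observations up to N0 + k + n. Summing over the next one
    therefore only slides the window in the Poisson term, and [lyapunov_step] applies path by
    path. *)
Lemma lyapunov_recursion k :
  path_exp M pib init (N0 + k.+1 + n) (lyap k.+1) <=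
  (1 - r) * path_exp M pib init (N0 + k + n) (lyap k) +
  36 * alpha * noise * b ^+ 2.
Proof.
rewrite addnS addSn path_expS; last first.
  move=> z z' h; rewrite /lyap (@target_prefix z z'); last first.
    by move=> i iN; apply: h; lia.
  rewrite (@critic_prefix _ (k.+1 + n) (fun i => z (N0 + i)%N)
    (fun i => z' (N0 + i)%N)) //.
  - by apply: lyapunov_prefix => i iN; apply: h; lia.
  - by move=> i iN; apply: h; lia.
rewrite -path_expZ -[X in _ <= _ + X](path_exp_cst M (N0 + k + n) _ pib_policy init_pmf).
rewrite -path_expD; apply: path_exp_le => // [|z]; first exact: init_pmf.1.
have [+ _ _] := lyapunov_step (target_policy z) (iterate z k)
  (fun i => z (N0 + k + i)%N).
rewrite -/r; apply: le_trans; rewrite le_eqVlt; apply/orP; left; apply/eqP.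
apply: eq_bigr => x _; congr (_ * _).
have tz : target (extend (N0 + k + n) z x) = target z.
  by apply: target_prefix => i iN; rewrite /extend; have -> : (i <= N0 + k + n)%N by lia.
rewrite /lyap tz.
rewrite (@critic_prefix _ (k + n) _ (fun i => z (N0 + i)%N)) //; last first.
  by move=> i iN; rewrite /extend; have -> : (N0 + i <= N0 + k + n)%N by lia.
rewrite criticS.
have -> : (fun i => z (N0 + (k + i))%N) = (fun i => z (N0 + k + i)%N).
  by apply/funext => i; rewrite addnA.
apply: lyapunov_prefix => i iN; rewrite /extend /push.
case: ltnP => hi.
  have -> : (N0 + k.+1 + i <= N0 + k + n)%N by lia.
  by congr z; lia.
by have -> : (N0 + k.+1 + i <= N0 + k + n)%N = false by lia.
Qed.

(** From w = 0 the Lyapunov value starts below 2 b^2. The recursion settles at 36 alpha noise b^2 /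
    r = 54 noise b^2 / rho0; returning to the squared error doubles this to 108 and adds 4, absorbed
    using rho0 <= 1. *)
Lemma critic_expectation K :
  path_exp M pib init (N0 + K + n) (fun z => dot (err z K) (err z K)) <=
  4 * (1 - r) ^+ K * b ^+ 2 + 112 * noise * b ^+ 2 / rho0.
Proof.
have rho0_0 := rho0_gt0; have rho1 := rho0_le1; have nz := noise_ge0.
have i0 := init_pmf.1; have b1 := b_ge1.
have b2 : 0 <= b ^+ 2 := sqr_ge0 b.
have r0 : 0 < r by rewrite mulr_gt0 ?divr_gt0 // mulr_gt0.
have a1 : alpha * rho0 <= 1.
  apply: mulr_ile1 => //; [exact: ltW|exact: ltW|exact: alpha_le1].
have r1 : 0 <= 1 - r by rewrite /r; lra.
have base z : lyap 0 z <= 2 * b ^+ 2.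
  have [_ + _] := lyapunov_step (target_policy z) (iterate z 0)
    (fun i => z (N0 + 0 + i)%N).
  move=> /le_trans; apply; rewrite /= sub0r -scaleN1r dotZl dotZr !mulN1r opprK.
  have h1 : dot (wstar M phi pib mub n (target z)) (wstar M phi pib mub n (target z))
      <= b ^+ 2.
    apply: (@le_trans _ _ (wbound M lam gamma_c ^+ 2)).
      by apply: wstar_dot => //; [exact: kap_pos|exact: kap_pmf.2].
    by rewrite lerXn2r ?nnegrE ?wbound_ge0 ?(le_trans ler01 b1) // lerDr.
  have nb : noise * b ^+ 2 <= 1 / 34 * b ^+ 2.
    by rewrite ler_wpM2r // ler_pdivlMr // mulrC (le_trans alpha_small).
  by move: h1 nb b2; move: (b ^+ 2) (noise) (dot _ _) => *; lra.
have rec k : path_exp M pib init (N0 + k + n) (lyap k) <=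
    (1 - r) ^+ k * (2 * b ^+ 2) + 36 * alpha * noise * b ^+ 2 / r.
  elim: k => [|k IH].
    rewrite expr0 mul1r; apply: (@le_trans _ _ (2 * b ^+ 2)); last first.
      rewrite lerDl divr_ge0 ?(ltW r0) // mulr_ge0 // mulr_ge0 // mulr_ge0 //.
      exact: ltW.
    rewrite -[leRHS](path_exp_cst M (N0 + 0 + n) _ pib_policy init_pmf).
    exact: path_exp_le.
  apply: le_trans (lyapunov_recursion k) _.
  apply: le_trans (lerD (ler_wpM2l r1 IH) (lexx _)) _.
  rewrite [(1 - r) ^+ k.+1]exprS le_eqVlt; apply/orP; left; apply/eqP.
  by move: r r0 {r1} => x x0; field; rewrite gt_eqF.
have hK : path_exp M pib init (N0 + K + n) (fun z => dot (err z K) (err z K)) <=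
   2 * path_exp M pib init (N0 + K + n) (lyap K) + 4 * noise * b ^+ 2.
  rewrite -path_expZ -[X in _ <= _ + X](path_exp_cst M (N0 + K + n) _ pib_policy init_pmf).
  rewrite -path_expD; apply: path_exp_le => // z.
  by have [_ _] := lyapunov_step (target_policy z) (iterate z K)
    (fun i => z (N0 + K + i)%N).
apply: le_trans hK _.
have h2 := ler_wpM2l (ler0n R 2) (rec K).
apply: le_trans (lerD h2 (lexx _)) _.
have -> : 2 * ((1 - r) ^+ K * (2 * b ^+ 2) + 36 * alpha * noise * b ^+ 2 / r) +
  4 * noise * b ^+ 2 =
  4 * (1 - r) ^+ K * b ^+ 2 + (108 * noise * b ^+ 2 / rho0 + 4 * noise * b ^+ 2).
  have -> : 36 * alpha * noise * b ^+ 2 / r = 54 * noise * b ^+ 2 / rho0.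
    rewrite /r; move: rho0 rho0_0 => x x0.
    by field; rewrite !gt_eqF.
  by ring.
rewrite lerD2l -lerBrDl -mulrBl.
have -> : 112 * noise * b ^+ 2 - 108 * noise * b ^+ 2 = 4 * noise * b ^+ 2 by ring.
by rewrite ler_peMr ?invf_ge1 // mulr_ge0 // mulr_ge0.
Qed.

End Expectation.
End Critic.

(** * Transfer to the probability space *)

Section TrajectoryExpectation.
Variables (R : realType) (S A : finType) (M : mdp R S A).
Variables (dsp : measure_display) (Omega : measurableType dsp).
Variables (Pr : probability Omega R) (Z : nat -> Omega -> S * A).

Lemma expectation_simple (J : finType) (D : J -> set Omega) (c : J -> R) :
  (forall j, measurable (D j)) ->
  ('E_Pr[fun omega => (\sum_j c j * \1_(D j) omega)%R] =
   \sum_j (c j)%:E * Pr (D j))%E.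
Proof.
move=> mD; rewrite unlock.
under eq_integral do rewrite -sumEFin.
under eq_integral do under eq_bigr do rewrite EFinM.
rewrite integral_sum //; last first.
  by move=> j; apply: integrableZl => //; apply: integrable_indic.
apply: eq_bigr => j _; rewrite integralZl //; last exact: integrable_indic.
by rewrite integral_indic // setIT.
Qed.

Lemma cylinder_measurable N x :
  (forall k z, measurable (Z k @^-1` [set z])) -> measurable (cylinder Z N x).
Proof.
move=> mZ; elim: N => [|N IH].
  have -> : cylinder Z 0 x = Z 0%N @^-1` [set x 0%N]; last exact: mZ.
  apply/seteqP; split => [w /(_ 0%N isT) //|w /= hw k].
  by rewrite leqn0 => /eqP ->.
have -> : cylinder Z N.+1 x = cylinder Z N x `&` Z N.+1 @^-1` [set x N.+1].
  apply/seteqP; split=> [w hw|w [hw /= hw'] k].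
    by split=> [k kN|]; apply: hw => //; apply: leqW.
  by rewrite leq_eqVlt => /orP[/eqP -> //|]; apply: hw.
exact: measurableI.
Qed.

Variables (pib : S -> A -> R) (nu : S -> R) (T : nat) (That : Omega -> 'I_T).
Hypothesis traj : is_trajectory M Pr Z pib nu.
Hypothesis unif : is_uniform_index Pr That.
Hypothesis indep : independent_index Pr Z That.

(** The random variable is a finite combination of indicators of an index value intersected with a
    cylinder, exactly the events whose probabilities the hypotheses give. *)
Lemma expectation_trajectory N (G : 'I_T -> (nat -> S * A) -> R) :
  (forall i, prefix_det N (G i)) ->
  ('E_Pr[fun omega => G (That omega) (fun k => Z k omega)] =
   (T%:R^-1 * \sum_i path_exp M pib (start_law pib nu) N (G i))%R%:E)%E.
Proof.
move=> hG; have [mZ hZ] := traj.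
pose path (x : {ffun 'I_N.+1 -> S * A}) : nat -> S * A := fun k => x (inord k).
pose D (p : 'I_T * {ffun 'I_N.+1 -> S * A}) :=
  That @^-1` [set p.1] `&` cylinder Z N (path p.2).
have -> : (fun omega => G (That omega) (fun k => Z k omega)) =
    (fun omega => \sum_p G p.1 (path p.2) * \1_(D p) omega).
  apply/funext => w; pose x := [ffun k : 'I_N.+1 => Z k w].
  rewrite (bigD1 (That w, x)) //= big1 ?addr0 => [|[i y] /= ne]; last first.
    rewrite indicE memNset ?mulr0 //= => -[/= hi hy]; case/negP: ne.
    apply/eqP; congr (_, _); first by rewrite hi.
    apply/ffunP => k; have := hy k; rewrite /path inord_val ffunE => -> //.
    by rewrite -ltnS.
  rewrite indicE mem_set ?mulr1.
    by apply: hG => k kN; rewrite /path ffunE inordK.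
  by split=> //= k kN; rewrite /path ffunE inordK.
rewrite expectation_simple; last first.
  move=> p; apply: measurableI; first exact: (unif p.1).1.
  exact: cylinder_measurable.
rewrite big_distrr /= -sumEFin sum_pairE; apply: eq_bigr => i _.
rewrite big_distrr /= -sumEFin; apply: eq_bigr => x _.
rewrite /D indep hZ (unif i).2 -!EFinM; congr _%:E; rewrite /path /=; ring.
Qed.

End TrajectoryExpectation.

(** * Choice of the parameters *)

Section StepSizes.
Variables (R : realType) (kc tau cB f g c lam eps : R) (n : nat) (tm : R -> nat).
Hypothesis kc_large : 32 * 40 * 28 <= kc.
Hypothesis tau_ge0 : 0 <= tau.
Hypothesis cB_ge1 : 1 <= cB.
Hypothesis f_large : 1 <= f.
Hypothesis g01 : 0 < g <= 1.
Hypothesis c01 : 0 < c <= 1.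
Hypothesis lam01 : 0 < lam <= 1.
Hypothesis n_gt0 : (0 < n)%N.
Hypothesis eps_small : 0 < eps <= 2^-1.
Hypothesis tm_le : forall a, 0 < a < 1 -> (tm a)%:R <= tau * (1 + ln a^-1).

(** Allowed size of alpha (t_alpha + n + 1): with squared limit norm 10 / (lam g^2 c), the noise
    term divided by c lam must stay below eps^2 g^4 / 32. *)
Definition step_budget : R :=
  eps ^+ 2 * g ^+ 6 * c ^+ 2 * lam ^+ 2 / (kc * f ^+ 2).
Definition step_unit : R := step_budget / ((tau + 2) * n%:R).
Definition step_log : R := 1 + ln step_unit^-1.
(** Resolves the circularity that t_alpha grows with ln(1/alpha): dividing by 2 [step_log] keeps 1 +
    ln(1/alpha) below 2 [step_log]. *)
Definition step_size : R := step_unit / (2 * step_log).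
Definition rate : R := 2 / 3 * (step_size * (c * lam)).
(** Reciprocal of the decay that (1 - rate)^K must reach for the initial error of the critic to
    become negligible. *)
Definition accuracy_inv : R := kc / (eps ^+ 2 * g ^+ 6 * lam * c).
Definition critic_iters : nat := (Num.truncn (ln accuracy_inv / rate)).+1.
Definition actor_iters : nat := (Num.truncn (2 * (cB / g + 2 / g ^+ 2) / eps)).+1.
Definition complexity : R := f ^+ 2 * n%:R * g ^- 8 * c ^- 3 * lam ^- 3.

Let kc_ge : 32 * 40 <= kc.
Proof. by apply: le_trans kc_large; rewrite ler_peMr // ler1n. Qed.
Let kc1 : 1 <= kc.
Proof. by apply: le_trans kc_ge; rewrite mulr_ege1 // ler1n. Qed.
Let kc0 : 0 < kc. Proof. exact: lt_le_trans kc1. Qed.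
Let g0 : 0 < g. Proof. by case/andP: g01. Qed.
Let g1 : g <= 1. Proof. by case/andP: g01. Qed.
Let c0 : 0 < c. Proof. by case/andP: c01. Qed.
Let c1 : c <= 1. Proof. by case/andP: c01. Qed.
Let lam0 : 0 < lam. Proof. by case/andP: lam01. Qed.
Let lam1 : lam <= 1. Proof. by case/andP: lam01. Qed.
Let f0 : 0 < f. Proof. exact: lt_le_trans f_large. Qed.
Let e0 : 0 < eps. Proof. by case/andP: eps_small. Qed.
Let e1 : eps <= 1.
Proof. by case/andP: eps_small => _ /le_trans; apply; rewrite invf_le1 ?ler1n. Qed.
Let n1 : 1 <= n%:R :> R. Proof. by rewrite ler1n. Qed.
Let n0 : 0 < n%:R :> R. Proof. exact: lt_le_trans n1. Qed.
Let tau2 : 0 < tau + 2. Proof. by rewrite ltr_wpDl. Qed.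
Let tau21 : 1 <= tau + 2. Proof. by have := tau_ge0; lra. Qed.

Lemma step_budget_gt0 : 0 < step_budget.
Proof. by rewrite divr_gt0 ?mulr_gt0 ?exprn_gt0. Qed.

Lemma step_budget_le :
  step_budget <= c ^+ 2 * lam ^+ 2 / (kc * f ^+ 2).
Proof.
rewrite ler_pM2r ?invr_gt0 ?mulr_gt0 ?exprn_gt0 // -mulrA ler_piMl //.
  by rewrite mulr_ge0 ?sqr_ge0.
by rewrite mulr_ile1 ?exprn_ge0 ?exprn_ile1 // ltW.
Qed.

Lemma step_unit_gt0 : 0 < step_unit.
Proof. by rewrite divr_gt0 ?step_budget_gt0 ?mulr_gt0. Qed.

Lemma step_unit_inv_ge1 : 1 <= step_unit^-1.
Proof.
rewrite invf_ge1 ?step_unit_gt0 // ler_pdivrMr ?mulr_gt0 // mul1r.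
apply: (@le_trans _ _ 1); last first.
  by rewrite mulr_ege1.
apply: le_trans step_budget_le _.
rewrite ler_pdivrMr ?mulr_gt0 ?exprn_gt0 // mul1r.
apply: (@le_trans _ _ 1).
  by rewrite mulr_ile1 ?exprn_ge0 ?exprn_ile1 // ltW.
by rewrite mulr_ege1 // exprn_ege1.
Qed.

Lemma step_log_ge1 : 1 <= step_log.
Proof. by rewrite lerDl ln_ge0 // step_unit_inv_ge1. Qed.

Let sl0 : 0 < step_log. Proof. exact: lt_le_trans step_log_ge1. Qed.

Lemma step_size_gt0 : 0 < step_size.
Proof. by rewrite divr_gt0 ?step_unit_gt0 // mulr_gt0. Qed.

Lemma ln2_le1 : ln 2 <= 1 :> R.
Proof.
rewrite -ler_expR lnK ?posrE //; have := expR_ge1Dx (1 : R).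
by rewrite -[X in X <= _]/(1 + 1 : R).
Qed.

Lemma ln_le_sub1 (x : R) : 0 < x -> ln x <= x - 1.
Proof.
move=> x0; rewrite lerBrDl -[leRHS]lnK ?posrE //; exact: expR_ge1Dx.
Qed.

Lemma step_size_lt1 : step_size < 1.
Proof.
rewrite ltr_pdivrMr ?mulr_gt0 // mul1r.
apply: (@le_lt_trans _ _ 1).
  by have := step_unit_inv_ge1; rewrite invf_ge1 ?step_unit_gt0.
by have := step_log_ge1; lra.
Qed.

Lemma ln_step_size : 1 + ln step_size^-1 <= 2 * step_log.
Proof.
have u0 := step_unit_gt0.
rewrite /step_size invfM invrK [_ * (2 * _)]mulrC -mulrA.
rewrite !lnM ?posrE ?mulr_gt0 ?invr_gt0 //.
have sE : ln step_unit^-1 = step_log - 1 by rewrite /step_log addrC addKr.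
by have := ln2_le1; have := ln_le_sub1 sl0; rewrite sE; lra.
Qed.

Lemma step_size_budget :
  (tm step_size + n + 1)%:R * step_size <= step_budget.
Proof.
have s0 := step_size_gt0; have u0 := step_unit_gt0.
have h := tm_le (introT andP (conj s0 step_size_lt1)).
have h2 : (tm step_size + n + 1)%:R <= (tau + 2) * n%:R * (2 * step_log).
  rewrite !natrD.
  have q1 := ler_wpM2l tau_ge0 ln_step_size.
  have q2 : tau * (2 * step_log) <= tau * (2 * step_log) * n%:R.
    by rewrite ler_peMr // mulr_ge0 // mulr_ge0 // ltW.
  have q3 : 1 + n%:R <= 2 * n%:R * (2 * step_log).
    have : 2 * n%:R <= 2 * n%:R * (2 * step_log).
      rewrite ler_peMr ?mulr_ge0 //; have := step_log_ge1; lra.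
    by move: n1; move: (n%:R) => *; lra.
  by move: h q1 q2 q3; move: (n%:R) ((tm _)%:R) => *; lra.
apply: le_trans (ler_wpM2r (ltW s0) h2) _.
rewrite le_eqVlt; apply/orP; left; apply/eqP; rewrite /step_size /step_unit.
by field; rewrite !gt_eqF.
Qed.

Lemma rate_gt0 : 0 < rate.
Proof. by rewrite mulr_gt0 ?divr_gt0 // mulr_gt0 ?step_size_gt0 // mulr_gt0. Qed.

Lemma rate_le1 : rate <= 1.
Proof.
have h : step_size * (c * lam) <= 1.
  apply: mulr_ile1; rewrite ?(ltW step_size_gt0) ?(ltW step_size_lt1) //.
    by rewrite ltW // mulr_gt0.
  by rewrite mulr_ile1 // ltW.
rewrite /rate; have : 0 < step_size * (c * lam).
  by rewrite mulr_gt0 ?step_size_gt0 ?mulr_gt0.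
by move: h; move: (step_size * _) => *; lra.
Qed.

Lemma accuracy_inv_ge1 : 1 <= accuracy_inv.
Proof.
rewrite ler_pdivlMr ?mulr_gt0 ?exprn_gt0 // mul1r.
apply: le_trans kc1.
by rewrite !mulr_ile1 ?mulr_ge0 ?exprn_ge0 ?exprn_ile1 // ltW.
Qed.

Let acc0 : 0 < accuracy_inv. Proof. exact: lt_le_trans accuracy_inv_ge1. Qed.

Lemma critic_iters_accuracy :
  40 * (1 - rate) ^+ critic_iters / (lam * g ^+ 2 * c) <=
  eps ^+ 2 * g ^+ 4 / 32.
Proof.
have r0 := rate_gt0.
have q0 : 0 <= ln accuracy_inv / rate.
  by rewrite divr_ge0 ?ln_ge0 ?accuracy_inv_ge1 // ltW.
have /andP[_ q2] := truncn_itv q0; rewrite -/critic_iters in q2.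
have h : (1 - rate) ^+ critic_iters <= accuracy_inv^-1.
  apply: (@le_trans _ _ (expR (- rate) ^+ critic_iters)).
    by rewrite lerXn2r ?nnegrE ?subr_ge0 ?rate_le1 ?expR_ge0 // expR_ge1Dx.
  rewrite -[accuracy_inv^-1]lnK ?posrE ?invr_gt0 // lnV ?posrE //.
  by rewrite -expRM_natl ler_expR mulrN lerN2 -ler_pdivrMr // ltW.
have k0 : 0 < lam * g ^+ 2 * c by rewrite !mulr_gt0 ?exprn_gt0.
rewrite ler_pdivrMr //; apply: le_trans (ler_wpM2l _ h) _ => //.
rewrite /accuracy_inv invfM invrK -subr_ge0.
have -> : eps ^+ 2 * g ^+ 4 / 32 * (lam * g ^+ 2 * c) -
    40 * (kc^-1 * (eps ^+ 2 * g ^+ 6 * lam * c)) =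
    (kc - 32 * 40) * (eps ^+ 2 * g ^+ 6 * lam * c / (32 * kc)).
  by field; rewrite gt_eqF.
rewrite mulr_ge0 ?subr_ge0 // divr_ge0 ?mulr_ge0 ?exprn_ge0 // ltW //.
Qed.

Lemma actor_iters_accuracy :
  (actor_iters%:R)^-1 * ((cB + 2 / g) / g) <= eps / 2.
Proof.
have q0 : 0 <= 2 * (cB / g + 2 / g ^+ 2) / eps.
  rewrite divr_ge0 ?(ltW e0) // mulr_ge0 // addr_ge0 ?divr_ge0 ?sqr_ge0 ?(ltW g0) //.
  exact: le_trans cB_ge1.
have /andP[_ q2] := truncn_itv q0; rewrite -/actor_iters in q2.
rewrite mulrC ler_pdivrMr ?ltr0n //.
rewrite mulrAC ler_pdivlMr // mulrC [eps * _]mulrC -ler_pdivrMr //.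
apply: le_trans (ltW q2); rewrite le_eqVlt; apply/orP; left; apply/eqP.
by field; rewrite !gt_eqF.
Qed.

(** Each summand receives half of the target. The first needs kc >= 32 * 40, the second kc >= 32 *
    112 * 10 = 32 * 40 * 28. *)
Lemma critic_accuracy (x y : R) : 0 <= x -> x <= 10 / (lam * g ^+ 2 * c) ->
  0 <= y -> y <= step_budget * f ^+ 2 ->
  4 * (1 - rate) ^+ critic_iters * x + 112 * y * x / (c * lam) <=
  (eps * g ^+ 2 / 4) ^+ 2.
Proof.
move=> x0 xle y0 yle.
have -> : (eps * g ^+ 2 / 4) ^+ 2 =
    eps ^+ 2 * g ^+ 4 / 32 + eps ^+ 2 * g ^+ 4 / 32 by field.
apply: lerD.
  apply: le_trans critic_iters_accuracy.
  have alg (q : R) : 40 * q / (lam * g ^+ 2 * c) =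
    4 * q * (10 / (lam * g ^+ 2 * c)) by field; rewrite !gt_eqF.
  by rewrite alg ler_wpM2l // mulr_ge0 // exprn_ge0 // subr_ge0 rate_le1.
have cl0 : 0 < c * lam by rewrite mulr_gt0.
rewrite -mulrA -mulrA.
apply: (@le_trans _ _ (112 * (step_budget * f ^+ 2 *
    (10 / (lam * g ^+ 2 * c) / (c * lam))))).
  apply: ler_wpM2l => //; apply: ler_pM => //.
    by rewrite divr_ge0 // ltW.
  by rewrite ler_pM2r ?invr_gt0.
rewrite -subr_ge0.
have -> : eps ^+ 2 * g ^+ 4 / 32 - 112 * (step_budget * f ^+ 2 *
    (10 / (lam * g ^+ 2 * c) / (c * lam))) =
    (kc - 32 * 40 * 28) * (eps ^+ 2 * g ^+ 4 / (32 * kc)).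
  by rewrite /step_budget; field; rewrite !gt_eqF.
by rewrite mulr_ge0 ?subr_ge0 // divr_ge0 ?mulr_ge0 ?exprn_ge0 // ltW.
Qed.

Lemma budget_noise (y : R) : y <= step_budget * f ^+ 2 -> 34 * y <= c * lam.
Proof.
move=> yle; have cl0 : 0 <= c * lam by rewrite mulr_ge0 // ltW.
have h : y <= (c * lam) ^+ 2 / kc.
  apply: le_trans yle _; rewrite -ler_pdivlMr ?exprn_gt0 //.
  apply: le_trans step_budget_le _; rewrite le_eqVlt; apply/orP; left; apply/eqP.
  by field; rewrite !gt_eqF.
have h2 : (c * lam) ^+ 2 / kc <= c * lam / 34.
  rewrite ler_pdivrMr // expr2 -[leRHS]mulrA; apply: ler_wpM2l => //.
  apply: (@le_trans _ _ 1); first by rewrite mulr_ile1 // ltW.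
  by have := kc_ge; lra.
by have := le_trans h h2; lra.
Qed.

Lemma budget_condition (x : R) : 0 < x -> x <= f ->
  step_budget <= c / (456 * x ^+ 2).
Proof.
move=> x0 xf; apply: le_trans step_budget_le _.
have h : c ^+ 2 * lam ^+ 2 <= c.
  rewrite expr2 -mulrA ler_piMr ?(ltW c0) // mulr_ile1 ?exprn_ge0 ?exprn_ile1 // ltW //.
apply: (@le_trans _ _ (c / (kc * f ^+ 2))).
  by rewrite ler_pM2r // invr_gt0 mulr_gt0 ?exprn_gt0.
apply: ler_wpM2l; first exact: ltW.
have k456 : 0 < 456 :> R by rewrite (ltr0n _ 456).
have x20 : 0 < x ^+ 2 by rewrite exprn_gt0.
have f20 : 0 < f ^+ 2 by rewrite exprn_gt0.
rewrite lef_pV2 ?posrE; [|exact: mulr_gt0 kc0 f20|exact: mulr_gt0 k456 x20].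
apply: ler_pM; [exact: ltW|exact: ltW|by have := kc_ge; lra|].
by rewrite lerXn2r ?nnegrE ?(ltW x0) // ltW.
Qed.

Lemma complexity_ge1 : 1 <= complexity.
Proof.
by rewrite /complexity -!exprVn !mulr_ege1 ?exprn_ege1 // invf_ge1.
Qed.

Let X0 : 0 < complexity. Proof. exact: lt_le_trans complexity_ge1. Qed.

Let le_powers (x : R) (i j : nat) : 0 < x <= 1 -> (i <= j)%N -> x ^- i <= x ^- j.
Proof.
move=> /andP[x0 x1] ij; rewrite lef_pV2 ?posrE ?exprn_gt0 //.
by rewrite ler_wiXn2l // ltW.
Qed.

Let log_const : R := 1 + ln (kc * (tau + 2)).

Let ln_eps : ln 2 <= ln eps^-1.
Proof.
rewrite ler_ln ?posrE ?invr_gt0 // -[2]invrK lef_pV2 ?posrE ?invr_gt0 //.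
by case/andP: eps_small.
Qed.

Let ln2_gt0 : 0 < ln 2 :> R. Proof. by rewrite ln_gt0 // ltr1n. Qed.

(** Since eps <= 1/2, ln(1/eps) >= ln 2, so additive constants and ln X can all be absorbed into the
    product ln(1/eps) (1 + ln X). *)
Let log_le (X k x : R) : 1 <= X -> 0 < x -> 0 < k -> k <= kc * (tau + 2) ->
  x <= k * (eps ^- 2 * X) ->
  1 + ln x <= ((log_const + 1) / ln 2 + 2) * (ln eps^-1 * (1 + ln X)).
Proof.
move=> X1 x0 k0 kle xle.
have X0' : 0 < X := lt_le_trans ltr01 X1.
have lX : 0 <= ln X by rewrite ln_ge0.
have q0 : 0 <= log_const by rewrite addr_ge0 // ln_ge0 // mulr_ege1.
have ei0 : 0 < eps^-1 by rewrite invr_gt0.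
have h : ln x <= ln (kc * (tau + 2)) + 2 * ln eps^-1 + ln X.
  apply: (@le_trans _ _ (ln (k * (eps^-1 ^+ 2 * X)))).
    rewrite ler_ln ?posrE //; first by rewrite exprVn.
    by rewrite mulr_gt0 // mulr_gt0 // exprn_gt0.
  have e2 : 0 < eps^-1 ^+ 2 by rewrite exprn_gt0.
  rewrite (lnM k0 (mulr_gt0 e2 X0')) (lnM e2 X0') (lnXn _ ei0) mulr_natl addrA.
  by rewrite !lerD2r ler_ln ?posrE // mulr_gt0.
have le0 : 0 < ln eps^-1 by apply: lt_le_trans ln_eps.
have h1 : log_const + 1 <= (log_const + 1) / ln 2 * ln eps^-1.
  by rewrite mulrAC ler_pdivlMr // ler_wpM2l // addr_ge0.
have h2 : ln X <= (log_const + 1) / ln 2 * ln eps^-1 * ln X.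
  by rewrite ler_peMl // (le_trans _ h1) // lerDr.
have h3 : 0 <= ln eps^-1 * ln X by rewrite mulr_ge0 // ltW.
have lE : log_const = 1 + ln (kc * (tau + 2)) by [].
move: (ln (kc * (tau + 2))) h lE => lk h lE.
move: h h1 h2 h3; rewrite lE; move: ((1 + lk + 1) / ln 2) (ln eps^-1) (ln X) (ln x).
by move=> *; lra.
Qed.

(** The factors bound in turn T, the critic length without logarithms, and the two logarithms. Only
    [kc], [tau] and [cB] occur, so the constant can be fixed before the MDP. *)
Definition complexity_const : R :=
  (2 * cB + 5) * (3 * kc * (tau + 2) + 3) *
  ((2 + ln (kc * (tau + 2))) / ln 2 + 2) ^+ 2.

Lemma samples_le :
  (actor_iters * (critic_iters + n) + 1)%:R <=
  complexity_const * (eps ^- 3 * ln eps^-1 ^+ 2) *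
    (complexity * (1 + ln complexity) ^+ 2).
Proof.
have r0 := rate_gt0; have u0 := step_unit_gt0.
(* The polynomial part of 1 / rate. The squared logarithm comes from [step_log], inside the step
   size, times [L1], from the required accuracy. *)
pose U := n%:R * f ^+ 2 * (eps ^- 2 * g ^- 6 * c ^- 3 * lam ^- 3).
have U1 : n%:R <= U.
  rewrite /U -mulrA ler_peMr //.
  by rewrite -!exprVn !mulr_ege1 ?exprn_ege1 // invf_ge1.
have rE : rate^-1 = 3 * kc * (tau + 2) * step_log * U.
  rewrite /rate /step_size /step_unit /step_budget /U.
  by field; rewrite !gt_eqF.
set L1 := 1 + ln accuracy_inv.
have L11 : 1 <= L1 by rewrite lerDl ln_ge0 // accuracy_inv_ge1.
have hK : (critic_iters + n + 1)%:R <=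
    (3 * kc * (tau + 2) + 3) * step_log * L1 * U.
  have q0 : 0 <= ln accuracy_inv / rate.
    by rewrite divr_ge0 ?ln_ge0 ?accuracy_inv_ge1 // ltW.
  have /andP[q1 _] := truncn_itv q0.
  rewrite !natrD /critic_iters -natr1.
  have k1 : ln accuracy_inv / rate <= 3 * kc * (tau + 2) * step_log * U * L1.
    rewrite rE mulrC ler_wpM2l ?lerDr //.
    by rewrite -rE invr_ge0 ltW.
  have k2 : U <= U * (step_log * L1).
    rewrite ler_peMr ?mulr_ege1 ?step_log_ge1 //.
    by rewrite (le_trans _ U1) // ltW.
  have k3 := le_trans n1 U1; lra.
have hT : actor_iters%:R <= (2 * cB + 5) * (g ^- 2 * eps^-1).
  have q0 : 0 <= 2 * (cB / g + 2 / g ^+ 2) / eps.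
    rewrite divr_ge0 ?(ltW e0) // mulr_ge0 // addr_ge0 ?divr_ge0 ?sqr_ge0 ?(ltW g0) //.
    exact: le_trans cB_ge1.
  have /andP[q1 _] := truncn_itv q0; rewrite /actor_iters -natr1.
  have k1 : g^-1 <= g ^- 2 by rewrite -[g^-1]expr1 exprVn le_powers.
  have k2 : 1 <= g ^- 2 * eps^-1.
    by rewrite -exprVn mulr_ege1 ?exprn_ege1 // invf_ge1.
  have k3 : cB * g^-1 * eps^-1 <= cB * g ^- 2 * eps^-1.
    by rewrite ler_wpM2r ?invr_ge0 ?(ltW e0) // ler_wpM2l // (le_trans ler01).
  have E : 2 * (cB / g + 2 / g ^+ 2) / eps =
    2 * (cB * g^-1 * eps^-1) + 4 * (g ^- 2 * eps^-1) by ring.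
  move: q1 k3; rewrite E; move: (g^-1) (g ^- 2) (eps^-1) k2 => *; lra.
have UX : g ^- 2 * eps^-1 * U = eps ^- 3 * complexity.
  by rewrite /U /complexity; field; rewrite !gt_eqF.
set c3 := (2 + ln (kc * (tau + 2))) / ln 2 + 2.
set Lg := ln eps^-1 * (1 + ln complexity).
have c3E : c3 = (log_const + 1) / ln 2 + 2.
  by rewrite /c3 /log_const; congr (_ / _ + _); ring.
have hsl : step_log <= c3 * Lg.
  rewrite c3E; apply: (@log_le _ (kc * (tau + 2))) => //.
  - exact: complexity_ge1.
  - by rewrite invr_gt0.
  - by rewrite mulr_gt0.
  have -> : step_unit^-1 = kc * (tau + 2) *
      (eps ^- 2 * (f ^+ 2 * n%:R * g ^- 6 * c ^- 2 * lam ^- 2)).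
    by rewrite /step_unit /step_budget; field; rewrite !gt_eqF.
  apply: ler_wpM2l; first by rewrite ltW // mulr_gt0.
  apply: ler_wpM2l; first by rewrite invr_ge0 exprn_ge0 // ltW.
  by rewrite /complexity !ler_pM ?mulr_ge0 ?invr_ge0 ?exprn_ge0 ?le_powers // ltW.
have hL1 : L1 <= c3 * Lg.
  rewrite c3E; apply: (@log_le _ kc) => //; first exact: complexity_ge1.
    by rewrite ler_peMr // ltW.
  have -> : accuracy_inv = kc * (eps ^- 2 * (g ^- 6 * (c ^- 1 * lam ^- 1))).
    by rewrite /accuracy_inv; field; rewrite !gt_eqF.
  apply: ler_wpM2l; first exact: ltW.
  apply: ler_wpM2l; first by rewrite invr_ge0 exprn_ge0 // ltW.
  have -> : complexity = f ^+ 2 * n%:R * (g ^- 8 * (c ^- 3 * lam ^- 3)).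
    by rewrite /complexity -!mulrA.
  rewrite -[leLHS]mul1r; apply: ler_pM => //.
  - by rewrite !mulr_ge0 ?invr_ge0 ?exprn_ge0 // ltW.
  - by rewrite mulr_ege1 // exprn_ege1.
  by rewrite !ler_pM ?mulr_ge0 ?invr_ge0 ?exprn_ge0 ?le_powers // ltW.
have slL : step_log * L1 <= (c3 * Lg) ^+ 2.
  by rewrite expr2 ler_pM ?(ltW sl0) // (le_trans ler01).
(* The single extra sample is absorbed because there is at least one actor iteration. *)
apply: (@le_trans _ _ (actor_iters%:R * (critic_iters + n + 1)%:R)).
  by rewrite -natrM ler_nat [leqRHS]mulnDr muln1 leq_add2l.
apply: le_trans (ler_pM _ _ hT hK) _ => //.
have -> : (2 * cB + 5) * (g ^- 2 * eps^-1) *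
    ((3 * kc * (tau + 2) + 3) * step_log * L1 * U) =
  (2 * cB + 5) * (3 * kc * (tau + 2) + 3) * (eps ^- 3 * complexity) *
    (step_log * L1) by rewrite -UX; ring.
have -> : complexity_const * (eps ^- 3 * ln eps^-1 ^+ 2) *
    (complexity * (1 + ln complexity) ^+ 2) =
  (2 * cB + 5) * (3 * kc * (tau + 2) + 3) * (eps ^- 3 * complexity) *
    (c3 * Lg) ^+ 2 by rewrite /complexity_const -/c3 /Lg; ring.
apply: ler_wpM2l slL; apply: mulr_ge0; apply: mulr_ge0.
- by have := cB_ge1; lra.
- by rewrite addr_ge0 // mulr_ge0 ?(ltW tau2) // mulr_ge0 // ltW.
- by rewrite invr_ge0 exprn_ge0 // ltW.
- exact: ltW.
Qed.

End StepSizes.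

(** * Regret of the actor-critic iteration *)

Lemma pmf_card_gt0 (R : realType) (T : finType) (p : T -> R) :
  is_pmf p -> (0 < #|T|)%N.
Proof.
move=> [_ p1]; rewrite lt0n; apply/negP => /eqP /card0_eq T0.
by move/eqP: p1; rewrite (big_pred0 _ _ _ _ T0) eq_sym oner_eq0.
Qed.

Lemma path_expB (R : realType) (S A : finType) (M : mdp R S A) pi init N
    (G H : (nat -> S * A) -> R) :
  path_exp M pi init N (fun z => G z - H z) =
  path_exp M pi init N G - path_exp M pi init N H.
Proof. by rewrite -sumrB /=; apply: eq_bigr => x _; rewrite mulrBr. Qed.

Section ActorCritic.
Variables (R : realType) (S A : finType) (M : mdp R S A).
Variables (d : nat) (phi : S -> A -> 'cV[R]_d).
Variables (pib : S -> A -> R) (mub : S -> R) (lam gamma_c : R) (n : nat).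
Local Notation gam := (discount M).
Local Notation f := (f_geom n (gam * zeta_max pib)).
Local Notation xi := (xi_err M phi pib mub n).
Hypothesis pib_policy : is_policy pib.
Hypothesis pib_gt0 : forall s a, 0 < pib s a.
Hypothesis mub_pmf : is_pmf mub.
Hypothesis mub_gt0 : forall s, 0 < mub s.
Hypothesis phi_norm : forall s a, \sum_i `|phi s a i 0| <= 1.
Hypothesis phi_free : features_free phi.
Hypothesis lam_min : is_min_eigenvalue phi pib mub lam.
Hypothesis d_gt0 : (0 < d)%N.
Hypothesis gc01 : 0 < gamma_c < 1.
Hypothesis n_gt0 : (0 < n)%N.
Hypothesis n_large :
  (2 * ln gamma_c + ln (kappa_min pib mub)) / (2 * ln gam) <= n%:R.
Hypothesis A_gt0 : (0 < #|A|)%N.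
Variables (theta0 : 'cV[R]_d) (B : R).
Hypothesis B_ge0 : 0 <= B.
Hypothesis theta0_le : forall i, `|theta0 i 0| <= B.
Variables (alpha : R) (t_mixing K T : nat).
Local Notation beta := (ln #|A|%:R : R).
Local Notation block := (K + n)%N.

Definition actor_at (z : nat -> S * A) (t : nat) : 'cV[R]_d :=
  actor M phi pib n z theta0 alpha beta K t.

Definition critic_at (z : nat -> S * A) (t : nat) : 'cV[R]_d :=
  critic M phi pib n (softmax phi (actor_at z t))
    (fun k => z (t * block + k)%N) alpha 0 K.

Definition critic_err (z : nat -> S * A) (t : nat) : 'cV[R]_d :=
  critic_at z t - wstar M phi pib mub n (softmax phi (actor_at z t)).

(** The horizon includes the observation at which block t starts; [critic_expectation] lets the
    target policy depend on it. *)
Lemma actor_prefix t : prefix_det (t * block) (fun z => actor_at z t).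
Proof using n_gt0.
elim: t => [|t IH] z z' h //.
have ht : actor_at z t = actor_at z' t.
  by apply: IH => k kt; apply/h/(leq_trans kt); rewrite mulSn leq_addl.
rewrite /actor_at /= -/(actor_at z t) -/(actor_at z' t) ht; congr (_ + _ *: _).
apply: (critic_prefix M phi pib n_gt0 alpha _ (N := block)) => // i ib.
by apply: h; rewrite mulSnr leq_add2l.
Qed.

Lemma critic_at_prefix t : prefix_det (t.+1 * block) (fun z => critic_at z t).
Proof using n_gt0.
move=> z z' h; rewrite /critic_at (@actor_prefix t z z'); last first.
  by move=> k kt; apply/h/(leq_trans kt); rewrite mulSn leq_addl.
apply: (critic_prefix M phi pib n_gt0 alpha _ (N := block)) => // i ib.
by apply: h; rewrite mulSnr leq_add2l.
Qed.

Lemma critic_err_prefix t : prefix_det (t.+1 * block) (fun z => critic_err z t).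
Proof using n_gt0.
move=> z z' h; rewrite /critic_err (critic_at_prefix h) (@actor_prefix t z z') //.
by move=> k kt; apply/h/(leq_trans kt); rewrite mulSn leq_addl.
Qed.

Lemma policy_unique (p p' : S -> A -> R) : #|A| = 1%N ->
  is_policy p -> is_policy p' -> p = p'.
Proof.
move=> A1 hp hp'; apply/funext => s; apply/funext => a.
have /fintype_le1P hA : (#|A| <= 1)%N by rewrite A1.
have h1 (q : S -> A -> R) : is_policy q -> q s a = 1.
  move=> hq; rewrite -(hq s).2 (bigD1 a) //= big1 ?addr0 // => b.
  by rewrite (hA a b) eqxx.
by rewrite !h1.
Qed.

(** Bounds (ln|A| + 2 B) / beta when |A| >= 2, uniformly in |A|. *)
Let cB : R := 1 + 2 * B / ln 2.

Lemma regret_le (pistar : S -> A -> R) (mu : S -> R) z :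
  is_policy pistar -> is_pmf mu ->
  \sum_(t < T) (V_mean M pistar mu - V_mean M (softmax phi (actor_at z t)) mu) <=
  (cB + 2 / (1 - gam) +
   2 * (\sum_(t < T) (xi + linf (critic_err z t))) / (1 - gam)) / (1 - gam).
Proof.
move=> hstar hmu; have g1 := discount_compl_gt0 M.
have l2 : 0 < ln 2 :> R by rewrite ln_gt0 // ltr1n.
have e_ge s a t : `|Q_fun M (softmax phi (actor_at z t)) s a -
    lin phi (critic_at z t) s a| <= xi + linf (critic_err z t).
  set pi := softmax phi (actor_at z t); set ws := wstar M phi pib mub n pi.
  have -> : Q_fun M pi s a - lin phi (critic_at z t) s a =
      (Q_fun M pi s a - lin phi ws s a) - lin phi (critic_err z t) s a.
    by rewrite /critic_err linB; ring.
  apply: le_trans (ler_normB _ _) _; apply: lerD.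
    by apply: (@xi_ub _ _ _ _ _ _ _ _ lam gamma_c) => //;
      [exact: kap_pos|exact: (kap_pmf _ _).2].
  exact: (linz_norm phi_norm _ (s, a)).
(* With a single action beta = 0 and [npg_regret] does not apply, but then all policies coincide and
   the regret vanishes. *)
have [A1|A2] := leqP #|A| 1.
  have A1' : #|A| = 1%N by apply/eqP; rewrite eqn_leq A1.
  rewrite big1 => [|t _]; last first.
    by rewrite (policy_unique A1' hstar (softmax_policy phi A_gt0 (actor_at z t))) subrr.
  have e0 t : 0 <= xi + linf (critic_err z t).
    have /card_gt0P[a _] := A_gt0.
    have /card_gt0P[s _] := pmf_card_gt0 hmu.
    exact: le_trans (e_ge s a t).
  rewrite divr_ge0 ?(ltW g1) // !addr_ge0 // ?divr_ge0 ?(ltW g1) ?(ltW l2) //.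
    by rewrite mulr_ge0.
  by rewrite mulr_ge0 // sumr_ge0.
have b0 : 0 < beta by rewrite ln_gt0 // ltr1n.
have reg s := npg_regret A_gt0 hstar b0 (theta := actor_at z)
  (w := critic_at z) (fun t => erefl) (fun t s a => e_ge s a t) T s.
set psi0 := \big[Num.max/0]_s _ in reg.
have hpsi : psi0 / beta <= cB.
  have p1 : psi0 <= beta + 2 * B.
    apply/bigmax_leP; split=> [|s _].
      by rewrite addr_ge0 ?(ltW b0) // mulr_ge0.
    rewrite /cross_entropy -sumrN -[leRHS](pmf_sum_cst _ (hstar s)).
    apply: ler_sum => a _; rewrite -mulrN ler_wpM2l ?(hstar s).1 //.
    exact: softmax_init_ln.
  rewrite ler_pdivrMr // /cB mulrDl mul1r; apply: le_trans p1 _.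
  rewrite lerD2l mulrAC ler_pdivlMr // ler_wpM2l ?mulr_ge0 //.
  by rewrite ler_ln ?posrE ?ltr0n // ler_nat.
have -> : \sum_(t < T)
    (V_mean M pistar mu - V_mean M (softmax phi (actor_at z t)) mu) =
  \sum_s mu s * \sum_(t < T)
    (V_fun M pistar s - V_fun M (softmax phi (actor_at z t)) s).
  under [RHS]eq_bigr do rewrite big_distrr /=.
  rewrite exchange_big /=; apply: eq_bigr => t _.
  by rewrite /V_mean -sumrB; apply: eq_bigr => s _; rewrite mulrBr.
rewrite -[leRHS](pmf_sum_cst _ hmu); apply: ler_sum => s _.
rewrite ler_wpM2l ?hmu.1 //; apply: le_trans (reg s) _.
by rewrite ler_pM2r ?invr_gt0 // lerD2r lerD2r.
Qed.

Hypothesis alpha_gt0 : 0 < alpha.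
Hypothesis t_mixed : mixed M pib mub alpha t_mixing.
Local Notation noise := ((t_mixing + n + 1)%:R * alpha * f ^+ 2).
Local Notation rho0 := ((1 - gamma_c) * lam).
Hypothesis alpha_small : 34 * noise <= rho0.
Hypothesis T_gt0 : (0 < T)%N.

Variables (eta : R) (init : S * A -> R).
Hypothesis eta_gt0 : 0 < eta.
Hypothesis init_pmf : is_pmf init.
Hypothesis critic_accuracy :
  4 * (1 - 2 / 3 * (alpha * rho0)) ^+ K * (1 + wbound M lam gamma_c) ^+ 2 +
  112 * noise * (1 + wbound M lam gamma_c) ^+ 2 / rho0 <= eta ^+ 2.
Local Notation E := (path_exp M pib init (T * block)).

Lemma critic_err_expectation (t : 'I_T) : E (fun z => linf (critic_err z t)) <= eta.
Proof.
have i0 := init_pmf.1.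
have h2 : E (fun z => dot (critic_err z t) (critic_err z t)) <= eta ^+ 2.
  have tT : (t.+1 * block <= T * block)%N by rewrite leq_mul2r ltn_ord orbT.
  have -> : E (fun z => dot (critic_err z t) (critic_err z t)) =
      path_exp M pib init (t * block + K + n)
        (fun z => dot (critic_err z t) (critic_err z t)).
    have -> : (t * block + K + n = t.+1 * block)%N by rewrite -addnA -mulSnr.
    have hG : prefix_det (t.+1 * block)
        (fun z => dot (critic_err z t) (critic_err z t)).
      by move=> z z' h; rewrite (critic_err_prefix h).
    have := path_exp_widen M init (T * block - t.+1 * block) pib_policy hG.
    by rewrite (subnKC tT).
  apply: le_trans critic_accuracy.
  apply: (critic_expectation _ _ _ _ _ _ _ _ _ _ _ _ t_mixed _ _ _
    (target := fun z => softmax phi (actor_at z t))) => // [z|z z' h].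
    exact: softmax_policy.
  by rewrite (actor_prefix h).
(* Second to first moment by l <= eta/2 + l^2/(2 eta), which loses nothing when the second moment is
   eta^2. *)
apply: (@le_trans _ _ (E (fun z => eta / 2 + (2 * eta)^-1 *
    dot (critic_err z t) (critic_err z t)))).
  apply: path_exp_le => // z; apply: le_trans (_ : eta / 2 + (2 * eta)^-1 *
    linf (critic_err z t) ^+ 2 <= _); last first.
    by rewrite lerD2l ler_wpM2l ?linf_sqr_le // invr_ge0 mulr_ge0 // ltW.
  rewrite -subr_ge0; set l := linf _.
  have -> : eta / 2 + (2 * eta)^-1 * l ^+ 2 - l = (2 * eta)^-1 * (eta - l) ^+ 2.
    by field; rewrite gt_eqF.
  by rewrite mulr_ge0 ?sqr_ge0 // invr_ge0 mulr_ge0 // ltW.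
rewrite path_expD path_exp_cst // (path_expZ M pib init _ (2 * eta)^-1).
apply: le_trans (lerD (lexx _) (ler_wpM2l _ h2)) _.
  by rewrite invr_ge0 mulr_ge0 // ltW.
by rewrite le_eqVlt; apply/orP; left; apply/eqP; field; rewrite gt_eqF.
Qed.

Lemma expected_regret_le (pistar : S -> A -> R) (mu : S -> R) :
  is_policy pistar -> is_pmf mu ->
  V_mean M pistar mu - T%:R^-1 * (\sum_(t < T)
    E (fun z => V_mean M (softmax phi (actor_at z t)) mu)) <=
  T%:R^-1 * ((cB + 2 / (1 - gam)) / (1 - gam)) +
  2 * (xi + eta) / (1 - gam) ^+ 2.
Proof.
move=> hstar hmu; have g1 := discount_compl_gt0 M; have i0 := init_pmf.1.
have T0 : 0 < T%:R :> R by rewrite ltr0n.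
have -> : V_mean M pistar mu - T%:R^-1 * (\sum_(t < T)
    E (fun z => V_mean M (softmax phi (actor_at z t)) mu)) =
  T%:R^-1 * E (fun z => \sum_(t < T)
    (V_mean M pistar mu - V_mean M (softmax phi (actor_at z t)) mu)).
  rewrite path_exp_sum; under [X in _ = _ * X]eq_bigr do
    rewrite path_expB path_exp_cst //.
  by rewrite sumrB sumr_const card_ord -[V_mean M pistar mu *+ T]mulr_natl mulrBr mulKf ?gt_eqF.
pose c1 : R := (cB + 2 / (1 - gam)) / (1 - gam).
pose c2 : R := 2 / (1 - gam) ^+ 2.
have step : E (fun z => \sum_(t < T)
    (V_mean M pistar mu - V_mean M (softmax phi (actor_at z t)) mu)) <=
    c1 + c2 * (T%:R * (xi + eta)).
  apply: (@le_trans _ _ (E (fun z => c1 + c2 *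
      \sum_(t < T) (xi + linf (critic_err z t))))).
    apply: path_exp_le => // z; apply: le_trans (regret_le z hstar hmu) _.
    rewrite le_eqVlt; apply/orP; left; apply/eqP.
    by rewrite /c1 /c2; field; rewrite gt_eqF.
  rewrite path_expD path_exp_cst // path_expZ lerD2l ler_wpM2l //.
    by rewrite divr_ge0 ?sqr_ge0.
  rewrite path_exp_sum mulr_natl -[X in _ *+ X]card_ord -sumr_const.
  apply: ler_sum => t _; rewrite path_expD path_exp_cst // lerD2l.
  exact: critic_err_expectation.
have := ler_wpM2l (ltW (_ : 0 < T%:R^-1)) step; rewrite invr_gt0 => /(_ T0).
move=> /le_trans; apply; rewrite mulrDr lerD2l.
rewrite le_eqVlt; apply/orP; left; apply/eqP; rewrite /c2.
by field; rewrite !gt_eqF.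
Qed.

End ActorCritic.

(** (1 + W)^2 <= 2 + 2 W^2 with W^2 = 4/D and D <= 1, whence 2 + 8/D <= 10/D. *)
Lemma wbound_sqr_le (R : realType) (S A : finType) (M : mdp R S A)
    (lam gamma_c : R) : 0 < lam <= 1 -> 0 < gamma_c < 1 ->
  (1 + wbound M lam gamma_c) ^+ 2 <=
  10 / (lam * (1 - discount M) ^+ 2 * (1 - gamma_c)).
Proof.
move=> /andP[lam0 lam1] gc01; have g1 := discount_compl_gt0 M.
have /andP[gc0 gc1] := gc01.
pose D := lam * (1 - discount M) ^+ 2 * (1 - gamma_c).
have c0 : 0 < 1 - gamma_c by rewrite subr_gt0.
have D0 : 0 < D by rewrite !mulr_gt0 ?exprn_gt0.
have D1 : D <= 1.
  apply: mulr_ile1; [by rewrite mulr_ge0 ?sqr_ge0 ?ltW|exact: ltW| |].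
    apply: mulr_ile1; [exact: ltW|exact: sqr_ge0|by []|].
    by apply: exprn_ile1; rewrite ?(ltW g1) // gerBl ltW ?discount_gt0.
  by rewrite gerBl ltW.
have Di : 1 <= D^-1 by rewrite invf_ge1.
have W2 : wbound M lam gamma_c ^+ 2 = 4 * D^-1.
  by rewrite sqr_sqrtr // divr_ge0 // ltW.
rewrite -/D; have := sqr_ge0 (1 - wbound M lam gamma_c).
rewrite sqrrB sqrrD W2 !mul1r expr1n.
move: (wbound M lam gamma_c) (D^-1) Di => *; lra.
Qed.

Theorem corollary2p2p1 (R : realType) (tau B : R) :
  exists (C : R) (p : nat),
  forall (S A : finType) (M : mdp R S A) (d : nat)
    (phi : S -> A -> 'cV[R]_d) (pib : S -> A -> R) (mub : S -> R)
    (lam gamma_c : R) (n : nat) (theta0 : 'cV[R]_d),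
  (0 < d)%N ->
  features_free phi ->
  (forall s a, \sum_i `|phi s a i 0| <= 1) ->
  is_policy pib ->
  (forall s a, 0 < pib s a) ->
  irreducible_chain M pib ->
  aperiodic_chain M pib ->
  is_stationary M pib mub ->
  is_min_eigenvalue phi pib mub lam ->
  0 < gamma_c < 1 ->
  (0 < n)%N ->
  (2 * ln gamma_c + ln (kappa_min pib mub)) / (2 * ln (discount M)) <= n%:R ->
  mixing_constant M pib mub <= tau ->
  (forall i, `|theta0 i 0| <= B) ->
  forall eps : R, 0 < eps <= 2^-1 ->
  exists (alpha : R) (K T : nat),
    [/\ 0 < alpha,
        forall theta : 'cV[R]_d,
          alpha * (t_mix M pib mub alpha + n + 1)%:R <=
          (1 - gamma_c) /
          (456 * f_geom n (discount M * zeta pib (softmax phi theta)) ^+ 2),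
        (0 < T)%N,
        forall (dsp : measure_display) (Omega : measurableType dsp)
          (Pr : probability Omega R) (Z : nat -> Omega -> S * A)
          (That : Omega -> 'I_T) (nu mu : S -> R) (pistar : S -> A -> R),
          is_pmf nu ->
          is_trajectory M Pr Z pib nu ->
          is_uniform_index Pr That ->
          independent_index Pr Z That ->
          is_pmf mu ->
          is_optimal M pistar mu ->
          ((V_mean M pistar mu)%:E -
             'E_Pr[fun omega => V_mean M (softmax phi
                (actor M phi pib n (fun k => Z k omega) theta0 alpha
                   (ln #|A|%:R) K (That omega))) mu]
           <= (eps + 4 * xi_err M phi pib mub n / (1 - discount M) ^+ 2)%:E)%E
      & let X := complexity_factor (f_geom n (discount M * zeta_max pib)) n
                   (discount M) gamma_c lam in
        (T * (K + n) + 1)%:R <=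
        C * (eps ^- 3 * ln eps^-1 ^+ 2) * (X * (1 + ln X) ^+ p) ].
Proof.
have l2 : 0 < ln 2 :> R by rewrite ln_gt0 // ltr1n.
(* [tau] and [B] are arbitrary reals; the parameter lemmas need nonnegative bounds. *)
pose tau' : R := Num.max tau 0; pose B' : R := Num.max B 0.
have tau0 : 0 <= tau' by rewrite le_max lexx orbT.
have B0 : 0 <= B' by rewrite le_max lexx orbT.
pose cB : R := 1 + 2 * B' / ln 2; pose kc : R := 32 * 40 * 28.
have cB1 : 1 <= cB by rewrite lerDl divr_ge0 ?(ltW l2) // mulr_ge0.
exists (complexity_const kc tau' cB), 2%N.
move=> S A M d phi pib mub lam gamma_c n theta0 d_gt0 phi_free phi_norm hpib.
move=> pib0 irr aper stat lam_min gc01 n_gt0 n_large htau htheta eps eps01.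
have mub_pmf := stat.1; have mub0 := stationary_gt0 hpib irr aper stat.
have kap0 := kap_pos pib0 mub0; have kap1 := (kap_pmf hpib mub_pmf).2.
have lam0 := min_eigenvalue_gt0 kap0 phi_free lam_min.
have lam1 := min_eigenvalue_le1 phi_norm kap0 kap1 lam_min.
have /andP[gc0 gc1] := gc01; have g0 := discount_compl_gt0 M.
have g01 : 0 < 1 - discount M <= 1 by rewrite g0 gerBl ltW ?discount_gt0.
have c01 : 0 < 1 - gamma_c <= 1 by rewrite subr_gt0 gc1 gerBl ltW.
have lam01 : 0 < lam <= 1 by rewrite lam0 lam1.
pose f := f_geom n (discount M * zeta_max pib).
have f1 : 1 <= f := f_ge1 M pib n.
have /andP[eps0 _] := eps01.
have /card_gt0P[s0 _] := pmf_card_gt0 mub_pmf.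
have A_gt0 := pmf_card_gt0 (hpib s0).
have kcl : 32 * 40 * 28 <= kc by [].
have tm_le (a : R) : 0 < a < 1 ->
    (t_mix M pib mub a)%:R <= tau' * (1 + ln a^-1).
  move=> ha; apply: (t_mix_le hpib irr aper stat ha).
  by rewrite le_max htau.
pose alpha := step_size kc tau' f (1 - discount M) (1 - gamma_c) lam eps n.
pose K := critic_iters kc tau' f (1 - discount M) (1 - gamma_c) lam eps n.
pose T := actor_iters cB (1 - discount M) eps.
have a0 : 0 < alpha by apply: step_size_gt0.
have a1 : alpha < 1 by apply: step_size_lt1.
have budget := step_size_budget kcl tau0 f1 g01 c01 lam01 n_gt0 eps01 tm_le.
rewrite -/alpha in budget.
have mixed_a := (t_mixP hpib irr aper stat (introT andP (conj a0 a1))).1.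
pose y : R := (t_mix M pib mub alpha + n + 1)%:R * alpha * f ^+ 2.
have y0 : 0 <= y by rewrite mulr_ge0 ?sqr_ge0 // mulr_ge0 // ltW.
have yle : y <= step_budget kc f (1 - discount M) (1 - gamma_c) lam eps * f ^+ 2.
  by rewrite ler_wpM2r ?sqr_ge0.
have small : 34 * y <= (1 - gamma_c) * lam by apply: budget_noise yle.
have acc := critic_accuracy kcl tau0 f1 g01 c01 lam01 n_gt0 eps01
  (sqr_ge0 (1 + wbound M lam gamma_c)) (wbound_sqr_le M lam01 gc01) y0 yle.
exists alpha, K, T; split=> //.
- move=> theta; rewrite mulrC; apply: le_trans budget _.
  have hpol := softmax_policy phi A_gt0 theta.
  have z0 : 0 <= discount M * zeta pib (softmax phi theta).
    by rewrite mulr_ge0 ?(ltW (discount_gt0 M)) //; apply: bigmax_ge_id.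
  apply: (budget_condition (kc := kc)) => //.
    exact: lt_le_trans ltr01 (f_geom_ge1 n z0).
  apply: f_geom_le => //; rewrite ler_wpM2l ?(ltW (discount_gt0 M)) //.
  by apply/bigmax_leP; split=> [|z _]; [exact: zeta_max_ge0|exact: rho_le].
- move=> dsp Omega Pr Z That nu mu pistar hnu traj unif indep hmu [hstar _].
  have htheta' i : `|theta0 i 0| <= B' by rewrite le_max htheta.
  (* This critic accuracy makes 2 eta / (1 - gam)^2 equal to eps/2; the choice of T supplies the
     other half. *)
  have eta0 : 0 < eps * (1 - discount M) ^+ 2 / 4.
    by rewrite divr_gt0 // mulr_gt0 // exprn_gt0.
  have init_pmf := start_law_pmf hpib hnu.
  have main := expected_regret_le hpib pib0 mub_pmf mub0 phi_norm phi_free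
    lam_min d_gt0 gc01 n_gt0 n_large A_gt0 B0 htheta' a0 mixed_a small
    (ltn0Sn _ : (0 < T)%N) eta0 init_pmf acc hstar hmu.
  rewrite (expectation_trajectory traj unif indep (N := T * (K + n))
    (G := fun t z => V_mean M (softmax phi (actor_at M phi pib n theta0 alpha K z t)) mu));
    last first.
    move=> i z z' h; congr (V_mean M (softmax phi _) mu).
    apply: actor_prefix => // k ki; apply: h; apply: leq_trans ki _.
    by rewrite leq_mul2r ltnW ?orbT.
  rewrite -EFinB lee_fin; apply: le_trans main _.
  have xi0 : 0 <= xi_err M phi pib mub n.
    have /card_gt0P[a' _] := A_gt0.
    apply: le_trans (xi_ub kap0 kap1 phi_norm phi_free lam_min d_gt0 gc01
      n_large A_gt0 0 s0 a') => //.
  have := actor_iters_accuracy cB1 g01 eps01; rewrite -/T -/cB => hT.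
  have -> : 2 * (xi_err M phi pib mub n + eps * (1 - discount M) ^+ 2 / 4) /
      (1 - discount M) ^+ 2 =
      2 * xi_err M phi pib mub n / (1 - discount M) ^+ 2 + eps / 2.
    by field; rewrite gt_eqF.
  (* The regret bound carries the coefficient 2 on [xi_err]; nonnegativity of [xi_err] allows the
     stated 4. *)
  have h24 : 2 * xi_err M phi pib mub n / (1 - discount M) ^+ 2 <=
      4 * xi_err M phi pib mub n / (1 - discount M) ^+ 2.
    by rewrite ler_pM2r ?invr_gt0 ?exprn_gt0 // ler_wpM2r // ler_nat.
  have -> : eps + 4 * xi_err M phi pib mub n / (1 - discount M) ^+ 2 =
      eps / 2 + (4 * xi_err M phi pib mub n / (1 - discount M) ^+ 2 + eps / 2).
    by move: (4 * _ / _) => w; field.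
  by apply: lerD => //; rewrite lerD2r.
- exact: (samples_le kcl tau0 cB1 f1 g01 c01 lam01 n_gt0 eps01).
Qed.
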